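(* Let $p$ be a prime and $s>-1$. Let $\nu^{(s)}$ be the unique probability measure on $\Delta$ such that $\mathsf{M}^{(s)}=\int_{\Delta}\mu_{\mathbf{k}}\,\nu^{(s)}(d\mathbf{k})$ (i.e. $\mathsf{M}^{(s)}(\mathfrak{F})=\int_\Delta \mu_{\mathbf{k}}(\mathfrak{F})\,\nu^{(s)}(d\mathbf{k})$ for every bounded Borel function $\mathfrak{F}$ on $\mathrm{Mat}(\mathbb{N},\mathbb{Q}_p)$). Then $\nu^{(s)}$ is supported on $\Delta_0$. Moreover, if $\mathbf{k}$ is random with law $\nu^{(s)}$, then the sequence $\{\mathsf{X}_i(\mathbf{k})\}_{i=1}^\infty$, where $\mathsf{X}_i(\mathbf{k})=\sum_{j=i}^{\infty}l_j(\mathbf{k})$, is a time-homogeneous Markov chain on $\mathbb{Z}_+$ with initial distribution $\pi^{(s)}$ and transition kernel $\mathsf{P}^{(s)}$; that is, $\sum_{i\ge1}l_i(\mathbf{k})$ has law $\pi^{(s)}$ and the conditional law of $\sum_{j\ge i+1}l_j(\mathbf{k})$ given the previous values is $\mathsf{P}^{(s)}\big(\sum_{j\ge i}l_j(\mathbf{k}),\cdot\big)$. Equivalently, for every $\mathbf{k}\in\Delta_0$, \[ \nu^{(s)}(\mathbf{k})=\left(p^{-1-s};p^{-1}\right)_\infty\, p^{-\sum_{i=1}^{\infty}\left(\sum_{j=i}^{\infty}l_j(\mathbf{k})\right)^2-s\sum_{i=1}^{\infty}i\,l_i(\mathbf{k})}\prod_{i=1}^{\infty}\frac{1}{\left(p^{-1};p^{-1}\right)_{l_i(\mathbf{k})}}.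 \]
   Context: $\mathbb{Q}_p$ is the field of $p$-adic numbers with absolute value $|\cdot|$, $\mathbb{Z}_p=\{x:|x|\le1\}$. $(\alpha;q)_N=\prod_{j=0}^{N-1}(1-\alpha q^j)$, $(\alpha;q)_0=1$, $(\alpha;q)_\infty=\prod_{j\ge0}(1-\alpha q^j)$. $\mathsf{vol}$ denotes the Haar measure on $\mathrm{Mat}(N,\mathbb{Q}_p)\simeq\mathbb{Q}_p^{N^2}$ normalized so that $\mathsf{vol}(\mathrm{Mat}(N,\mathbb{Z}_p))=1$. Every $\mathbf{Z}\in\mathrm{Mat}(N,\mathbb{Q}_p)$ can be written $\mathbf{Z}=\mathbf{B}\,\mathrm{diag}(p^{-k_1},\dots,p^{-k_N})\,\mathbf{C}$ with $\mathbf{B},\mathbf{C}\in\mathrm{GL}(N,\mathbb{Z}_p)$ and uniquely determined $k_1\ge\dots\ge k_N\ge-\infty$ (with $p^{-(-\infty)}=0$), the singular numbers of $\mathbf{Z}$. Define $\gamma(\mathbf{Z})=\prod_{j:k_j>0}p^{k_j}$ ($=1$ if all $k_j\le0$), and for $s>-1$ the probability measure $d\mathsf{M}_N^{(s)}(\mathbf{Z})=\frac{(p^{-1-s};p^{-1})_N^2}{(p^{-1-s};p^{-1})_{2N}}\gamma(\mathbf{Z})^{-s-2N}d\mathsf{vol}(\mathbf{Z})$ on $\mathrm{Mat}(N,\mathbb{Q}_p)$. $\mathrm{Mat}(\mathbb{N},\mathbb{Q}_p)$ is the space of infinite matrices $\{\mathbf{Z}_{ij}\}_{i,j\ge1}$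 over $\mathbb{Q}_p$ with the product topology; $\mathsf{M}^{(s)}$ is the unique probability measure on it whose image under the map to the top-left $N\times N$ corner is $\mathsf{M}_N^{(s)}$ for every $N$. $\Delta=\{\mathbf{k}=(k_j)_{j\ge1}\in(\mathbb{Z}\cup\{-\infty\})^{\mathbb{N}}:k_1\ge k_2\ge\cdots\}$ with the product topology; $\Delta_0=\{\mathbf{k}\in\mathbb{Z}_+^{\mathbb{N}}:k_1\ge k_2\ge\cdots,\ k_i=0\text{ for $i$ large}\}$, $\mathbb{Z}_+=\{0,1,2,\dots\}$; $l_i(\mathbf{k})=\#\{j:k_j=i\}$. For $\mathbf{k}\in\Delta$ with $k=\lim_j k_j\in\mathbb{Z}\cup\{-\infty\}$, $\mu_{\mathbf{k}}$ is the law of the random infinite matrix $\mathbf{A}_{\mathbf{k}}=\big[\sum_{N:k_N>k}p^{-k_N}X_i^{(N)}Y_j^{(N)}+p^{-k}Z_{ij}\big]_{i,j\in\mathbb{N}}$, where $X_i^{(N)},Y_j^{(N)},Z_{ij}$ are i.i.d. with the Haar probability measure on $\mathbb{Z}_p$ (the series converges a.s.; the last term is $0$ if $k=-\infty$). The Markov kernel $\mathsf{P}^{(s)}$ on $\mathbb{Z}_+$ is $\mathsf{P}^{(s)}(x_1,x_2)=\frac{p^{-x_2^2-sx_2}(p^{-1};p^{-1})_{x_1}(p^{-1-s};p^{-1})_{x_1}}{(p^{-1};p^{-1})_{x_2}(p^{-1};p^{-1})_{x_1-x_2}(p^{-1-s};p^{-1})_{x_2}}\mathbf{1}(0\le x_2\le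 x_1)$, and $\pi^{(s)}(x)=\frac{p^{-x^2-sx}(p^{-1-s};p^{-1})_\infty}{(p^{-1};p^{-1})_x(p^{-1-s};p^{-1})_x}$, $x\in\mathbb{Z}_+$ (both are probability distributions). *)

(* Defs.v *)
From HB Require Import structures.
From mathcomp Require Import all_boot all_order all_algebra.
From mathcomp Require Import all_classical all_reals all_analysis.
Set Implicit Arguments.
Unset Strict Implicit.
Unset Printing Implicit Defensive.
Import Order.TTheory GRing.Theory Num.Theory.
Import numFieldNormedType.Exports.
Local Open Scope classical_set_scope.
Local Open Scope ring_scope.

Definition qpoch {R : realType} (a q : R) (n : nat) : R :=
  \prod_(j < n) (1 - a * q ^+ j).
Definition qpoch_inf {R : realType} (a q : R) : R :=
  limn (fun n => qpoch a q n).

(* The field Q_p, given axiomatically: a field K with an absolute value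
   absK such that (K, absK) is the completion of (Q, |.|_p), i.e.
   absK is a non-archimedean absolute value extending the p-adic one on
   Q (embedded via ratr), Q is dense and K is complete.  This determines
   (K, absK) up to isometric field isomorphism.                        *)

Definition pw {R : realType} (p : nat) (c : int) : R := (p%:R : R) ^ c.

Definition padic_abs {R : realType} (p : nat) (q : rat) : R :=
  if q == 0 then 0
  else pw p (- ((logn p `|numq q|%N)%:Z - (logn p `|denq q|%N)%:Z)).

Definition Kcauchy {R : realType} {K : fieldType} (absK : K -> R)
  (u : nat -> K) : Prop :=
  forall e : R, 0 < e -> exists M : nat,
    forall m n : nat, (M <= m)%N -> (M <= n)%N -> absK (u m - u n) < e.

Definition Kconv {R : realType} {K : fieldType} (absK : K -> R)
  (u : nat -> K) (L : K) : Prop :=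
  forall e : R, 0 < e -> exists M : nat,
    forall n : nat, (M <= n)%N -> absK (u n - L) < e.

Definition is_Qp {R : realType} (p : nat) (K : fieldType) (absK : K -> R) : Prop :=
  (forall x : K, absK x = 0 <-> x = 0) /\
  (forall x : K, 0 <= absK x) /\
  (forall x y : K, absK (x * y) = absK x * absK y) /\
  (forall x y : K, absK (x + y) <= Num.max (absK x) (absK y)) /\
  (forall q : rat, absK (ratr q) = padic_abs p q) /\
  (forall (x : K) (e : R), 0 < e -> exists q : rat, absK (x - ratr q) < e) /\
  (forall u : nat -> K, Kcauchy absK u -> exists L : K, Kconv absK u L).

(* Finite matrices Mat(N, Q_p) with their Borel sigma-algebra,
   generated by the balls A + p^c Mat(N, Z_p).                        *)

Definition MatN (K : fieldType) (N : nat) := 'M[K]_N.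
HB.instance Definition _ (K : fieldType) (N : nat) := Choice.on (MatN K N).
HB.instance Definition _ (K : fieldType) (N : nat) :=
  isPointed.Build (MatN K N) (0 : 'M[K]_N).

Section Mats.
Variables (R : realType) (K : fieldType) (absK : K -> R) (p : nat).

Definition ballN (N : nat) (A : 'M[K]_N) (c : int) : set (MatN K N) :=
  [set Z | forall i j : 'I_N, absK (Z i j - A i j) <= pw p (- c)].

Definition ballsN (N : nat) : set (set (MatN K N)) :=
  [set B | exists (A : 'M[K]_N) (c : int), B = ballN A c].

Definition MatNm (N : nat) := g_sigma_algebraType (@ballsN N).

(* Infinite matrices Mat(N, Q_p), product sigma-algebra, generated by the
   cylinders {Z | top-left N x N corner of Z lies in a ball}. *)
Definition MatInf := nat -> nat -> K.
HB.instance Definition _ := Choice.on MatInf.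
HB.instance Definition _ := isPointed.Build MatInf (fun _ _ => 0).

Definition corner (N : nat) (Z : MatInf) : 'M[K]_N := \matrix_(i < N, j < N) Z i j.

Definition cylsInf : set (set MatInf) :=
  [set C | exists (N : nat) (A : 'M[K]_N) (c : int),
           C = [set Z | ballN A c (corner N Z)]].

Definition MatInfm := g_sigma_algebraType cylsInf.

Definition GLZp (N : nat) (B : 'M[K]_N) : Prop :=
  [/\ (forall i j, absK (B i j) <= 1), B \in unitmx
    & (forall i j, absK (invmx B i j) <= 1)].

(* order on Z \cup {-oo}, with None = -oo *)
Definition oint_le (a b : option int) : bool :=
  match a, b with
  | None, _ => true
  | Some _, None => false
  | Some x, Some y => x <= y
  end.

(* diag(p^{-k_1}, ..., p^{-k_N}) with p^{-(-oo)} = 0 *)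
Definition pdiag (N : nat) (k : {ffun 'I_N -> option int}) : 'M[K]_N :=
  diag_mx (\row_j (match k j with Some c => (p%:R : K) ^ (- c) | None => 0 end)).

Definition singnums (N : nat) (Z : 'M[K]_N) (k : {ffun 'I_N -> option int}) : Prop :=
  (forall i j : 'I_N, (i <= j)%N -> oint_le (k j) (k i)) /\
  exists B C : 'M[K]_N, [/\ GLZp B, GLZp C & Z = B *m pdiag k *m C].

Definition sing (N : nat) (Z : 'M[K]_N) : {ffun 'I_N -> option int} :=
  xget [ffun => None] [set k | singnums Z k].

Definition gammaZ (N : nat) (Z : 'M[K]_N) : R :=
  \prod_(j < N) (match sing Z j with
                 | Some c => if 0 < c then pw p c else 1
                 | None => 1 end).

Definition is_haar (vol : forall N : nat, {measure set (MatNm N) -> \bar R}) : Prop :=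
  forall (N : nat) (A : 'M[K]_N) (c : int),
    vol N (ballN A c) = (pw p (- c) ^+ (N * N))%:E.

Definition MsN (vol : forall N : nat, {measure set (MatNm N) -> \bar R})
  (s : R) (N : nat) (B : set (MatNm N)) : \bar R :=
  let a := (p%:R : R) `^ (-1 - s) in
  let q := (p%:R : R)^-1 in
  ((qpoch a q N ^+ 2 / qpoch a q (2 * N))%:E *
   \int[vol N]_(Z in B) ((gammaZ Z) `^ (- s - (2 * N)%:R))%:E)%E.

Definition Kballs : set (set K) :=
  [set B | exists (a : K) (c : int), B = [set x | absK (x - a) <= pw p (- c)]].

(* index set for the families X_i^{(N)} (inl (inl (N,i))),
   Y_j^{(N)} (inl (inr (N,j))) and Z_{ij} (inr (i,j)) *)
Definition Idx := ((nat * nat) + (nat * nat) + (nat * nat))%type.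

Section RV.
Variables (d : measure_display) (Omega : measurableType d) (P : probability Omega R)
  (V : Idx -> Omega -> K).

Definition iid_haar_Zp : Prop :=
  [/\ (forall f B, <<s Kballs >> B -> measurable (V f @^-1` B)),
      (forall f (a : K) (c : nat), absK a <= 1 ->
          P (V f @^-1` [set x | absK (x - a) <= pw p (- c%:Z)]) = (pw p (- c%:Z))%:E)
    & (forall (F : seq Idx) (B : Idx -> set K), uniq F ->
          (forall f, <<s Kballs >> (B f)) ->
          P (\bigcap_(f in [set f | f \in F]) (V f @^-1` B f)) =
          (\prod_(f <- F) P (V f @^-1` B f))%E)].

Definition Xr (N i : nat) := V (inl (inl (N, i))).
Definition Yr (N j : nat) := V (inl (inr (N, j))).
Definition Zr (i j : nat) := V (inr (i, j)).

Definition klim (k : nat -> option int) : option int :=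
  xget None [set c | exists m : nat, forall n : nat, (m <= n)%N -> k n = c].

Definition Apart (k : nat -> option int) (w : Omega) (i j : nat) (n : nat) : K :=
  \sum_(N < n | k N != klim k)
     (match k N with
      | Some c => (p%:R : K) ^ (- c) * Xr N i w * Yr N j w
      | None => 0 end)
  + (match klim k with Some c => (p%:R : K) ^ (- c) * Zr i j w | None => 0 end).

(* A_k (entrywise limit of the series; 0 where it diverges, a null event) *)
Definition Amat (k : nat -> option int) (w : Omega) : MatInf :=
  fun i j => xget 0 [set L | Kconv absK (Apart k w i j) L].

Definition mu (k : nat -> option int) (A : set MatInf) : \bar R :=
  P [set w | A (Amat k w)].
End RV.
End Mats.

Definition Delta :=
  {k : nat -> option int | forall n : nat, oint_le (k n.+1) (k n)}.
HB.instance Definition _ := gen_eqMixin Delta.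
HB.instance Definition _ := gen_choiceMixin Delta.
Lemma Delta_pt_proof : forall n : nat, oint_le ((fun _ : nat => None : option int) n.+1)
  ((fun _ : nat => None : option int) n).
Proof. by []. Qed.
HB.instance Definition _ := isPointed.Build Delta (exist _ _ Delta_pt_proof).

(* product (of discrete) sigma-algebra on Delta: generated by {k | k_n = v} *)
Definition cylsDelta : set (set Delta) :=
  [set C | exists (n : nat) (v : option int), C = [set k : Delta | sval k n = v]].
Definition Deltam := g_sigma_algebraType cylsDelta.

Definition Delta0 : set Deltam :=
  [set k | (forall n, exists c : nat, sval k n = Some c%:Z) /\
           exists m : nat, forall n : nat, (m <= n)%N -> sval k n = Some 0].

(* elements of Delta0 <-> partitions lambda (nonincreasing positive parts):
   k = (lambda_1, ..., lambda_r, 0, 0, ...) *)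
Definition is_partition (lam : seq nat) : bool := sorted geq lam && all (fun x => 0 < x)%N lam.
Definition padf (lam : seq nat) : nat -> option int := fun n => Some (nth 0%N lam n)%:Z.
Definition maxpart (lam : seq nat) : nat := \max_(x <- lam) x.
Definition lv (lam : seq nat) (j : nat) : nat := count_mem j lam.
Definition Xv (lam : seq nat) (i : nat) : nat :=
  (\sum_(i <= j < (maxpart lam).+1) lv lam j)%N.

Section Chain.
Variables (R : realType) (p : nat) (s : R).
Local Notation a := ((p%:R : R) `^ (-1 - s)).
Local Notation q := ((p%:R : R)^-1).

Definition pi_s (x : nat) : R :=
  (p%:R : R) `^ (- (x ^ 2)%:R - s * x%:R) * qpoch_inf a q / (qpoch q q x * qpoch a q x).

Definition P_s (x1 x2 : nat) : R :=
  if (x2 <= x1)%N then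
    (p%:R : R) `^ (- (x2 ^ 2)%:R - s * x2%:R) * qpoch q q x1 * qpoch a q x1 /
      (qpoch q q x2 * qpoch q q (x1 - x2) * qpoch a q x2)
  else 0.

Definition nu_formula (lam : seq nat) : R :=
  qpoch_inf a q *
  (p%:R : R) `^ (- (\sum_(1 <= i < (maxpart lam).+1) (Xv lam i) ^ 2)%:R
                  - s * (\sum_(1 <= i < (maxpart lam).+1) i * lv lam i)%:R) *
  \prod_(1 <= i < (maxpart lam).+1) (qpoch q q (lv lam i))^-1.
End Chain.

(* Main.v *)
Require Import Defs.
From HB Require Import structures.
From mathcomp Require Import all_boot all_order all_algebra.
From mathcomp Require Import all_classical all_reals all_analysis.
From mathcomp Require Import perm zify ring lra.
Import Order.TTheory GRing.Theory Num.Theory.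
Import numFieldNormedType.Exports.
Set Implicit Arguments.
Unset Strict Implicit.
Unset Printing Implicit Defensive.
Local Open Scope classical_set_scope.
Local Open Scope ring_scope.

(* Let [xr Z] be the least rank of a matrix congruent to [Z] modulo integral matrices; the numbers
   [X_i = xr (p ^ i Z)], i >= 0, count the singular numbers of [Z] that exceed i. The set of
   N x N matrices with given [X_0 >= X_1 >= ...] is a finite union of cosets of Mat(N, Z_p), and
   passing from [p Z] to [Z] these cosets are counted by matrices over F_p of a given rank. Hence
   its M_N-mass is explicit, and it tends to the claimed formula as N grows.
   Each mu_k bounds nu from above: if mu_k(A) >= c for k in T, then c nu(T) <= M(A). Taking for A
   a corner event that is almost sure under mu_k shows that nu{k} is at most the claimed value
   for k in Delta_0, that nu vanishes on sequences with negative entries (under mu_k the corner is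
   then close to a matrix of bounded rank) and on each sequence with a limit >= 1 (the corners
   then have [xr] tending to infinity, against tightness). So nu is carried by the countable set
   Delta_0, where the claimed values sum to at most 1, and equality holds throughout.
   The finite-dimensional laws of the chain follow by induction on the last value x: split off
   the transitions to y < x, and iterate the transition to x, whose probability is less than 1. *)

(** * The field of p-adic numbers *)

(** The density of M_N depends on Z only through the sum of the X_i, because a positive singular
    number c is counted by X_0, ..., X_(c-1). With q = 1/p and b = p^-s it is a constant times (b
    q^(2N)) to the power of that sum. A level of size y has, up to bounded factors, p^(2Ny - y^2)
    lifts, and q^(2Ny) cancels all of this but q^(y^2): this is the origin of the squares in the
    formula. Convergence of each single mass would allow mass to escape as N grows. It does not,
    since the mass of a level set is at most its limit times a factor that depends on N alone and
    tends to 1. Summed over all level sets, this makes the limits sum to at least 1, whence the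
    tightness of X_0. Negative singular numbers are invisible to the X_i. They are detected by [xr]
    of Z / p, which counts the singular numbers that are at least 0. Under M_N it exceeds every
    fixed J with probability tending to 1: dividing by p costs a volume factor p^(-N^2), while the
    density and the count give back only powers of p linear in N. *)

Class prime_nat (p : nat) : Prop := is_prime : prime p.
Class Qp_field {R : realType} (p : nat) {K : fieldType} (absK : K -> R) : Prop :=
  Qp_axioms : is_Qp p absK.

Section PAdicField.
Context {R : realType} {p : nat} {K : fieldType} {absK : K -> R}.
Context {Hp : prime_nat p} {HQ : Qp_field p absK}.
Implicit Types (x y z : K).

Lemma prime_gt0R : 0 < p%:R :> R.
Proof. by rewrite ltr0n prime_gt0. Qed.

Lemma prime_gt1R : 1 < p%:R :> R.
Proof. by rewrite ltr1n prime_gt1. Qed.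

Lemma pw0 : pw p 0 = 1 :> R.
Proof. by rewrite /pw expr0z. Qed.

Lemma pwD c d : pw p (c + d) = pw p c * pw p d :> R.
Proof. by rewrite /pw expfzDr // gt_eqF // prime_gt0R. Qed.

Lemma pw_gt0 c : 0 < pw p c :> R.
Proof. by rewrite /pw exprz_gt0 // prime_gt0R. Qed.

Lemma pw_ge0 c : 0 <= pw p c :> R.
Proof. exact/ltW/pw_gt0. Qed.

Lemma ler_pw c d : (pw p c <= pw p d :> R) = (c <= d).
Proof. by rewrite /pw ler_eXz2l // prime_gt1R. Qed.

Lemma ltr_pw c d : (pw p c < pw p d :> R) = (c < d).
Proof. by rewrite /pw ltr_eXz2l // prime_gt1R. Qed.

Lemma pwN c : pw p (- c) = (pw p c)^-1 :> R.
Proof. by rewrite /pw invr_expz. Qed.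

Lemma pw_nat n : pw p n%:Z = p%:R ^+ n :> R.
Proof. by []. Qed.

Lemma absK_eq0 x : (absK x == 0) = (x == 0).
Proof. by case: HQ => h _; apply/eqP/eqP => /h. Qed.

Lemma absK0 : absK 0 = 0.
Proof. by apply/eqP; rewrite absK_eq0. Qed.

Lemma absK_ge0 x : 0 <= absK x.
Proof. by case: HQ => _ [h _]. Qed.

Lemma absK_gt0 x : (0 < absK x) = (x != 0).
Proof. by rewrite lt_neqAle absK_ge0 andbT eq_sym absK_eq0. Qed.

Lemma absKM x y : absK (x * y) = absK x * absK y.
Proof. by case: HQ => _ [_ [h _]]. Qed.

Lemma absKD_max x y : absK (x + y) <= Num.max (absK x) (absK y).
Proof. by case: HQ => _ [_ [_ [h _]]]. Qed.

Lemma absK_ratr (q : rat) : absK (ratr q) = padic_abs p q.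
Proof. by case: HQ => _ [_ [_ [_ [h _]]]]. Qed.

Lemma rat_dense x (e : R) : 0 < e -> exists q : rat, absK (x - ratr q) < e.
Proof. by case: HQ => _ [_ [_ [_ [_ [h _]]]]]; exact: h. Qed.

Lemma K_complete u : Kcauchy absK u -> exists L, Kconv absK u L.
Proof. by case: HQ => _ [_ [_ [_ [_ [_ h]]]]]; exact: h. Qed.

Lemma absK1 : absK 1 = 1.
Proof.
have h : absK 1 != 0 by rewrite absK_eq0 oner_eq0.
by apply: (mulfI h); rewrite -absKM !mulr1.
Qed.

Lemma absKN x : absK (- x) = absK x.
Proof.
have h : absK (-1) = 1.
  apply/eqP; rewrite -(@eqrXn2 _ 2) ?absK_ge0 ?ler01 //.
  by rewrite expr2 -absKM mulrNN mulr1 absK1 expr1n.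
by rewrite -mulN1r absKM h mul1r.
Qed.

Lemma absKB x y : absK (x - y) = absK (y - x).
Proof. by rewrite -absKN opprB. Qed.

Lemma absKV x : absK x^-1 = (absK x)^-1.
Proof.
have [->|x0] := eqVneq x 0; first by rewrite invr0 absK0 invr0.
have h : absK x != 0 by rewrite absK_eq0.
by apply: (mulfI h); rewrite -absKM !divff // absK1.
Qed.

Lemma absKX x n : absK (x ^+ n) = absK x ^+ n.
Proof. by elim: n => [|n ih]; rewrite ?expr0 ?absK1 // !exprS absKM ih. Qed.

Lemma absKD_le x y e : absK x <= e -> absK y <= e -> absK (x + y) <= e.
Proof.
by move=> hx hy; apply: le_trans (absKD_max x y) _; rewrite ge_max hx.
Qed.

Lemma absKD_lt x y e : absK x < e -> absK y < e -> absK (x + y) < e.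
Proof.
by move=> hx hy; apply: le_lt_trans (absKD_max x y) _; rewrite gt_max hx.
Qed.

Lemma absKB_le x y e : absK x <= e -> absK y <= e -> absK (x - y) <= e.
Proof. by move=> hx hy; apply: absKD_le; rewrite ?absKN. Qed.

Lemma absKB_lt x y e : absK x < e -> absK y < e -> absK (x - y) < e.
Proof. by move=> hx hy; apply: absKD_lt; rewrite ?absKN. Qed.

Lemma absKM_le1 x y : absK x <= 1 -> absK y <= 1 -> absK (x * y) <= 1.
Proof. by move=> hx hy; rewrite absKM mulr_ile1 ?absK_ge0. Qed.

Lemma absK_sum_le I (r : seq I) (Q : pred I) (F : I -> K) (e : R) : 0 <= e ->
  (forall i, Q i -> absK (F i) <= e) -> absK (\sum_(i <- r | Q i) F i) <= e.
Proof.
move=> e0 h; elim/big_ind: _ => //; first by rewrite absK0.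
by move=> x y; exact: absKD_le.
Qed.

Lemma absK_prod_le1 I (r : seq I) (Q : pred I) (F : I -> K) :
  (forall i, Q i -> absK (F i) <= 1) -> absK (\prod_(i <- r | Q i) F i) <= 1.
Proof.
move=> h; elim/big_ind: _ => //; first by rewrite absK1.
by move=> x y; exact: absKM_le1.
Qed.

Lemma absK_isosceles x y : absK y < absK x -> absK (x + y) = absK x.
Proof.
move=> h; apply/eqP; rewrite eq_le absKD_le ?(ltW h) //=.
rewrite leNgt; apply/negP => h2.
by have := absKD_lt h2 (_ : absK (- y) < absK x); rewrite addrK absKN h ltxx => /(_ isT).
Qed.

Lemma absK_close x y : absK (x - y) < absK y -> absK x = absK y.
Proof. by move=> h; rewrite -(absK_isosceles h) addrC subrK. Qed.

Lemma absK_nat n : absK n%:R <= 1.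
Proof.
elim: n => [|n ih]; first by rewrite absK0 ler01.
by rewrite -addn1 natrD absKD_le // absK1.
Qed.

Lemma absK_p : absK p%:R = pw p (- 1).
Proof.
have := absK_ratr p%:R; rewrite ratr_nat => ->.
have pr : prime p := Hp.
rewrite /padic_abs pnatr_eq0 (negbTE (lt0n_neq0 (prime_gt0 pr))).
rewrite pmulrn numq_int denq_int /= logn1 subr0.
by have -> : logn p p = 1%N by rewrite logn_prime // eqxx.
Qed.

Lemma p_neq0 : (p%:R : K) != 0.
Proof. by rewrite -absK_gt0 absK_p pw_gt0. Qed.

Lemma absK_pz c : absK ((p%:R : K) ^ c) = pw p (- c).
Proof.
case: c => n.
  by rewrite -exprnP absKX absK_p !pwN /pw expr1z -exprnP exprVn.
by rewrite NegzE -exprnN absKV absKX absK_p opprK pwN /pw expr1z -exprnP exprVn invrK.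
Qed.

Lemma absK_rat_pw (q : rat) : q != 0 -> exists c : int, absK (ratr q) = pw p c.
Proof.
by move=> /negbTE q0; rewrite absK_ratr /padic_abs q0; eexists.
Qed.

(** A rational closer to [x] than [absK x] has the same absolute value, so passing to the completion
    adds no new values. *)
Lemma absK_pw x : x != 0 -> exists c : int, absK x = pw p c.
Proof.
rewrite -absK_gt0 => x0; have [q hq] := rat_dense x x0.
have e : absK x = absK (ratr q).
  by rewrite -(@absK_close (ratr q) x) // absKB.
rewrite e; apply: absK_rat_pw; apply/eqP => q0.
by move: x0; rewrite e absK_ratr /padic_abs q0 eqxx ltxx.
Qed.

Lemma absK_lt_pw x c : absK x < pw p c -> absK x <= pw p (c - 1).
Proof.
have [->|x0] := eqVneq x 0; first by rewrite absK0 pw_ge0.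
by have [d ->] := absK_pw x0; rewrite ltr_pw ler_pw; lia.
Qed.

Lemma absK_lt1 x : (absK x < 1) = (absK x <= pw p (- 1)).
Proof.
apply/idP/idP; first by rewrite -pw0 => /absK_lt_pw.
by move=> /le_lt_trans; apply; rewrite -pw0 ltr_pw.
Qed.

Lemma absK_gt1 x : (1 < absK x) = (pw p 1 <= absK x).
Proof.
apply/idP/idP => [h|]; last by apply: lt_le_trans; rewrite -pw0 ltr_pw.
have x0 : x != 0 by rewrite -absK_gt0 (lt_trans _ h).
by move: h; have [d ->] := absK_pw x0; rewrite -pw0 ltr_pw ler_pw; lia.
Qed.

(** For n prime to p, a Bezout relation u n - v p = 1 would force the absolute value of 1 below 1 if
    that of n were. *)
Lemma absK_nat_lt1 n : (absK n%:R < 1) = (p %| n)%N.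
Proof.
have pr : prime p := Hp.
have [d|nd] := boolP (p %| n)%N.
  case/dvdnP: d => m ->; rewrite natrM absKM.
  apply: le_lt_trans (_ : absK (p%:R) < 1); last by rewrite absK_lt1 absK_p.
  by rewrite ler_piMl ?absK_nat ?absK_ge0.
have cop : coprime p n by rewrite prime_coprime.
have n0 : (0 < n)%N by case: (n) nd => //; rewrite dvdn0.
case: (egcdnP p n0) => u v e _.
have g1 : gcdn n p = 1%N by apply/eqP; rewrite gcdnC.
move: e; rewrite g1 => e.
apply/negbTE; rewrite -leNgt leNgt; apply/negP => h.
have e1 : (1 : K) = u%:R * n%:R - v%:R * p%:R.
  by rewrite -!natrM e natrD addrAC subrr add0r.
have : absK 1 < 1.
  rewrite e1; apply: absKB_lt; rewrite absKM.
    by apply: le_lt_trans h; rewrite ler_piMl ?absK_nat ?absK_ge0.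
  apply: le_lt_trans (_ : absK (p%:R) < 1); last by rewrite absK_lt1 absK_p.
  by rewrite ler_piMl ?absK_nat ?absK_ge0.
by rewrite absK1 ltxx.
Qed.

Lemma absK_int_lt1 (m : int) : (absK m%:~R < 1) = (p %| `|m|)%N.
Proof.
by case: m => n; rewrite ?NegzE ?rmorphN ?absKN -?pmulrn absK_nat_lt1 //= abszN.
Qed.

Lemma absK_int (m : int) : absK m%:~R <= 1.
Proof. by case: m => n; rewrite ?NegzE ?rmorphN ?absKN -?pmulrn absK_nat. Qed.

Lemma int_residue (m : int) : exists n : nat, absK (m%:~R - n%:R) < 1.
Proof.
have pr : prime p := Hp.
exists `|(m %% p)%Z|%N.
have h : 0 <= (m %% p)%Z by rewrite modz_ge0 // eqz_nat -lt0n prime_gt0.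
rewrite pmulrn gez0_abs // -rmorphB /= absK_int_lt1.
have -> : m - (m %% p)%Z = (m %/ p)%Z * p by rewrite {1}(divz_eq m p) addrK.
by rewrite abszM dvdn_mull.
Qed.

(** Density replaces [x] by a rational at distance less than 1. Being integral and reduced, it has a
    denominator prime to p; if u inverts this denominator modulo p, the residue is that of the
    numerator times u. *)
Lemma nat_residue x : absK x <= 1 -> exists n : nat, absK (x - n%:R) < 1.
Proof.
have pr : prime p := Hp.
move=> hx; have [q hq] := rat_dense x ltr01.
have q1 : absK (ratr q) <= 1.
  by rewrite -[ratr q](subKr x) absKB_le // ltW.
suff [n hn] : exists n : nat, absK (ratr q - n%:R) < 1.
  by exists n; rewrite -[x](subrK (ratr q)) -addrA absKD_lt.
have d0 : (denq q)%:~R != 0 :> K.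
  rewrite -absK_gt0; have := absK_ratr (denq q)%:Q; rewrite ratr_int => ->.
  by rewrite /padic_abs intr_eq0 (negbTE (denq_neq0 q)) pw_gt0.
have eqq : ratr q = (numq q)%:~R / (denq q)%:~R :> K by [].
have dq : absK (denq q)%:~R = 1.
  apply/eqP; rewrite eq_le absK_int /= leNgt absK_int_lt1; apply/negP => pd.
  have pn : ~~ (p %| `|numq q|)%N.
    apply/negP => pn; have := coprime_num_den q.
    by move=> /eqP e; have := dvdn_gcd p `|numq q| `|denq q|; rewrite pn pd e dvdn1 => /eqP p1;
      move: pr; rewrite p1.
  move: q1; rewrite eqq absKM absKV leNgt => /negP; apply.
  have -> : absK (numq q)%:~R = 1.
    by apply/eqP; rewrite eq_le absK_int leNgt absK_int_lt1 pn.
  by rewrite mul1r invf_gt1 ?absK_gt0 // absK_int_lt1.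
have cop : coprime `|denq q| p.
  rewrite coprime_sym prime_coprime //.
  by rewrite -absK_int_lt1 dq ltxx.
have D0 : (0 < `|denq q|)%N by rewrite absz_gt0 denq_neq0.
case: (egcdnP p D0) => u v; rewrite (eqP cop) => e _.
have [n hn] := int_residue (numq q * u%:Z).
exists n; rewrite -(subrK ((numq q * u%:Z)%:~R) (ratr q)) -addrA.
apply: absKD_lt => //.
have e1 : u%:R * (denq q)%:~R = v%:R * p%:R + 1 :> K.
  have -> : (denq q)%:~R = `|denq q|%N%:R :> K.
    by rewrite -[in LHS](gtz0_abs (denq_gt0 q)) -pmulrn.
  by rewrite -!natrM e natrD.
have -> : ratr q - (numq q * u%:Z)%:~R = - (v%:R * p%:R * ratr q) :> K.
  rewrite eqq rmorphM /= -!pmulrn.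
  apply: (mulIf d0); rewrite mulrBl mulNr -!mulrA mulVf // mulr1 e1.
  by rewrite mulrDr mulr1 opprD addrCA subrr addr0; ring.
rewrite absKN (absKM _ (ratr q)) (absKM v%:R) -mulrA.
apply: le_lt_trans (_ : absK (p%:R) < 1); last by rewrite absK_lt1 absK_p.
apply: le_trans (_ : absK (p%:R) * absK (ratr q) <= _).
  by rewrite ler_piMl ?absK_nat // mulr_ge0 ?absK_ge0.
by rewrite ler_piMr ?absK_ge0.
Qed.

(** The digits 0, ..., p - 1. This is a section of the reduction [red], not a homomorphism. *)
Definition tau (a : 'F_p) : K := (nat_of_ord a)%:R.
(* Only meaningful on the unit ball. *)
Definition red (x : K) : 'F_p := xget 0 [set a | absK (x - tau a) < 1].

Lemma absK_tau a : absK (tau a) <= 1.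
Proof. exact: absK_nat. Qed.

Lemma Fp_lt (a : 'F_p) : (a < p)%N.
Proof. by rewrite -[X in (_ < X)%N](Fp_cast Hp) ltn_ord. Qed.

Lemma red_close x : absK x <= 1 -> absK (x - tau (red x)) < 1.
Proof.
move=> hx; rewrite /red; case: xgetP => [a _ //|].
have [n hn] := nat_residue hx => /(_ (n%:R : 'F_p)) [] /=.
rewrite -[x](subrK n%:R) -addrA; apply: absKD_lt => //.
rewrite /tau val_Fp_nat // {1}(divn_eq n p) natrD addrK.
by rewrite absK_nat_lt1 dvdn_mull.
Qed.

Lemma tau_inj a b : absK (tau a - tau b) < 1 -> a = b.
Proof.
have pr : prime p := Hp.
rewrite /tau => h; apply: val_inj => /=.
wlog ab : a b h / (a <= b)%N => [hw|].
  have [/hw->//|/ltnW /hw ->//] := leqP a b.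
  by rewrite absKB.
move: h; rewrite absKB -natrB // absK_nat_lt1 => d.
apply/eqP; rewrite eqn_leq ab /= leqNgt; apply/negP => ab'.
have := dvdn_leq _ d; rewrite subn_gt0 => /(_ ab').
by have := Fp_lt b; lia.
Qed.

Lemma red_unique x a : absK (x - tau a) < 1 -> red x = a.
Proof.
move=> h; have hx : absK x <= 1.
  by rewrite -[x](subrK (tau a)) absKD_le ?absK_tau // ltW.
apply: tau_inj.
by rewrite -[tau _](subKr x) [_ - _ - _]addrAC absKB_lt // red_close.
Qed.

Lemma tauK a : red (tau a) = a.
Proof. by apply: red_unique; rewrite subrr absK0 ltr01. Qed.

Lemma red_nat n : red n%:R = n%:R.
Proof.
apply: red_unique; rewrite /tau val_Fp_nat // {1}(divn_eq n p) natrD addrK.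
by rewrite absK_nat_lt1 dvdn_mull.
Qed.

Lemma eq_red x y : absK y <= 1 -> absK (x - y) < 1 -> red x = red y.
Proof.
move=> hy h; apply: red_unique.
by rewrite -[x](subrK y) -addrA absKD_lt // red_close.
Qed.

Lemma redD x y : absK x <= 1 -> absK y <= 1 -> red (x + y) = red x + red y.
Proof.
move=> hx hy; rewrite -[red x + red y]natr_Zp.
have -> : (nat_of_ord (red x + red y))%:R = ((red x + red y)%N%:R : 'F_p).
  by rewrite natr_Zp natrD !natr_Zp.
rewrite -red_nat; apply: eq_red; first exact: absK_nat.
rewrite natrD opprD addrACA.
by apply: absKD_lt; exact: red_close.
Qed.

Lemma redM x y : absK x <= 1 -> absK y <= 1 -> red (x * y) = red x * red y.
Proof.
move=> hx hy; rewrite -[red x * red y]natr_Zp.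
have -> : (nat_of_ord (red x * red y))%:R = ((red x * red y)%N%:R : 'F_p).
  by rewrite natr_Zp natrM !natr_Zp.
rewrite -red_nat; apply: eq_red; first exact: absK_nat.
rewrite natrM -/(tau _) -/(tau _).
have -> : x * y - tau (red x) * tau (red y) =
  (x - tau (red x)) * y + tau (red x) * (y - tau (red y)) by ring.
apply: absKD_lt; rewrite absKM.
  by apply: le_lt_trans (red_close hx); rewrite ler_piMr ?absK_ge0.
by apply: le_lt_trans (red_close hy); rewrite ler_piMl ?absK_ge0 ?absK_tau.
Qed.

Lemma red0 : red 0 = 0.
Proof. exact: (red_nat 0). Qed.

Lemma red1 : red 1 = 1.
Proof. exact: (red_nat 1). Qed.

Lemma red_lt1 x : absK x < 1 -> red x = 0.
Proof. by move=> h; rewrite -red0; apply: eq_red; rewrite ?absK0 ?ler01 ?subr0. Qed.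

Lemma red_eq0 x : absK x <= 1 -> (red x == 0) = (absK x < 1).
Proof.
move=> hx; apply/eqP/idP => [h|/red_lt1//].
by have := red_close hx; rewrite h /tau /= subr0.
Qed.

Lemma red_sum I (r : seq I) (Q : pred I) (F : I -> K) :
  (forall i, Q i -> absK (F i) <= 1) ->
  red (\sum_(i <- r | Q i) F i) = \sum_(i <- r | Q i) red (F i).
Proof.
move=> h; suff [//] : absK (\sum_(i <- r | Q i) F i) <= 1 /\
  red (\sum_(i <- r | Q i) F i) = \sum_(i <- r | Q i) red (F i).
elim/big_rec2: _ => [|i y z Qi [h1 h2]]; first by rewrite absK0 ler01 red0.
by rewrite absKD_le ?h // redD ?h // -h2.
Qed.

Lemma red_prod I (r : seq I) (Q : pred I) (F : I -> K) :
  (forall i, Q i -> absK (F i) <= 1) ->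
  red (\prod_(i <- r | Q i) F i) = \prod_(i <- r | Q i) red (F i).
Proof.
move=> h; suff [//] : absK (\prod_(i <- r | Q i) F i) <= 1 /\
  red (\prod_(i <- r | Q i) F i) = \prod_(i <- r | Q i) red (F i).
elim/big_rec2: _ => [|i y z Qi [h1 h2]]; first by rewrite absK1 lexx red1.
by rewrite absKM_le1 ?h // redM ?h // -h2.
Qed.

End PAdicField.

Arguments red {R p K} absK x.
Arguments tau {p K} a.

(** * Integral matrices and the rank modulo integral matrices *)

Section IntegralMatrices.
Context {R : realType} {p : nat} {K : fieldType} {absK : K -> R}.
Context {Hp : prime_nat p} {HQ : Qp_field p absK}.

Definition intm m n (A : 'M[K]_(m, n)) : bool :=
  [forall i, forall j, absK (A i j) <= 1].

Lemma intmP m n (A : 'M[K]_(m, n)) :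
  reflect (forall i j, absK (A i j) <= 1) (intm A).
Proof.
apply: (iffP forallP) => [h i j|h i]; last by apply/forallP.
by have /forallP := h i.
Qed.

Lemma intm0 m n : intm (0 : 'M[K]_(m, n)).
Proof. by apply/intmP => i j; rewrite mxE absK0 ler01. Qed.

Lemma intmD m n (A B : 'M[K]_(m, n)) : intm A -> intm B -> intm (A + B).
Proof. by move=> /intmP hA /intmP hB; apply/intmP => i j; rewrite mxE absKD_le. Qed.

Lemma intmN m n (A : 'M[K]_(m, n)) : intm (- A) = intm A.
Proof. by apply/intmP/intmP => h i j; have := h i j; rewrite mxE absKN. Qed.

Lemma intmB m n (A B : 'M[K]_(m, n)) : intm A -> intm B -> intm (A - B).
Proof. by move=> hA hB; rewrite intmD ?intmN. Qed.

Lemma intmBC m n (A B : 'M[K]_(m, n)) : intm (A - B) = intm (B - A).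
Proof. by rewrite -intmN opprB. Qed.

Lemma intmZ m n a (A : 'M[K]_(m, n)) : absK a <= 1 -> intm A -> intm (a *: A).
Proof. by move=> ha /intmP hA; apply/intmP => i j; rewrite mxE absKM_le1. Qed.

Lemma intm_mul m n q (A : 'M[K]_(m, n)) (B : 'M[K]_(n, q)) :
  intm A -> intm B -> intm (A *m B).
Proof.
move=> /intmP hA /intmP hB; apply/intmP => i j; rewrite mxE.
by apply: absK_sum_le => // k _; exact: absKM_le1.
Qed.

Lemma intm_scalar n a : absK a <= 1 -> intm (a%:M : 'M[K]_n).
Proof.
by move=> ha; apply/intmP => i j; rewrite mxE; case: (_ == _); rewrite ?absK0.
Qed.

Lemma intm1 n : intm (1%:M : 'M[K]_n).
Proof. by apply: intm_scalar; rewrite absK1. Qed.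

Lemma intm_det n (A : 'M[K]_n) : intm A -> absK (\det A) <= 1.
Proof.
move=> /intmP hA; apply: absK_sum_le => // s _; apply: absKM_le1.
  by rewrite absKX absKN absK1 expr1n.
by apply: absK_prod_le1.
Qed.

Lemma GLZpE n (A : 'M[K]_n) :
  GLZp absK A <-> [/\ intm A, A \in unitmx & intm (invmx A)].
Proof. by split=> [][h1 h2 h3]; split=> //; apply/intmP. Qed.

(** By Cramer's rule the inverse is the integral adjugate divided by a unit. *)
Lemma GLZp_det n (A : 'M[K]_n) : intm A -> absK (\det A) = 1 -> GLZp absK A.
Proof.
move=> hA d1; have uA : A \in unitmx.
  by rewrite unitmxE unitfE -absK_gt0 d1 ltr01.
apply/GLZpE; split=> //; apply/intmP => i j; rewrite /invmx uA.
rewrite !mxE absKM absKV d1 invr1 mul1r /cofactor absKM absKX absKN absK1 expr1n mul1r.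
by apply: intm_det; apply/intmP => k l; rewrite !mxE; move/intmP: hA.
Qed.

Lemma GLZp_absdet n (A : 'M[K]_n) : GLZp absK A -> absK (\det A) = 1.
Proof.
move=> /GLZpE [iA uA iV]; apply/eqP; rewrite eq_le intm_det //=.
have := intm_det iV; rewrite det_inv absKV.
by rewrite invf_le1 // absK_gt0 -unitfE -unitmxE.
Qed.

Lemma GLZp1 n : GLZp absK (1%:M : 'M[K]_n).
Proof. by apply: GLZp_det; rewrite ?intm1 ?det1 ?absK1. Qed.

Lemma GLZpM n (A B : 'M[K]_n) : GLZp absK A -> GLZp absK B -> GLZp absK (A *m B).
Proof.
move=> hA hB; have /GLZpE [iA _ _] := hA; have /GLZpE [iB _ _] := hB.
apply: GLZp_det; first exact: intm_mul.
by rewrite det_mulmx absKM !GLZp_absdet // mulr1.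
Qed.

Lemma GLZpV n (A : 'M[K]_n) : GLZp absK A -> GLZp absK (invmx A).
Proof. by move=> /GLZpE [iA uA iV]; apply/GLZpE; rewrite unitmx_inv invmxK. Qed.

Lemma GLZp_perm n (s : 'S_n) : GLZp absK (perm_mx s : 'M[K]_n).
Proof.
apply: GLZp_det; last by rewrite det_perm absKX absKN absK1 expr1n.
by apply/intmP => i j; rewrite !mxE; case: (_ == _); rewrite ?absK1 ?absK0 ?ler01.
Qed.

Lemma intm_block m1 m2 n1 n2 (A : 'M[K]_(m1, n1)) B C (D : 'M[K]_(m2, n2)) :
  intm A -> intm B -> intm C -> intm D -> intm (block_mx A B C D).
Proof.
move=> /intmP hA /intmP hB /intmP hC /intmP hD; apply/intmP => i j.
by rewrite mxE; case: splitP => k _; rewrite mxE; case: splitP.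
Qed.

Lemma GLZp_ublock m n (A : 'M[K]_m) B (D : 'M[K]_n) :
  GLZp absK A -> intm B -> GLZp absK D -> GLZp absK (block_mx A B 0 D).
Proof.
move=> hA hB hD; have /GLZpE [iA _ _] := hA; have /GLZpE [iD _ _] := hD.
apply: GLZp_det; first by rewrite intm_block ?intm0.
by rewrite det_ublock absKM !GLZp_absdet // mulr1.
Qed.

Lemma GLZp_lblock m n (A : 'M[K]_m) C (D : 'M[K]_n) :
  GLZp absK A -> intm C -> GLZp absK D -> GLZp absK (block_mx A 0 C D).
Proof.
move=> hA hC hD; have /GLZpE [iA _ _] := hA; have /GLZpE [iD _ _] := hD.
apply: GLZp_det; first by rewrite intm_block ?intm0.
by rewrite det_lblock absKM !GLZp_absdet // mulr1.
Qed.

Definition redm m n (A : 'M[K]_(m, n)) : 'M['F_p]_(m, n) := map_mx (red absK) A.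
Definition taum m n (M : 'M['F_p]_(m, n)) : 'M[K]_(m, n) := map_mx tau M.

Lemma intm_tau m n (M : 'M['F_p]_(m, n)) : intm (taum M).
Proof. by apply/intmP => i j; rewrite mxE absK_tau. Qed.

Lemma taumK m n (M : 'M['F_p]_(m, n)) : redm (taum M) = M.
Proof. by apply/matrixP => i j; rewrite !mxE tauK. Qed.

Lemma intm_pinvZ m n (A : 'M[K]_(m, n)) :
  intm (p%:R^-1 *: A) = [forall i, forall j, absK (A i j) < 1].
Proof.
apply/intmP/forallP => [h i|h i j].
  apply/forallP => j; have := h i j.
  rewrite mxE absKM absKV absK_p pwN invrK => h1.
  by rewrite absK_lt1 pwN -[leRHS]mul1r ler_pdivlMr ?pw_gt0 // mulrC.
have /forallP/(_ j) := h i; rewrite absK_lt1 pwN -[leRHS]mul1r => h1.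
by rewrite mxE absKM absKV absK_p pwN invrK mulrC -ler_pdivlMr ?pw_gt0.
Qed.

Lemma redm_close m n (A : 'M[K]_(m, n)) : intm A ->
  intm (p%:R^-1 *: (A - taum (redm A))).
Proof.
move=> /intmP hA; rewrite intm_pinvZ; apply/forallP => i; apply/forallP => j.
by rewrite !mxE red_close.
Qed.

Lemma eq_redm m n (A B : 'M[K]_(m, n)) : intm B ->
  intm (p%:R^-1 *: (A - B)) -> redm A = redm B.
Proof.
move=> /intmP hB; rewrite intm_pinvZ => h; apply/matrixP => i j; rewrite !mxE.
by apply: eq_red => //; move/forallP/(_ i)/forallP/(_ j) : h; rewrite !mxE.
Qed.

Lemma redm_eq_close m n (A B : 'M[K]_(m, n)) : intm A -> intm B ->
  redm A = redm B -> intm (p%:R^-1 *: (A - B)).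
Proof.
move=> hA hB e.
have -> : A - B = (A - taum (redm A)) - (B - taum (redm B)).
  by rewrite e opprB addrA subrK.
by rewrite scalerBr intmB ?redm_close.
Qed.

Lemma redmM m n q (A : 'M[K]_(m, n)) (B : 'M[K]_(n, q)) :
  intm A -> intm B -> redm (A *m B) = redm A *m redm B.
Proof.
move=> /intmP hA /intmP hB; apply/matrixP => i j; rewrite !mxE red_sum.
  by apply: eq_bigr => k _; rewrite redM // !mxE.
by move=> k _; exact: absKM_le1.
Qed.

Lemma redmD m n (A B : 'M[K]_(m, n)) :
  intm A -> intm B -> redm (A + B) = redm A + redm B.
Proof.
by move=> /intmP hA /intmP hB; apply/matrixP => i j; rewrite !mxE redD.
Qed.

Lemma redm1 n : redm (1%:M : 'M[K]_n) = 1%:M.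
Proof. by apply/matrixP => i j; rewrite !mxE; case: (_ == _); rewrite ?red1 ?red0. Qed.

Lemma red_det n (A : 'M[K]_n) : intm A -> red absK (\det A) = \det (redm A).
Proof.
move=> /intmP hA; rewrite /determinant red_sum; last first.
  move=> s _; apply: absKM_le1; first by rewrite absKX absKN absK1 expr1n.
  exact: absK_prod_le1.
apply: eq_bigr => s _; rewrite redM; last first.
- exact: absK_prod_le1.
- by rewrite absKX absKN absK1 expr1n.
congr (_ * _).
  have h : red absK (-1) = -1 :> 'F_p.
    apply/eqP; rewrite -subr_eq0 opprK -[X in _ + X](red1 (absK := absK)).
    by rewrite -redD ?absKN ?absK1 // addNr red0.
  by case: odd_perm; rewrite ?expr1 ?expr0 ?red1.
by rewrite red_prod //; apply: eq_bigr => i _; rewrite mxE.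
Qed.

(** Determinants commute with reduction. In particular every integral matrix congruent to the
    identity modulo p is invertible over the p-adic integers, which is the form in which this is
    mostly used. *)
Lemma GLZp_red n (A : 'M[K]_n) : intm A -> redm A \in unitmx -> GLZp absK A.
Proof.
move=> hA; rewrite unitmxE unitfE -red_det // red_eq0 ?intm_det //.
by rewrite -leNgt => h; apply: GLZp_det => //; apply/eqP; rewrite eq_le h intm_det.
Qed.

Lemma unitmx_redm n (A : 'M[K]_n) : GLZp absK A -> redm A \in unitmx.
Proof.
move=> hA; have /GLZpE [iA _ _] := hA.
by rewrite unitmxE unitfE -red_det // red_eq0 ?intm_det // GLZp_absdet // ltxx.
Qed.

(* [xr Z], the distance in rank from [Z] to the integral matrices, is the number of singular
   numbers of [Z] that are at least 1. *)
Definition xrle m n (Z : 'M[K]_(m, n)) (r : nat) : bool :=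
  `[< exists Y : 'M[K]_(m, n), (\rank Y <= r)%N /\ intm (Z - Y) >].

Lemma xrle_ex m n (Z : 'M[K]_(m, n)) : exists r, xrle Z r.
Proof. by exists (\rank Z); apply/asboolP; exists Z; rewrite subrr intm0. Qed.

Definition xr m n (Z : 'M[K]_(m, n)) : nat :=
  if pselect (exists r, xrle Z r) is left h then ex_minn h else 0%N.

Lemma xr_le m n (Z Y : 'M[K]_(m, n)) : intm (Z - Y) -> (xr Z <= \rank Y)%N.
Proof.
move=> h; rewrite /xr; case: pselect => // h'.
by case: ex_minnP => r _; apply; apply/asboolP; exists Y.
Qed.

Lemma xr_ex m n (Z : 'M[K]_(m, n)) :
  exists Y : 'M[K]_(m, n), (\rank Y <= xr Z)%N /\ intm (Z - Y).
Proof. rewrite /xr; case: pselect => [h|/(_ (xrle_ex Z))//].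
by case: ex_minnP => r /asboolP. Qed.

Lemma xr_mul m n m' n' (A : 'M[K]_(m', m)) (Z : 'M[K]_(m, n)) (B : 'M[K]_(n, n')) :
  intm A -> intm B -> (xr (A *m Z *m B) <= xr Z)%N.
Proof.
move=> hA hB; have [Y [rY hY]] := xr_ex Z.
apply: leq_trans (_ : (\rank (A *m Y *m B) <= _)%N).
  by apply: xr_le; rewrite -mulmxBl -mulmxBr !intm_mul.
apply: leq_trans rY.
exact: leq_trans (mxrankM_maxl _ _) (mxrankM_maxr _ _).
Qed.

Lemma xr_GL m n (A : 'M[K]_m) (Z : 'M[K]_(m, n)) (B : 'M[K]_n) :
  GLZp absK A -> GLZp absK B -> xr (A *m Z *m B) = xr Z.
Proof.
move=> /GLZpE [iA uA iAV] /GLZpE [iB uB iBV].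
apply/eqP; rewrite eqn_leq xr_mul //=.
have {1}-> : Z = invmx A *m (A *m Z *m B) *m invmx B.
  by rewrite !mulmxA mulVmx // mul1mx mulmxK.
exact: xr_mul.
Qed.

Lemma xr_addr m n (Z Y : 'M[K]_(m, n)) : (xr (Z + Y) <= xr Z + \rank Y)%N.
Proof.
have [Y' [rY hY]] := xr_ex Z.
apply: leq_trans (_ : (\rank (Y' + Y)%R <= _)%N).
  by apply: xr_le; rewrite opprD addrACA subrr addr0.
by apply: leq_trans (mxrank_add _ _) _; rewrite leq_add2r.
Qed.

Lemma eq_xr m n (Z Z' : 'M[K]_(m, n)) : intm (Z - Z') -> xr Z = xr Z'.
Proof.
move=> h; apply/eqP; rewrite eqn_leq.
have aux (A B : 'M[K]_(m, n)) : intm (A - B) -> (xr A <= xr B)%N.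
  move=> hAB; have [Y [rY hY]] := xr_ex B; apply: leq_trans rY.
  by apply: xr_le; rewrite -[A](subrK B) -addrA intmD.
by rewrite !aux // intmBC.
Qed.

Lemma xr_rank m n (Z : 'M[K]_(m, n)) : (xr Z <= \rank Z)%N.
Proof. by apply: xr_le; rewrite subrr intm0. Qed.

Lemma xr_eq0 m n (Z : 'M[K]_(m, n)) : (xr Z == 0)%N = intm Z.
Proof.
apply/idP/idP => [/eqP x0|h].
  by have [Y []] := xr_ex Z; rewrite x0 leqn0 mxrank_eq0 => /eqP->; rewrite subr0.
by rewrite -leqn0 -(mxrank0 K m n) xr_le // subr0.
Qed.

Lemma xr_scale m n a (Z : 'M[K]_(m, n)) : absK a <= 1 -> (xr (a *: Z) <= xr Z)%N.
Proof.
move=> ha; rewrite -mul_scalar_mx -[_ *m Z]mulmx1.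
by apply: xr_mul; rewrite ?intm1 ?intm_scalar.
Qed.

(** If T - Y is integral, then Y = T (1 - T^-1 (T - Y)), and the second factor is congruent to the
    identity modulo p; hence Y is invertible and has rank n. *)
Lemma xr_expanding n (T : 'M[K]_n) :
  T \in unitmx -> (forall i j, absK (invmx T i j) < 1) -> xr T = n.
Proof.
move=> uT hT; apply/eqP; rewrite eqn_leq (leq_trans (xr_rank _)) ?rank_leq_row //=.
have [Y [rY hY]] := xr_ex T; apply: leq_trans rY.
have iT : intm (p%:R^-1 *: invmx T).
  by rewrite intm_pinvZ; apply/forallP => i; apply/forallP.
have iT' : intm (invmx T) by apply/intmP => i j; exact/ltW.
suff : Y \in unitmx by rewrite -row_free_unit => /eqP->.
have -> : Y = T *m (1%:M - invmx T *m (T - Y)).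
  by rewrite mulmxBr mulmxA mulmxV // mul1mx mulmx1 subKr.
rewrite unitmx_mul uT /=.
have : GLZp absK (1%:M - invmx T *m (T - Y)); last by case.
apply: GLZp_red; first by rewrite intmB ?intm1 ?intm_mul.
rewrite (@eq_redm _ _ _ 1%:M) ?redm1 ?unitmx1 ?intm1 //.
by rewrite addrAC subrr add0r scalerN intmN scalemxAl intm_mul.
Qed.

(** Erasing the integral entries leaves a matrix of rank r, which gives the upper bound. For the
    lower bound, the 0-1 matrix [Q] cuts out the large entries as an r x r block to which
    [xr_expanding] applies, and integral factors cannot raise [xr]. *)
Lemma xr_diag n (d : 'rV[K]_n) : xr (diag_mx d) = #|[pred j | 1 < absK (d 0 j)]|.
Proof.
set S := [pred j | _]; set r := #|S|.
pose Q : 'M[K]_(r, n) := \matrix_(a, j) (enum_val a == j)%:R.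
pose e : 'rV[K]_r := \row_a d 0 (enum_val a).
have iQ : intm Q by apply/intmP => i j; rewrite mxE; case: (_ == _); rewrite ?absK1 ?absK0 ?ler01.
have iQT : intm Q^T by apply/intmP => i j; rewrite mxE; move/intmP: iQ.
have eQ : Q *m diag_mx d *m Q^T = diag_mx e.
  apply/matrixP => a b; rewrite mxE.
  rewrite (bigD1 (enum_val b)) //= big1 ?addr0 => [|j jb].
    rewrite mul_mx_diag !mxE eqxx mulr1 (inj_eq enum_val_inj).
    by case: eqVneq => [->|]; rewrite ?mul1r ?mul0r ?mulr1n ?mulr0n.
  by rewrite [Q^T _ _]mxE [Q _ _]mxE eq_sym (negbTE jb) mulr0.
have eS (a : 'I_r) : 1 < absK (e 0 a).
  by rewrite mxE; have := enum_valP a; rewrite inE.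
have e0 (a : 'I_r) : e 0 a != 0 by rewrite -absK_gt0 (lt_trans ltr01).
pose e' : 'rV[K]_r := \row_a (e 0 a)^-1.
have ee' : diag_mx e *m diag_mx e' = 1%:M.
  rewrite mulmx_diag; apply/matrixP => i j; rewrite !mxE.
  by case: eqVneq => // ->; have := e0 j; rewrite mxE => h; rewrite divff.
have [ue _] := mulmx1_unit ee'.
have ie : invmx (diag_mx e) = diag_mx e'.
  by apply: (can_inj (mulKmx ue)); rewrite mulmxV.
apply/eqP; rewrite eqn_leq; apply/andP; split.
  apply: leq_trans (_ : (\rank (Q^T *m diag_mx e *m Q) <= _)%N).
    apply: xr_le; apply/intmP => i j.
    have Ej k (a : 'I_r) : Q a k = (enum_val a == k)%:R by rewrite mxE.
    have EQ : (Q^T *m diag_mx e *m Q) i j = if (i == j) && (i \in S) then d 0 i else 0.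
      rewrite mxE; have [iS|iS] := boolP (i \in S); last first.
        rewrite andbF big1 // => a _; rewrite mul_mx_diag !mxE.
        case: eqP => [ai|_]; last by rewrite !mul0r.
        by move: iS; rewrite -ai enum_valP.
      rewrite (bigD1 (enum_rank_in iS i)) //= big1 ?addr0 => [|a ai].
        rewrite mul_mx_diag !mxE enum_rankK_in // eqxx mul1r andbT.
        by case: eqP; rewrite ?mulr1 ?mulr0.
      rewrite mul_mx_diag !mxE; case: eqP => [e1|_]; last by rewrite !mul0r.
      by move/eqP: ai => []; apply: enum_val_inj; rewrite enum_rankK_in.
    rewrite mxE [X in _ + X]mxE EQ mxE.
    case: eqVneq => [->|_] /=; last by rewrite subrr absK0.
    rewrite mulr1n; have [jS|jS] := boolP (j \in S); first by rewrite subrr absK0.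
    by rewrite subr0 leNgt; move: jS; rewrite inE.
  exact: leq_trans (mxrankM_maxr _ _) (rank_leq_row _).
have <- : xr (diag_mx e) = r.
  apply: xr_expanding => // i j; rewrite ie !mxE.
  case: eqP => _; last by rewrite mulr0n absK0 ltr01.
  have := eS i; rewrite mxE mulr1n absKV => h.
  by rewrite invf_lt1 // (lt_trans ltr01 h).
by rewrite -eQ xr_mul.
Qed.

End IntegralMatrices.

Arguments intm {R K} absK {m n} A.
Arguments redm {R p K} absK {m n} A.
Arguments taum {p K m n} M.
Arguments xr {R K} absK {m n} Z.

(** * Singular numbers *)

Section SmithForm.
Context {R : realType} {p : nat} {K : fieldType} {absK : K -> R}.
Context {Hp : prime_nat p} {HQ : Qp_field p absK}.
Local Notation intm := (intm absK).
Local Notation xr := (xr absK).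

Definition expand_sing (k : option int) : K :=
  if k is Some c then (p%:R : K) ^ (- c) else 0.

Lemma pdiagE n (k : {ffun 'I_n -> option int}) :
  pdiag K p k = diag_mx (\row_j expand_sing (k j)).
Proof. by []. Qed.

Lemma absK_expand_sing c : absK (expand_sing (Some c)) = pw p c.
Proof. by rewrite /= absK_pz opprK. Qed.

Lemma GLZp_tperm n (i j : 'I_n) : GLZp absK (tperm_mx i j : 'M[K]_n).
Proof. exact: GLZp_perm. Qed.

Lemma GLZp_scalar n (u : K) : absK u = 1 -> GLZp absK (u%:M : 'M[K]_n).
Proof.
move=> hu; apply: GLZp_det; first by apply: intm_scalar; rewrite hu.
by rewrite det_scalar absKX hu expr1n.
Qed.

Lemma max_entry m n (Z : 'M[K]_(m, n)) : Z != 0 ->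
  exists i j, Z i j != 0 /\ forall i' j', absK (Z i' j') <= absK (Z i j).
Proof.
move=> Z0; have [[i0 j0] h0] : exists ij : 'I_m * 'I_n, Z ij.1 ij.2 != 0.
  apply: contrapT => h; move/eqP: Z0; apply; apply/matrixP => i j; rewrite mxE.
  by apply: contrapT => /eqP zij; apply: h; exists (i, j).
pose F (ij : 'I_m * 'I_n) := absK (Z ij.1 ij.2).
have [[i j] _ h] := @arg_maxP _ _ _ (i0, j0) predT F isT.
exists i, j; split.
  by rewrite -absK_gt0; apply: lt_le_trans (h (i0, j0) isT); rewrite absK_gt0.
by move=> i' j'; exact: h (i', j') isT.
Qed.

Lemma absK_mulmx_le m n q (A : 'M[K]_(m, n)) (B : 'M[K]_(n, q)) e :
  0 <= e -> intm A -> (forall i j, absK (B i j) <= e) ->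
  forall i j, absK ((A *m B) i j) <= e.
Proof.
move=> e0 /intmP hA hB i j; rewrite mxE; apply: absK_sum_le => // k _.
by rewrite absKM -[e]mul1r ler_pM ?absK_ge0.
Qed.

Lemma absK_mulmx_ler m n q (A : 'M[K]_(m, n)) (B : 'M[K]_(n, q)) e :
  0 <= e -> intm B -> (forall i j, absK (A i j) <= e) ->
  forall i j, absK ((A *m B) i j) <= e.
Proof.
move=> e0 /intmP hB hA i j; rewrite mxE; apply: absK_sum_le => // k _.
by rewrite absKM -[e]mulr1 ler_pM ?absK_ge0.
Qed.

(** The diagonal form is obtained from Z by integral factors, so its entries are no larger than
    those of Z. In [smith] this places the pivot's exponent above all exponents of the remaining
    block. *)
Lemma smith_bound n (Z B C : 'M[K]_n) (k : {ffun 'I_n -> option int}) c :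
  GLZp absK B -> GLZp absK C -> Z = B *m pdiag K p k *m C ->
  (forall i j, absK (Z i j) <= pw p c) -> forall j, oint_le (k j) (Some c).
Proof.
move=> /GLZpE [iB uB iBV] /GLZpE [iC uC iCV] eZ hZ j.
have e : pdiag K p k = invmx B *m Z *m invmx C.
  by rewrite eZ !mulmxA mulVmx // mul1mx mulmxK.
have c0 : 0 <= pw p c :> R by exact: pw_ge0.
have := absK_mulmx_ler c0 iCV (absK_mulmx_le c0 iBV hZ) j j.
rewrite -e pdiagE !mxE eqxx mulr1n; case: (k j) => // d.
by rewrite absK_expand_sing ler_pw.
Qed.

Definition ffcons n (c : option int) (k : {ffun 'I_n -> option int}) :
  {ffun 'I_n.+1 -> option int} :=
  [ffun j => if unlift ord0 j is Some j' then k j' else c].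

Lemma pdiag_cons n c (k : {ffun 'I_n -> option int}) :
  pdiag K p (ffcons c k) =
  block_mx (expand_sing c)%:M 0 0 (pdiag K p k) :> 'M[K]_(1 + n).
Proof.
rewrite !pdiagE; have -> : \row_j expand_sing (ffcons c k j) =
  row_mx (\row__ expand_sing c) (\row_j expand_sing (k j)) :> 'rV[K]_(1 + n).
  apply/rowP => j; rewrite !mxE; case: splitP => i e; rewrite !mxE ffunE.
    have -> : j = @ord0 n by apply: val_inj; rewrite /= e ord1.
    by rewrite unlift_none.
  have -> : j = lift (@ord0 n) i by apply: val_inj; rewrite /= e.
  by rewrite liftK.
etransitivity; first exact: diag_mx_row.
congr block_mx.
by apply/matrixP => i j; rewrite !mxE !ord1.
Qed.

(** Gaussian elimination with an entry of maximal absolute value as pivot: the multipliers are then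
    integral, so every elimination step is invertible over the p-adic integers. *)
Lemma smith n (Z : 'M[K]_n) : exists k, singnums absK p Z k.
Proof.
elim: n Z => [|n IH] Z.
  exists [ffun=> None]; split; first by case.
  by exists 1%:M, 1%:M; split; [exact: GLZp1|exact: GLZp1|rewrite !thinmx0].
have [->|Z0] := eqVneq Z 0.
  exists [ffun=> None]; split; first by move=> i j _; rewrite !ffunE.
  exists 1%:M, 1%:M; split; [exact: GLZp1|exact: GLZp1|].
  rewrite mul1mx mulmx1; apply/matrixP => i j; rewrite pdiagE !mxE ffunE /=.
  by rewrite mul0rn.
have [i0 [j0 [h0 hmax]]] := max_entry Z0.
pose Pm := tperm_mx (ord0 : 'I_n.+1) i0 : 'M[K]_n.+1.
pose Qm := tperm_mx (ord0 : 'I_n.+1) j0 : 'M[K]_n.+1.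
have [Z1 dZ1] : exists A : 'M[K]_(1 + n), A = Pm *m Z *m Qm by eexists.
have Z1E i j : Z1 i j = Z (tperm ord0 i0 i) (tperm ord0 j0 j).
  have eQ : Qm = perm_mx (tperm ord0 j0)^-1%g by rewrite /Qm tpermV.
  by rewrite dZ1 eQ -col_permE /Pm /tperm_mx -row_permE !mxE.
set x := Z i0 j0 in h0 hmax.
have Z100 : Z1 0 0 = x by rewrite Z1E !tpermL.
have Z1max i j : absK (Z1 i j) <= absK x by rewrite Z1E.
have [c hc] := absK_pw h0.
(* The unit part of the pivot; it is absorbed by the left factor, so that a pure power of p stays on
   the diagonal. *)
pose u := x * (p%:R : K) ^ c.
have eu : absK u = 1 by rewrite /u absKM absK_pz hc -pwD subrr pw0.
have xu : x = u * expand_sing (Some c).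
  by rewrite /u /= -mulrA -expfzDr ?p_neq0 // subrr expr0z mulr1.
pose b := ursubmx Z1; pose l := dlsubmx Z1; pose d := drsubmx Z1.
have a1 : ulsubmx Z1 = x%:M.
  have aux (A : 'M[K]_(1 + n)) i j : ulsubmx A i j = A 0 0.
    by rewrite !mxE !ord1; congr (A _ _); apply: val_inj.
  by apply/matrixP => i j; rewrite aux Z100 mxE !ord1 mulr1n.
pose l' := x^-1 *: l; pose b' := x^-1 *: b.
have x0 : 0 < absK x by rewrite absK_gt0.
have il : intm l'.
  by apply/intmP => i j; rewrite !mxE absKM absKV mulrC ler_pdivrMr // mul1r.
have ib : intm b'.
  by apply/intmP => i j; rewrite !mxE absKM absKV mulrC ler_pdivrMr // mul1r.
(* The Schur complement of the pivot. Its entries are still bounded by the pivot, by the ultrametric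
   inequality. *)
pose d' := d - l *m b'.
have [k' [ks [B' [C' [gB gC eZ']]]]] := IH d'.
have d'max i j : absK (d' i j) <= pw p c.
  rewrite -hc mxE [X in _ + X]mxE absKB_le //; first by rewrite !mxE.
  by apply: absK_mulmx_ler => // [|i' j']; rewrite ?absK_ge0 // !mxE.
have kb := smith_bound gB gC eZ' d'max.
have eZ1 : Z1 = block_mx 1%:M 0 l' 1%:M *m block_mx x%:M 0 0 d' *m
                block_mx 1%:M b' 0 1%:M.
  rewrite !mulmx_block !(mul0mx, mulmx0, mul1mx, mulmx1, addr0, add0r).
  rewrite -[Z1 in LHS]submxK a1 -/b -/l -/d; congr block_mx.
  - by rewrite mul_scalar_mx scalerA divff // scale1r.
  - by rewrite mul_mx_scalar scalerA divff // scale1r.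
  - rewrite mul_mx_scalar scalerA divff // scale1r.
    by rewrite /d' addrC subrK.
exists (ffcons (Some c) k'); split.
  move=> i j ij; rewrite !ffunE; case: unliftP => [j' ej|ej].
    case: unliftP => [i' ei|_]; last exact: kb.
    by apply: ks; move: ij; rewrite ei ej /= /bump /= !add1n ltnS.
  case: unliftP => [i' ei|ei]; last by rewrite /= lexx.
  by move: ij; rewrite ei ej.
pose B1 : 'M[K]_(1 + n) := block_mx 1%:M 0 l' 1%:M *m block_mx u%:M 0 0 B'.
pose C1 : 'M[K]_(1 + n) := block_mx 1%:M 0 0 C' *m block_mx 1%:M b' 0 1%:M.
have gB1 : GLZp absK B1.
  by apply: GLZpM; apply: GLZp_lblock => //; rewrite ?intm0 //; do ?exact: GLZp1;
    exact: GLZp_scalar.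
have gC1 : GLZp absK C1.
  by apply: GLZpM; apply: GLZp_ublock => //; rewrite ?intm0 //; exact: GLZp1.
have eZ11 : Z1 = B1 *m pdiag K p (ffcons (Some c) k') *m C1.
  have key : block_mx x%:M 0 0 d' = block_mx u%:M 0 0 B' *m
      (block_mx (expand_sing (Some c))%:M 0 0 (pdiag K p k') *m block_mx 1%:M 0 0 C')
      :> 'M[K]_(1 + n).
    rewrite !mulmx_block !(mul0mx, mulmx0, mul1mx, mulmx1, addr0, add0r).
    by rewrite -scalar_mxM -xu eZ' mulmxA.
  rewrite eZ1 pdiag_cons /B1 /C1 !mulmxA; congr (_ *m _).
  rewrite -!mulmxA; congr (_ *m _); exact: key.
have gP : GLZp absK Pm by exact: GLZp_tperm.
have gQ : GLZp absK Qm by exact: GLZp_tperm.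
have [_ uP _] := gP; have [_ uQ _] := gQ.
exists (invmx Pm *m B1), (C1 *m invmx Qm); split.
- by apply: GLZpM => //; exact: GLZpV.
- by apply: GLZpM => //; exact: GLZpV.
- have eZ : Z = invmx Pm *m Z1 *m invmx Qm.
    by rewrite dZ1 !mulmxA mulVmx // mul1mx mulmxK.
  by rewrite eZ eZ11 !mulmxA.
Qed.

Lemma singP n (Z : 'M[K]_n) : singnums absK p Z (sing absK p Z).
Proof. by rewrite /sing; case: xgetP => [k _ //|h]; have [k /h] := smith Z. Qed.

(* The number of singular numbers of [Z] that exceed [i]. *)
Definition Xfun n (Z : 'M[K]_n) (i : nat) : nat := xr ((p%:R : K) ^+ i *: Z).

Lemma xr_smith n (Z B C : 'M[K]_n) (k : {ffun 'I_n -> option int}) (e : int) :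
  GLZp absK B -> GLZp absK C -> Z = B *m pdiag K p k *m C ->
  xr ((p%:R : K) ^ e *: Z) = #|[pred j | ~~ oint_le (k j) (Some e)]|.
Proof.
move=> gB gC ->; rewrite scalemxAl scalemxAr xr_GL //.
pose d := \row_j ((p%:R : K) ^ e * expand_sing (k j)).
have -> : (p%:R : K) ^ e *: pdiag K p k = diag_mx d.
  by apply/matrixP => i j; rewrite pdiagE !mxE mulrnAr.
rewrite xr_diag; apply: eq_card => j; rewrite !inE mxE absKM absK_pz.
case: (k j) => [c|] /=; last by rewrite absK0 mulr0 ltr10.
by rewrite absK_pz opprK -pwD -(@pw0 R p) ltr_pw; lia.
Qed.

Lemma Xfun_smith n (Z : 'M[K]_n) (i : nat) :
  Xfun Z i = #|[pred j | ~~ oint_le (sing absK p Z j) (Some i%:Z)]|.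
Proof.
by have [_ [B [C [gB gC eZ]]]] := singP Z; rewrite /Xfun (xr_smith i gB gC eZ).
Qed.

Lemma Xfun_mono n (Z : 'M[K]_n) i j : (i <= j)%N -> (Xfun Z j <= Xfun Z i)%N.
Proof.
move=> ij; rewrite /Xfun -(subnK ij) exprD -scalerA; apply: xr_scale.
by rewrite absKX exprn_ile1 ?absK_ge0 // absK_nat.
Qed.

Lemma Xfun_eventually0 n (Z : 'M[K]_n) : exists i, Xfun Z i = 0%N.
Proof.
pose F (j : 'I_n) := if sing absK p Z j is Some c then `|c|%N else 0%N.
exists (\max_j F j)%N; rewrite Xfun_smith; apply: eq_card0 => j; rewrite !inE.
apply/negbTE; rewrite negbK.
have : (F j <= \max_j F j)%N by exact: leq_bigmax.
by rewrite /F; case: (sing _ _ _ _) => //= c h; lia.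
Qed.

Lemma Xfun_int n (Z Z' : 'M[K]_n) i : intm (Z - Z') -> Xfun Z i = Xfun Z' i.
Proof.
move=> h; apply: eq_xr; rewrite -scalerBr; apply: intmZ => //.
by rewrite absKX exprn_ile1 ?absK_ge0 // absK_nat.
Qed.

Lemma Xfun_seq n (Z : 'M[K]_n) : exists xs, is_partition xs /\
  forall i, Xfun Z i = nth 0%N xs i.
Proof.
have [] := Xfun_eventually0 Z => i0 hi0.
have ex : exists i, Xfun Z i == 0%N by exists i0; apply/eqP.
have hm : exists m, Xfun Z m = 0%N /\ forall i, (i < m)%N -> (0 < Xfun Z i)%N.
  case: (ex_minnP ex) => m /eqP h1 h2; exists m; split => // i im.
  by rewrite lt0n; apply/negP => /h2; rewrite leqNgt im.
have [m [h1 h2]] := hm.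
exists (mkseq (Xfun Z) m); split.
  apply/andP; split; last by apply/allP => x /mapP [i]; rewrite mem_iota => /andP [_ im] ->;
    apply: h2.
  rewrite /mkseq sorted_map; apply: sub_sorted (iota_sorted 0 m) => i j /=.
  exact: Xfun_mono.
move=> i; have [im|im] := ltnP i m; first by rewrite nth_mkseq.
rewrite nth_default ?size_mkseq //.
by apply/eqP; rewrite -leqn0 -h1 Xfun_mono.
Qed.

(** Double counting: a singular number c > 0 contributes one to each X_i with 0 <= i < c, so the
    exponents in [gammaZ] add up to the sum of the X_i. *)
Lemma gammaZ_seq n (Z : 'M[K]_n) xs :
  (forall i, Xfun Z i = nth 0%N xs i) -> gammaZ absK p Z = pw p (sumn xs).
Proof.
move=> hX; set m := size xs.
pose kp (j : 'I_n) := (\sum_(i < m) ~~ oint_le (sing absK p Z j) (Some i%:Z))%N.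
have kle (j : 'I_n) : oint_le (sing absK p Z j) (Some m%:Z).
  have : Xfun Z m = 0%N by rewrite hX nth_default.
  rewrite Xfun_smith => /card0_eq /(_ j); rewrite !inE => /negbT.
  by rewrite negbK.
have kpE (j : 'I_n) : (if sing absK p Z j is Some c then
    if 0 < c then pw p c else 1 else 1) = pw p (kp j) :> R.
  rewrite /kp; have := kle j; case: (sing _ _ _ j) => [c|] /=; last first.
    by rewrite big1 ?pw0.
  move=> cm; have -> : (\sum_(i < m) ~~ (c <= i)%R)%N = if 0 < c then `|c|%N else 0%N.
    transitivity (\sum_(i < m | (i < (if (0 < c)%R then `|c|%N else 0%N))%N) 1)%N.
      rewrite [RHS]big_mkcond /=; apply: eq_bigr => i _.
      have -> : (i < (if (0 < c)%R then `|c| else 0))%N = ~~ (c <= i)%R.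
        by case: (ltrP 0 c); lia.
      by case: (_ <= _).
    rewrite -(big_ord_widen m (fun=> 1%N)) ?sum1_card ?card_ord //.
    by case: (ltrP 0 c) => //; lia.
  by case: (ltrP 0 c) => h; rewrite ?pw0 // gtz0_abs.
rewrite /gammaZ (eq_bigr _ (fun j _ => kpE j)).
have -> : sumn xs = (\sum_j kp j)%N.
  rewrite exchange_big /= sumnE (big_nth 0%N) big_mkord; apply: eq_bigr => i _.
  rewrite -hX Xfun_smith -sum1_card big_mkcond; apply: eq_bigr => j _.
  by rewrite inE; case: (oint_le _ _).
elim/big_ind2: _ => [|x1 a1 x2 a2 -> ->|//]; first by rewrite pw0.
by rewrite -pwD.
Qed.

End SmithForm.

Arguments Xfun {R} p {K} absK {n} Z i.

(** * Counting lifts of cosets *)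

Section RankCount.
Context {R : realType} {p : nat} {Hp : prime_nat p}.
Local Notation P := (p%:R : R).

Definition card_rank m n l : nat := #|[pred M : 'M['F_p]_(m, n) | \rank M == l]|.

Lemma card_Fp_mx m n : #|{: 'M['F_p]_(m, n)}| = (p ^ (m * n))%N.
Proof. by rewrite card_mx card_Fp. Qed.

Lemma card_row_space m n (A : 'M['F_p]_(m, n)) :
  #|[pred v : 'rV['F_p]_n | (v <= A)%MS]| = (p ^ \rank A)%N.
Proof.
pose f (u : 'rV['F_p]_(\rank A)) := u *m row_base A.
have fI : injective f by apply: row_free_inj; exact: row_base_free.
rewrite -[RHS](_ : #|{: 'rV['F_p]_(\rank A)}| = _); last by rewrite card_Fp_mx mul1n.
rewrite -(card_codom fI); apply: eq_card => v; rewrite !inE -(eq_row_base A).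
apply/submxP/codomP => [[u ->]|[u ->]]; by exists u.
Qed.

Lemma rank_add_row m n (v : 'rV['F_p]_n) (A : 'M['F_p]_(m, n)) :
  \rank (col_mx v A) = (\rank A + ~~ (v <= A)%MS)%N.
Proof.
rewrite -addsmxE; have [vA|vA] := boolP (v <= A)%MS.
  by rewrite addn0 (addsmx_idPr vA).
apply/eqP; rewrite eqn_leq; apply/andP; split.
  apply: leq_trans (mxrank_adds_leqif _ _) _.
  by rewrite addnC leq_add2l rank_leq_row.
rewrite addn1; have : (A < v + A)%MS.
  by rewrite /ltmx addsmxSr; apply: contra vA => /(submx_trans (addsmxSl _ _)).
exact: rank_ltmx.
Qed.

(** Prepend a row to a matrix of rank r: the p^r rows of its row space keep the rank, the p^n - p^r
    others raise it by one. *)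
Lemma rkcS m n l : (card_rank m.+1 n l =
  p ^ l * card_rank m n l + (if l is l'.+1 then (p ^ n - p ^ l') * card_rank m n l' else 0))%N.
Proof.
pose f (x : 'rV['F_p]_n * 'M['F_p]_(m, n)) : 'M['F_p]_(1 + m, n) := col_mx x.1 x.2.
have fb : bijective f.
  exists (fun M => (usubmx M, dsubmx M)) => [[u v]|M]; rewrite /f /=.
    by rewrite col_mxKu col_mxKd.
  by rewrite vsubmxK.
have cardv (M : 'M['F_p]_(m, n)) b :
  (\sum_(v : 'rV['F_p]_n | eqb (v <= M)%MS b) 1 = if b then p ^ \rank M else p ^ n - p ^ \rank M)%N.
  case: b; rewrite sum1_card.
    by rewrite -card_row_space; apply: eq_card => v; rewrite -!topredE /= /eqb addbT negbK.
  apply/eqP; rewrite -(eqn_add2l (p ^ \rank M)) -{1}card_row_space subnKC; last first.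
    by rewrite leq_exp2l ?prime_gt1 // rank_leq_col.
  rewrite -[X in _ == X](_ : #|{: 'rV['F_p]_n}| = _); last by rewrite card_Fp_mx mul1n.
  rewrite -(cardC [pred v : 'rV['F_p]_n | (v <= M)%MS]) eqn_add2l.
  by apply/eqP/eq_card => v; rewrite -!topredE /= /eqb addbF.
rewrite {1}/card_rank -sum1_card (reindex f) /=; last exact: onW_bij.
transitivity (\sum_(M : 'M['F_p]_(m, n)) \sum_(v : 'rV['F_p]_n | \rank (col_mx v M) == l) 1)%N.
  rewrite [RHS](exchange_big_dep xpredT) //= [RHS]pair_big_dep /=.
  by apply: eq_bigl => -[u M].
have split1 (M : 'M['F_p]_(m, n)) :
  (\sum_(v : 'rV['F_p]_n | \rank (col_mx v M) == l) 1 =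
   (\rank M == l) * p ^ \rank M + ((\rank M).+1 == l) * (p ^ n - p ^ \rank M))%N.
  rewrite -{1}(cardv M true) -{1}(cardv M false) !big_distrr /=.
  rewrite [X in _ = (X + _)%N]big_mkcond [X in _ =
    (_ + X)%N]big_mkcond -big_split [LHS]big_mkcond /=.
  apply: eq_bigr => v _; rewrite rank_add_row.
  by case: (v <= M)%MS; rewrite ?addn0 ?addn1 ?muln1; case: (_ == _).
rewrite (eq_bigr _ (fun M _ => split1 M)) big_split /=; congr (_ + _)%N.
  rewrite /card_rank -sum1_card big_distrr /= [RHS]big_mkcond /=; apply: eq_bigr => M _.
  by rewrite inE; case: eqP => [->|_]; rewrite ?mul1n ?mul0n ?muln1.
case: l {split1} => [|l]; first by rewrite big1.
rewrite /card_rank -sum1_card big_distrr /= [RHS]big_mkcond /=; apply: eq_bigr => M _.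
by rewrite inE eqSS; case: eqP => [->|_]; rewrite ?mul1n ?mul0n ?muln1.
Qed.

(** At x = p^n this is the number of l-tuples of independent vectors in a space of dimension n over
    F_p. *)
Definition ffact_prod (l : nat) (x : R) : R := \prod_(j < l) (x - P ^+ j).

Lemma ffact_prodS l x : ffact_prod l.+1 x = ffact_prod l x * (x - P ^+ l).
Proof. by rewrite /ffact_prod big_ord_recr. Qed.

(** Each factor p x - p^(j+1) equals p (x - p^j); only the factor p x - 1 is new. This serves the
    induction on the number of rows, where p^m becomes p^(m+1). *)
Lemma ffact_prod_mul l x :
  ffact_prod l.+1 (P * x) = (P * x - 1) * P ^+ l * ffact_prod l x.
Proof.
elim: l => [|l ih]; first by rewrite ffact_prodS /ffact_prod !big_ord0 !expr0; ring.
by rewrite ffact_prodS ih ffact_prodS !exprS; ring.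
Qed.

(** The classical count of matrices of given rank, kept free of division; both sides vanish when l
    exceeds m or n. *)
Lemma card_rank_formula m n l : (card_rank m n l)%:R * ffact_prod l (P ^+ l) =
  ffact_prod l (P ^+ m) * ffact_prod l (P ^+ n).
Proof.
have rle k : (card_rank k n l = 0)%N \/ (l <= n)%N.
  case: (leqP l n) => ln; [by right|left].
  apply: eq_card0 => M; rewrite !inE; apply/eqP => e.
  by have := rank_leq_col M; rewrite e leqNgt ln.
elim: m l rle => [|m ih] l rle.
  case: l {rle} => [|l].
    rewrite /ffact_prod !big_ord0 !mulr1 /card_rank -sum1_card (eq_bigl xpredT).
      by rewrite sum1_card card_Fp_mx mul0n expn0.
    by move=> M; rewrite inE flatmx0 mxrank0 eqxx.
  rewrite /card_rank eq_card0 ?mul0r; last by move=> M; rewrite inE flatmx0 mxrank0.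
  by rewrite {1}/ffact_prod big_ord_recl expr0 subrr !mul0r.
have rle' k l' : (card_rank k n l' = 0)%N \/ (l' <= n)%N.
  case: (leqP l' n) => ln; [by right|left].
  apply: eq_card0 => M; rewrite !inE; apply/eqP => e.
  by have := rank_leq_col M; rewrite e leqNgt ln.
rewrite rkcS; case: l {rle} => [|l].
  rewrite expn0 mul1n addn0 ih; last by move=> k; exact: rle'.
  by rewrite /ffact_prod !big_ord0.
rewrite natrD mulrDl natrM -mulrA ih; last by move=> k; exact: rle'.
(* The natural subtraction agrees with the real one for l <= n; for l > n the cardinal it multiplies
   is 0. *)
have -> : ((p ^ n - p ^ l) * card_rank m n l)%:R = (P ^+ n - P ^+ l) * (card_rank m n l)%:R.
  case: (rle' m l) => [->|ln]; first by rewrite muln0 mulr0.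
  by rewrite natrM natrB ?natrX // leq_exp2l ?prime_gt1.
have e1 : ffact_prod l.+1 (P ^+ l.+1) = (P * P ^+ l - 1) * P ^+ l * ffact_prod l (P ^+ l).
  by rewrite exprS ffact_prod_mul.
have e2 : ffact_prod l.+1 (P ^+ m.+1) = (P * P ^+ m - 1) * P ^+ l * ffact_prod l (P ^+ m).
  by rewrite exprS ffact_prod_mul.
have ihl := ih l (rle' ^~ l).
transitivity ((p ^ l.+1)%:R * (ffact_prod l.+1 (P ^+ m) * ffact_prod l.+1 (P ^+ n)) +
  (P ^+ n - P ^+ l) * ((P * P ^+ l - 1) * P ^+ l) *
  ((card_rank m n l)%:R * ffact_prod l (P ^+ l))).
  by rewrite e1; ring.
by rewrite ihl e2 !ffact_prodS natrX exprS; ring.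
Qed.

Lemma card_rank_drsub x n l :
  #|[pred M : 'M['F_p]_(x + n) | \rank (drsubmx M) == l]| =
  (p ^ (x * x + x * n + n * x) * card_rank n n l)%N.
Proof.
pose T := ('M['F_p]_x * 'M['F_p]_(x, n) * 'M['F_p]_(n, x))%type.
pose f (t : T * 'M['F_p]_n) := block_mx t.1.1.1 t.1.1.2 t.1.2 t.2.
have fb : bijective f.
  exists (fun M => ((ulsubmx M, ursubmx M, dlsubmx M), drsubmx M)) => [[[[a b] c] d]|M];
    rewrite /f /=.
    by rewrite block_mxKul block_mxKur block_mxKdl block_mxKdr.
  by rewrite submxK.
rewrite -sum1_card (reindex f) /=; last exact: onW_bij.
rewrite !expnD -!card_Fp_mx -!card_prod /card_rank -!sum1_card big_distrl /=.
under [RHS]eq_bigr do rewrite big_distrr /=.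
rewrite pair_big /=; apply: eq_big => [[t d]|//].
by rewrite !inE block_mxKdr.
Qed.

End RankCount.

Arguments card_rank p m n l : clear implicits.

(** * Lifting a coset of p Z to cosets of Z *)

Section CosetCount.
Context {R : realType} {p : nat} {K : fieldType} {absK : K -> R}.
Context {Hp : prime_nat p} {HQ : Qp_field p absK}.
Local Notation intm := (intm absK).
Local Notation xr := (xr absK).
Local Notation redm := (redm (p := p) absK).

Lemma absK_pinv : absK (p%:R^-1) = pw p 1.
Proof. by rewrite absKV absK_p pwN invrK. Qed.

Lemma absK_pinv_gt1 : 1 < absK (p%:R^-1).
Proof. by rewrite absK_gt1 absK_pinv. Qed.

Lemma intm_of_pinvZ m n (A : 'M[K]_(m, n)) : intm (p%:R^-1 *: A) -> intm A.
Proof.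
rewrite intm_pinvZ => /forallP h; apply/intmP => i j.
by have /forallP/(_ j)/ltW := h i.
Qed.

(** The large block U = diag e + T11 has an inverse divisible by p. Eliminating with integral
    matrices leaves U and the Schur complement S, which is congruent to T22 modulo p. After division
    by p, the block U accounts for x and S for the rank of T22 modulo p. *)
Lemma xr_block x n (e : 'rV[K]_x) (T : 'M[K]_(x + n)) :
  (forall j, 1 < absK (e 0 j)) -> intm T ->
  xr (p%:R^-1 *: (block_mx (diag_mx e) 0 0 0 + T)) = (x + \rank (redm (drsubmx T)))%N.
Proof.
move=> he hT.
have iT i j : absK (T i j) <= 1 by move: i j; exact/intmP.
set T11 := ulsubmx T; set T12 := ursubmx T; set T21 := dlsubmx T; set T22 := drsubmx T.
have i11 : intm T11 by apply/intmP => i j; rewrite !mxE.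
have i12 : intm T12 by apply/intmP => i j; rewrite !mxE.
have i21 : intm T21 by apply/intmP => i j; rewrite !mxE.
have i22 : intm T22 by apply/intmP => i j; rewrite !mxE.
have e0 j : e 0 j != 0 by rewrite -absK_gt0 (lt_trans ltr01).
pose f : 'rV[K]_x := \row_j (e 0 j)^-1.
have ef : diag_mx e *m diag_mx f = 1%:M.
  rewrite mulmx_diag; apply/matrixP => i j; rewrite !mxE.
  by case: eqVneq => // ->; rewrite divff.
have fe : diag_mx f *m diag_mx e = 1%:M by exact: mulmx1C.
have pf : intm (p%:R^-1 *: diag_mx f).
  rewrite intm_pinvZ; apply/forallP => i; apply/forallP => j; rewrite !mxE.
  case: eqVneq => _; last by rewrite absK0.
  by rewrite mulr1n absKV invf_lt1 // (lt_trans ltr01).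
have ifx : intm (diag_mx f) by exact: intm_of_pinvZ.
(* U factors as diag e times [G], and [G] is congruent to the identity because diag e has an inverse
   divisible by p. *)
pose G := 1%:M + diag_mx f *m T11.
have iG : intm G by rewrite intmD ?intm1 // intm_mul // intm_of_pinvZ.
have gG : GLZp absK G.
  apply: GLZp_red => //; rewrite (eq_redm (B := 1%:M)) ?redm1 ?unitmx1 ?intm1 //.
  by rewrite /G addrAC subrr add0r scalemxAl intm_mul.
have [_ uG _] := gG; have /GLZpE [_ _ iGV] := gG.
pose U := diag_mx e + T11.
have UE : U = diag_mx e *m G.
  by rewrite /G mulmxDr mulmx1 mulmxA ef mul1mx.
pose V := invmx G *m diag_mx f.
have UV : U *m V = 1%:M by rewrite UE /V -mulmxA mulKVmx.
have VU : V *m U = 1%:M by exact: mulmx1C.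
have pV : intm (p%:R^-1 *: V) by rewrite /V scalemxAr intm_mul.
have iV : intm V by exact: intm_of_pinvZ.
pose S := T22 - T21 *m V *m T12.
have iS : intm S by rewrite intmB // !intm_mul.
have rS : redm S = redm T22.
  apply: eq_redm => //; rewrite /S addrAC subrr add0r scalerN intmN.
  by rewrite -mulmxA scalemxAr scalemxAl !intm_mul.
have -> : block_mx (diag_mx e) 0 0 0 + T =
  block_mx 1%:M 0 (T21 *m V) 1%:M *m block_mx U 0 0 S *m
  block_mx 1%:M (V *m T12) 0 1%:M.
  rewrite -[T in LHS]submxK add_block_mx !add0r -/T11 -/T12 -/T21 -/T22 -/U.
  rewrite !mulmx_block !(mul0mx, mulmx0, mul1mx, mulmx1, addr0, add0r).
  rewrite -(mulmxA T21) VU mulmx1 (mulmxA U) UV mul1mx /S mulmxA.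
  by rewrite [_ + (_ - _)]addrCA subrr addr0.
rewrite scalemxAl scalemxAr xr_GL; last first.
- by apply: GLZp_ublock; rewrite ?intm_mul //; exact: GLZp1.
- by apply: GLZp_lblock; rewrite ?intm_mul //; exact: GLZp1.
rewrite -rS; set r := \rank _.
(* The rank normal form of S over F_p, lifted. Replacing S by the lifted product changes it by a
   multiple of p, hence does not affect [xr] after division by p. *)
pose L : 'M[K]_n := taum (col_ebase (redm S)).
pose Q : 'M[K]_n := taum (row_ebase (redm S)).
have gL : GLZp absK L by apply: GLZp_red; rewrite ?intm_tau ?taumK ?col_ebase_unit.
have gQ : GLZp absK Q by apply: GLZp_red; rewrite ?intm_tau ?taumK ?row_ebase_unit.
pose dr : 'rV[K]_n := \row_j (j < r)%:R.
have idr : intm (diag_mx dr).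
  apply/intmP => i j; rewrite !mxE; case: (_ == _); last by rewrite absK0.
  by rewrite mulr1n absK_nat.
have rdr : redm (diag_mx dr) = pid_mx r.
  apply/matrixP => i j; rewrite !mxE; case: eqVneq => [->|ij] /=.
    by rewrite eqxx mulr1n red_nat.
  by rewrite mulr0n red0; case: eqP => // /val_inj e1; rewrite e1 eqxx in ij.
have iLQ : intm (L *m diag_mx dr *m Q) by rewrite !intm_mul ?intm_tau.
have rLQ : redm (L *m diag_mx dr *m Q) = redm S.
  by rewrite !redmM ?intm_mul ?intm_tau // !taumK rdr mulmx_ebase.
rewrite (eq_xr (Z' := p%:R^-1 *: block_mx U 0 0 (L *m diag_mx dr *m Q))); last first.
  rewrite -scalerBr opp_block_mx add_block_mx !subrr scale_block_mx !scaler0.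
  by rewrite intm_block ?intm0 // redm_eq_close.
have -> : block_mx U 0 0 (L *m diag_mx dr *m Q) =
  block_mx 1%:M 0 0 L *m diag_mx (row_mx e dr) *m block_mx G 0 0 Q.
  rewrite diag_mx_row !mulmx_block !(mul0mx, mulmx0, mul1mx, mulmx1, addr0, add0r).
  by rewrite -UE.
rewrite scalemxAl scalemxAr xr_GL; last first.
- by apply: GLZp_ublock; rewrite ?intm0.
- by apply: GLZp_lblock; rewrite ?intm0 //; exact: GLZp1.
have -> : p%:R^-1 *: diag_mx (row_mx e dr) = diag_mx (p%:R^-1 *: row_mx e dr).
  by apply/matrixP => i j; rewrite !mxE mulrnAr.
rewrite xr_diag -sum1_card big_mkcond big_split_ord /=; congr (_ + _)%N.
  rewrite -[RHS]card_ord -sum1_card; apply: eq_bigr => j _.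
  rewrite inE mxE row_mxEl absKM.
  by rewrite (lt_trans absK_pinv_gt1) // ltr_pMr ?he // (lt_trans ltr01 absK_pinv_gt1).
have rn : (r <= n)%N by exact: rank_leq_row.
transitivity (\sum_(j < n | (j < r)%N) 1)%N.
  rewrite [RHS]big_mkcond; apply: eq_bigr => j _.
  rewrite inE mxE row_mxEr mxE absKM.
  by case: (_ < _)%N; rewrite ?absK1 ?absK0 ?mulr1 ?mulr0 ?absK_pinv_gt1 ?ltr10.
by rewrite -(big_ord_widen n (fun=> 1%N)) // sum1_card card_ord.
Qed.

Lemma card_initial_segment N (Q : pred 'I_N) :
  (forall i j : 'I_N, (i <= j)%N -> Q j -> Q i) -> forall j, Q j = (j < #|Q|)%N.
Proof.
move=> hQ.
have c m : (m <= N)%N -> #|[pred i : 'I_N | (i < m)%N]| = m.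
  by move=> mN; rewrite -sum1_card -(big_ord_widen N (fun=> 1%N)) // sum1_card card_ord.
move=> j; apply/idP/idP => [Qj|].
  rewrite -[X in (X <= _)%N]c ?ltn_ord //; apply: subset_leq_card.
  by apply/fintype.subsetP => i; rewrite !inE ltnS => ij; exact: hQ Qj.
apply: contraTT => Qj; suff : (#|Q| <= j)%N by rewrite leqNgt.
rewrite -[X in (_ <= X)%N](c j (ltnW (ltn_ord j))).
apply: subset_leq_card; apply/fintype.subsetP => i; rewrite !inE => Qi.
by rewrite ltnNge; apply: contra Qj => ji; exact: hQ Qi.
Qed.

(** In coordinates where p Z0 is diagonal, the residue matrix M enters through an affine bijection
    [phi], and by [xr_block] only the rank of the lower right block of [phi M] matters; the other
    three blocks are free. *)
Lemma card_xr_coset x n l (Z0 : 'M[K]_(x + n)) : xr ((p%:R : K) *: Z0) = x ->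
  #|[pred M : 'M['F_p]_(x + n) | xr (Z0 + p%:R^-1 *: taum M) == (x + l)%N]| =
  (p ^ (x * x + x * n + n * x) * card_rank p n n l)%N.
Proof.
move=> hx; have [ks [B [C [gB gC eZ]]]] := singP ((p%:R : K) *: Z0).
set k := sing absK p _ in ks eZ.
(* The singular numbers are sorted, so the x positive ones of p Z0 fill exactly the first block of
   the splitting x + n. *)
have kx (j : 'I_(x + n)) : ~~ oint_le (k j) (Some 0) = (j < x)%N.
  have := @card_initial_segment (x + n) [pred j : 'I_(x + n) | ~~ oint_le (k j) (Some 0)].
  rewrite -(xr_smith 0 gB gC eZ) expr0z scale1r hx; apply.
  move=> a b ab /=; apply: contra; have := ks _ _ ab.
  by case: (k b) => [c|//]; case: (k a) => [c'|//] /= h /(le_trans h).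
have [iB uB iBV] := (GLZpE _).1 gB; have [iC uC iCV] := (GLZpE _).1 gC.
pose d : 'rV[K]_(x + n) := \row_j expand_sing (p := p) (k j).
pose e : 'rV[K]_x := lsubmx d.
pose Di : 'M[K]_(x + n) := block_mx 0 0 0 (diag_mx (rsubmx d)).
have he j : 1 < absK (e 0 j).
  rewrite !mxE; have := kx (lshift n j); rewrite /= ltn_ord.
  by case: (k _) => //= c; rewrite -ltNge absK_pz opprK -(@pw0 R p) ltr_pw.
have iDi : intm Di.
  rewrite intm_block ?intm0 //; apply/intmP => i j; rewrite !mxE.
  case: eqVneq => _; last by rewrite mulr0n absK0.
  rewrite mulr1n; have := kx (rshift x i).
  rewrite [RHS]ltnNge leq_addr /= => /negbT.
  case: (k _) => [c|] /=; last by rewrite absK0.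
  by rewrite negbK absK_pz opprK -(@pw0 R p) ler_pw.
have De : pdiag K p k = block_mx (diag_mx e) 0 0 0 + Di.
  by rewrite pdiagE -/d -[d]hsubmxK diag_mx_row add_block_mx !addr0 !add0r.
pose phi (M : 'M['F_p]_(x + n)) := redm Di + redm (invmx B) *m M *m redm (invmx C).
have phib : bijective phi.
  apply: injF_bij => M M' /addrI.
  have uB' : redm (invmx B) \in unitmx by apply: unitmx_redm; exact: GLZpV.
  have uC' : redm (invmx C) \in unitmx by apply: unitmx_redm; exact: GLZpV.
  move=> /(can_inj (mulmxK uC')).
  exact: (can_inj (mulKmx uB')).
have key (M : 'M['F_p]_(x + n)) :
  xr (Z0 + p%:R^-1 *: taum M) = (x + \rank (drsubmx (phi M)))%N.
  pose T := Di + invmx B *m taum M *m invmx C.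
  have iT : intm T by rewrite intmD // !intm_mul ?intm_tau.
  have -> : drsubmx (phi M) = redm (drsubmx T).
    have -> : phi M = redm T.
      by rewrite /T redmD ?intm_mul ?intm_tau // !redmM ?intm_mul ?intm_tau // taumK.
    by apply/matrixP => i j; rewrite !mxE.
  rewrite -(xr_block he iT) addrA -De -[RHS](xr_GL _ gB gC).
  congr (xr _); rewrite -scalemxAr -scalemxAl mulmxDr mulmxDl -eZ scalerDr.
  rewrite scalerA mulVf ?p_neq0 // scale1r; congr (_ + _ *: _).
  by rewrite !mulmxA mulmxV // mul1mx mulmxKV.
rewrite -card_rank_drsub -!sum1_card [RHS](reindex phi) /=; last exact: onW_bij.
by apply: eq_bigl => M; rewrite !inE key eqn_add2l.
Qed.

(** Multiplying the lift by p brings back p Z0 up to an integral matrix, and this cannot raise [xr].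
    Hence the value 0 in [level_count] when the next entry is larger. *)
Lemma xr_coset_ge n (Z0 : 'M[K]_n) (M : 'M['F_p]_n) :
  (xr ((p%:R : K) *: Z0) <= xr (Z0 + p%:R^-1 *: taum M))%N.
Proof.
apply: leq_trans (_ : (xr (p%:R *: (Z0 + p%:R^-1 *: taum M)) <= _)%N); last first.
  by apply: xr_scale; exact: absK_nat.
rewrite scalerDr scalerA divff ?p_neq0 // scale1r leq_eqVlt (eq_xr (Z' := p%:R *: Z0 + taum M))
  ?eqxx //.
by rewrite opprD addrA subrr add0r intmN intm_tau.
Qed.

End CosetCount.

(** * q-Pochhammer symbols *)

Section QPochhammer.
Context {R : realType}.
Implicit Types (a q : R).

Lemma qpochS a q n : qpoch a q n.+1 = qpoch a q n * (1 - a * q ^+ n).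
Proof. by rewrite /qpoch big_ord_recr. Qed.

Lemma qpoch0 a q : qpoch a q 0 = 1.
Proof. by rewrite /qpoch big_ord0. Qed.

Lemma prod_le1 n (F : 'I_n -> R) :
  (forall i, 0 <= F i <= 1) -> \prod_(i < n) F i <= 1.
Proof.
move=> hF; suff /andP[] : 0 <= \prod_(i < n) F i <= 1 by [].
elim/big_ind: _ => [|x y /andP[x0 x1] /andP[y0 y1]|i _]; rewrite ?ler01 ?lexx //.
by rewrite mulr_ge0 // mulr_ile1.
Qed.

Section Bounds.
Variables a q : R.
Hypotheses (a0 : 0 <= a) (a1 : a < 1) (q0 : 0 <= q) (q1 : q < 1).

Lemma aq_ge0 j : 0 <= a * q ^+ j.
Proof. by rewrite mulr_ge0 ?exprn_ge0. Qed.

Lemma aq_lt1 j : a * q ^+ j < 1.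
Proof.
apply: le_lt_trans a1; rewrite ler_piMr // exprn_ile1 // ltW //.
Qed.

Lemma qpoch_gt0 n : 0 < qpoch a q n.
Proof. by apply: prodr_gt0 => j _; rewrite subr_gt0 aq_lt1. Qed.

Lemma qpoch_decr m n : (m <= n)%N -> qpoch a q n <= qpoch a q m.
Proof.
elim: n => [|n ih]; first by rewrite leqn0 => /eqP->.
rewrite leq_eqVlt => /predU1P[->//|/ih h]; apply: le_trans h.
by rewrite qpochS ler_piMr ?(ltW (qpoch_gt0 _)) // gerBl aq_ge0.
Qed.

Lemma cvg_qpoch : qpoch a q n @[n --> \oo] --> qpoch_inf a q.
Proof.
apply: nonincreasing_is_cvgn; first by move=> m n; exact: qpoch_decr.
by exists 0 => _ [n _ <-]; exact/ltW/qpoch_gt0.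
Qed.

(* A Weierstrass-product bound on the tail, whose geometric sum is made smaller than 1/2. *)
Lemma qpoch_inf_gt0 : 0 < qpoch_inf a q.
Proof.
have q1' : `|q| < 1 by rewrite ger0_norm.
have [m _ hm] : \forall n \near \oo, q ^+ n < (1 - q) / 2.
  have e0 : 0 < (1 - q) / 2 by rewrite divr_gt0 // subr_gt0.
  have /cvgrPdist_lt/(_ _ e0) := cvg_expr q1'; apply: filterS => n.
  by rewrite sub0r normrN ger0_norm // exprn_ge0.
have hm' : q ^+ m < (1 - q) / 2 by apply: hm => /=.
have tail k : 1 - a * q ^+ m * \sum_(j < k) q ^+ j <=
    \prod_(j < k) (1 - a * q ^+ (m + j)).
  elim: k => [|k ih]; first by rewrite !big_ord0 mulr0 subr0.
  rewrite !big_ord_recr /=.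
  set x := a * q ^+ (m + k).
  have x0 : 0 <= x by exact: aq_ge0.
  have x1 : x < 1 by exact: aq_lt1.
  set pr := \prod_(j < k) _ in ih *.
  have p1 : pr <= 1.
    by apply: prod_le1 => j; rewrite subr_ge0 ltW ?aq_lt1 //= gerBl aq_ge0.
  have -> : a * q ^+ m * (\sum_(i < k) q ^+ i + q ^+ k) =
    a * q ^+ m * \sum_(i < k) q ^+ i + x by rewrite /x exprD; ring.
  nra.
have half k : 2^-1 <= \prod_(j < k) (1 - a * q ^+ (m + j)).
  apply: le_trans (tail k).
  have gs : (1 - q) * \sum_(j < k) q ^+ j = 1 - q ^+ k.
    by rewrite -opprB -[1 - _ ^+ _]opprB mulNr -subrX1.
  have s0 : 0 <= \sum_(j < k) q ^+ j by apply: sumr_ge0 => j _; rewrite exprn_ge0.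
  have qk : 0 <= q ^+ k by rewrite exprn_ge0.
  have qm : 0 <= q ^+ m by rewrite exprn_ge0.
  set S := \sum_(j < k) q ^+ j in gs s0 *.
  have h1 : q ^+ m * S <= 2^-1 by nra.
  have h2 : 0 <= q ^+ m * S by rewrite mulr_ge0.
  have h3 : a * (q ^+ m * S) <= q ^+ m * S by rewrite ler_piMl // ltW.
  by rewrite -mulrA; lra.
suff h : qpoch a q m / 2 <= qpoch_inf a q.
  by apply: lt_le_trans h; rewrite divr_gt0 ?qpoch_gt0.
apply: limr_ge; first by apply/cvg_ex; exists (qpoch_inf a q); exact: cvg_qpoch.
exists m => // n /= mn; rewrite -(subnKC mn) /qpoch big_split_ord /=.
by rewrite ler_wpM2l ?half // ltW // qpoch_gt0.
Qed.

Lemma cvg_qpoch_double : qpoch a q (2 * n) @[n --> \oo] --> qpoch_inf a q.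
Proof.
apply: (cvg_comp (fun n => (2 * n)%N) (qpoch a q) _ cvg_qpoch).
by move=> A [m _ mA]; exists m => // n /= mn; apply: mA => /=; lia.
Qed.

Lemma cvg_qpoch_ratio :
  qpoch a q n ^+ 2 / qpoch a q (2 * n) @[n --> \oo] --> qpoch_inf a q.
Proof.
have i0 : qpoch_inf a q != 0 by rewrite gt_eqF // qpoch_inf_gt0.
rewrite -[X in _ --> X](_ : qpoch_inf a q * qpoch_inf a q / qpoch_inf a q = _).
  apply: cvgM; last by apply: cvgV => //; exact: cvg_qpoch_double.
  by apply: cvgM; exact: cvg_qpoch.
by rewrite mulfK.
Qed.

End Bounds.

(** What remains of [ffact_prod] at p^N once the powers of p are taken out. Natural subtraction
    makes it 0 at q = 1/p, as at any q, as soon as x > N. *)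
Definition fallq q (N x : nat) : R := \prod_(j < x) (1 - q ^+ (N - j)).

Lemma fallq_split q N x l : fallq q N (x + l) = fallq q N x * fallq q (N - x) l.
Proof.
rewrite /fallq big_split_ord /=; congr (_ * _); apply: eq_bigr => j _.
by rewrite subnDA.
Qed.

Lemma fallq_ge0 q N x : 0 <= q -> q <= 1 -> 0 <= fallq q N x.
Proof.
by move=> q0 q1; apply: prodr_ge0 => j _; rewrite subr_ge0 exprn_ile1.
Qed.

Lemma fallq_le1 q N x : 0 <= q -> q <= 1 -> fallq q N x <= 1.
Proof.
move=> q0 q1; apply: prod_le1 => j.
by rewrite subr_ge0 exprn_ile1 //= gerBl exprn_ge0.
Qed.

Lemma fallq_qpoch q n : fallq q n n = qpoch q q n.
Proof.
rewrite /fallq /qpoch (reindex_inj rev_ord_inj) /=; apply: eq_bigr => j _.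
by rewrite -exprS; congr (1 - q ^+ _); have := ltn_ord j; lia.
Qed.

Lemma cvg_fallq q x : 0 <= q -> q < 1 -> fallq q N x @[N --> \oo] --> (1 : R).
Proof.
move=> q0 q1; rewrite /fallq.
elim: x => [|x ih].
  under eq_fun do rewrite big_ord0; exact: cvg_cst.
under eq_fun do rewrite big_ord_recr /=.
suff h : (1 - q ^+ (N - x)) @[N --> \oo] --> (1 - 0 : R).
  have h2 := cvgM ih h; rewrite subr0 mulr1 in h2; exact: h2.
apply: cvgB; first exact: cvg_cst.
apply: (cvg_comp (fun n => (n - x)%N) (fun n => q ^+ n) (G := \oo)).
  by move=> A [m _ mA]; exists (m + x)%N => // n /= mn; apply: mA => /=; lia.
by apply: cvg_expr; rewrite ger0_norm.
Qed.

(** Gaussian binomial coefficients, by the q-Pascal recursion rather than as quotients, so that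
    identities for them go by induction on x without division. *)
Fixpoint gauss_binom q (x y : nat) : R :=
  match x, y with
  | _, 0 => 1
  | 0, _.+1 => 0
  | x'.+1, y'.+1 => gauss_binom q x' y + q ^+ (x - y) * gauss_binom q x' y'
  end.

Lemma gauss_binom0 q x : gauss_binom q x 0 = 1.
Proof. by case: x. Qed.

Lemma gauss_binom_small q x y : (x < y)%N -> gauss_binom q x y = 0.
Proof.
elim: x y => [|x ih] [|y] //= xy; rewrite ih ?ih ?mulr0 ?addr0 //; lia.
Qed.

Lemma gauss_binom_formula q x y : (y <= x)%N ->
  gauss_binom q x y * (qpoch q q y * qpoch q q (x - y)) = qpoch q q x.
Proof.
elim: x y => [|x ih] [|y] //.
- by rewrite !qpoch0 gauss_binom0 !mulr1.
- by rewrite gauss_binom0 qpoch0 subn0 !mul1r.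
- rewrite ltnS => yx /=; rewrite subSS [qpoch q q x.+1]qpochS.
  have iy := ih y yx.
  rewrite [LHS]mulrDl.
  transitivity ((1 - q ^+ (x - y)) * qpoch q q x +
    q ^+ (x - y) * ((1 - q * q ^+ y) * (gauss_binom q x y * (qpoch q q y * qpoch q q (x - y))))).
    congr (_ + _); last by rewrite qpochS; ring.
    move: yx; rewrite leq_eqVlt => /predU1P[e|yx].
      by rewrite -e gauss_binom_small // subnn expr0 subrr !mul0r.
    rewrite -(ih _ yx) -[(x - y)%N](subnSK yx) [qpoch q q (x - y.+1).+1]qpochS -exprS; ring.
  rewrite iy -!exprS mulrBr mulr1 mulrA mulrBr -exprD.
  have -> : (x - y + y.+1 = x.+1)%N by lia.
  by ring.
Qed.

(** The row sum of the transition kernel, cleared of denominators: for a = p^(-1-s), the factor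
    q^(y(y-1)) a^y is p^(-y^2-sy). *)
Definition vsum q (x : nat) a : R :=
  \sum_(y < x.+1) gauss_binom q x y * q ^+ (y * y.-1) * a ^+ y * qpoch (a * q ^+ y) q (x - y).

(* The q-Chu-Vandermonde identity in the limiting case that sums the chain's kernel. *)
Lemma vsumE q x a : vsum q x a = 1.
Proof.
elim: x a => [|x ih] a.
  by rewrite /vsum big_ord_recl big_ord0 /= !expr0 qpoch0; ring.
(* The two terms of the q-Pascal recursion give the two summands: the first keeps y and lengthens
   the Pochhammer symbol by the factor 1 - a q^x, the second shifts y by one and turns a into a
   q. *)
suff -> : vsum q x.+1 a = (1 - a * q ^+ x) * vsum q x a + a * q ^+ x * vsum q x (a * q).
  by rewrite !ih; ring.
rewrite {1}/vsum big_ord_recl /= ?gauss_binom0 !expr0 !mulr1 !mul1r subn0.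
under eq_bigr => i _ do rewrite /bump /= add1n subSS !mulrDl.
rewrite big_split /= addrA; congr (_ + _).
  rewrite big_ord_recr /= gauss_binom_small // !mul0r addr0 /vsum big_distrr /=.
  rewrite [RHS]big_ord_recl /= ?gauss_binom0 !expr0 !mulr1 !mul1r subn0 qpochS mulrC.
  congr (_ + _); apply: eq_bigr => i _; rewrite /bump /= add1n.
  have ix := ltn_ord i.
  rewrite -[(x - i)%N](subnSK ix) qpochS -[a * q ^+ i.+1 * q ^+ _]mulrA -exprD.
  have -> : (i.+1 + (x - i.+1) = x)%N by lia.
  by ring.
rewrite /vsum big_distrr /=; apply: eq_bigr => i _.
have ix : (i <= x)%N by rewrite -ltnS.
rewrite -[a * q * q ^+ i]mulrA -exprS exprMn.
have -> : q ^+ (i.+1 * i) = q ^+ (i * i.-1) * q ^+ i * q ^+ i.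
  by rewrite -!exprD; congr (q ^+ _); case: (i : nat) => //= k; lia.
have -> : q ^+ x = q ^+ (x - i) * q ^+ i by rewrite -exprD subnK.
by rewrite add0n exprS; ring.
Qed.

End QPochhammer.

(** * Level sets of the singular numbers *)

Section LevelSets.
Context {R : realType} {p : nat} {K : fieldType} {absK : K -> R}.
Context {Hp : prime_nat p} {HQ : Qp_field p absK}.
Local Notation intm := (intm absK).
Local Notation xr := (xr absK).
Local Notation Xfun := (Xfun p absK).
Local Notation q := ((p%:R : R)^-1).

(* The matrices whose positive singular numbers form the partition conjugate to [xs]. *)
Definition level_set N (xs : seq nat) : set (MatNm absK p N) :=
  [set Z : 'M[K]_N | forall i, Xfun Z i = nth 0%N xs i].

Arguments level_set N xs : clear implicits.

(* The number of cosets of the integral matrices in [level_set N (y :: xs')]: above each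
   coset of [p Z] in [level_set N xs'] they are counted by residue matrices of given rank. *)
Fixpoint level_count N (xs : seq nat) : nat :=
  if xs is y :: xs' then
    let x := head 0%N xs' in
    if ((x <= y) && (x <= N))%N then
      (level_count N xs' * (p ^ (x * x + x * (N - x) + (N - x) * x) *
        card_rank p (N - x) (N - x) (y - x)))%N
    else 0%N
  else 1%N.

Lemma level_set_cons N y xs (Z : 'M[K]_N) :
  level_set N (y :: xs) Z <-> xr Z = y /\ level_set N xs ((p%:R : K) *: Z).
Proof.
have XS i : Xfun Z i.+1 = Xfun ((p%:R : K) *: Z) i.
  by rewrite /Xfun scalerA exprSr.
have X0 : Xfun Z 0 = xr Z by rewrite /Xfun expr0 scale1r.
split=> [h|[h1 h2] [|i]].
- by split; [have := h 0%N; rewrite X0|move=> i; have := h i.+1; rewrite XS].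
- by rewrite X0 h1.
- by rewrite XS h2.
Qed.

Lemma level_set_nil N (Z : 'M[K]_N) : level_set N [::] Z <-> intm Z.
Proof.
rewrite -xr_eq0; split=> [/(_ 0%N)|/eqP h i].
  by rewrite /Xfun expr0 scale1r => ->.
rewrite nth_nil; apply/eqP; rewrite -leqn0.
have X0 : Xfun Z 0 = 0%N by rewrite /Xfun expr0 scale1r.
by rewrite -X0 Xfun_mono.
Qed.

Lemma level_set_headE N xs (Z : 'M[K]_N) : level_set N xs Z -> xr Z = head 0%N xs.
Proof. by move=> /(_ 0%N); rewrite /Xfun expr0 scale1r nth0. Qed.

Lemma level_set_int N xs (Z Z' : 'M[K]_N) : intm (Z - Z') -> level_set N xs Z -> level_set N xs Z'.
Proof. by move=> h hZ i; rewrite -hZ; apply/esym/Xfun_int. Qed.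

Definition coset_cover N n (c : 'I_n -> 'M[K]_N) (S : set 'M[K]_N) : Prop :=
  (forall i j, intm (c i - c j) -> i = j) /\
  (forall Z, S Z <-> exists i, intm (Z - c i)).

(** The coset of Z modulo integral matrices is determined by the coset of p Z, represented by some
    c_i, and by the residue M of p Z - c_i modulo p. The candidates are therefore (c_i + M) / p, and
    those with [xr] equal to y are kept. *)
Lemma level_set_cover N xs : exists c : 'I_(level_count N xs) ->
  'M[K]_N, coset_cover c (level_set N xs).
Proof.
elim: xs => [|y xs [c [cI cZ]]].
  exists (fun=> 0); split=> [i j _|Z]; first by rewrite !ord1.
  rewrite level_set_nil; split=> [h|[_]]; last by rewrite subr0.
  by exists ord0; rewrite subr0.
have lc i : level_set N xs (c i) by apply/cZ; exists i; rewrite subrr intm0.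
set x := head 0%N xs.
have xE i : xr (c i) = x by exact: level_set_headE (lc i).
have p1 : absK p%:R <= 1 by exact: absK_nat.
pose f (u : 'I_(level_count N xs) * 'M['F_p]_N) := (p%:R^-1 *: c u.1 + p%:R^-1 *: taum u.2 :
  'M[K]_N).
pose I := {u | xr (f u) == y}.
have pf u : p%:R *: f u = c u.1 + taum u.2.
  by rewrite /f scalerDr !scalerA divff ?p_neq0 // !scale1r.
have fI u v : intm (f u - f v) -> u = v.
  move=> h; have e1 : u.1 = v.1.
    apply: cI; have : intm (p%:R *: (f u - f v)) by exact: intmZ.
    rewrite scalerBr !pf opprD addrACA => h1.
    rewrite -[c u.1 - c v.1](addrK (taum u.2 - taum v.2)) intmB //.
    by rewrite intmB ?intm_tau.
  move: u v e1 h => [i a] [j b] /= <-; rewrite /f /= opprD addrACA subrr add0r.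
  rewrite -scalerBr => h; congr (_, _).
  rewrite -[a](taumK (absK := absK)) -[b](taumK (absK := absK)).
  by apply: eq_redm => //; exact: intm_tau.
have cover (Z : 'M[K]_N) : level_set N (y :: xs) Z <-> exists u : I, intm (Z - f (val u)).
  rewrite level_set_cons; split=> [[hy /cZ[i hi]]|[[u hu] /= h]].
    pose M : 'M['F_p]_N := redm absK (p%:R *: Z - c i).
    have h : intm (Z - f (i, M)).
      have -> : Z - f (i, M) = p%:R^-1 *: (p%:R *: Z - c i - taum M).
        by rewrite !scalerBr scalerA mulVf ?p_neq0 // scale1r opprD addrA.
      exact: redm_close.
    have hu : xr (f (i, M)) == y by rewrite -(eq_xr h) hy.
    by exists (exist _ (i, M) hu).
  split; first by rewrite (eq_xr h) (eqP hu).
  apply/cZ; exists u.1; have : intm (p%:R *: (Z - f u)) by exact: intmZ.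
  rewrite scalerBr pf => h1; rewrite -[_ - c u.1](subrK (taum u.2)) intmD ?intm_tau //.
  by rewrite -addrA -opprD.
have cardI : #|{: I}| = level_count N (y :: xs).
  rewrite card_sig -sum1_card /=.
  transitivity (\sum_(i < level_count N xs) #|[pred M :
    'M['F_p]_N | xr (p%:R^-1 *: c i + p%:R^-1 *: taum M) == y]|)%N.
    under [RHS]eq_bigr do rewrite -sum1_card.
    by rewrite pair_big_dep /=; apply: eq_bigl => -[i M]; rewrite !inE.
  rewrite -/x; case: ifPn => [/andP[xy xN]|nxy].
    rewrite (eq_bigr (fun=> (p ^ (x * x + x * (N - x) + (N - x) * x) *
        card_rank p (N - x) (N - x) (y - x))%N)); first by rewrite sum_nat_const card_ord.
    move=> i _; move: (c i) (xE i) => A hA {c cI cZ lc xE f I pf fI cover}.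
    have : xr (p%:R *: (p%:R^-1 *: A)) = x by rewrite scalerA divff ?p_neq0 // scale1r.
    move: (p%:R^-1 *: A) => B; rewrite -{1}(subnKC xy).
    have [n eN] : exists n, N = (x + n)%N by exists (N - x)%N; rewrite subnKC.
    clear A hA xN; subst N; rewrite addKn => hB.
    exact: card_xr_coset.
  rewrite big1 // => i _; apply: eq_card0 => M; rewrite !inE.
  apply/negbTE; apply: contra nxy => /eqP <-.
  have hx : xr (p%:R *: (p%:R^-1 *: c i)) = x.
    by rewrite scalerA divff ?p_neq0 // scale1r.
  rewrite -{1}hx xr_coset_ge /= -(xE i).
  exact: leq_trans (xr_rank _) (rank_leq_row _).
rewrite -cardI; exists (fun i => f (val (enum_val i : I))); split.
  by move=> i j /fI /val_inj /enum_val_inj.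
move=> Z; rewrite cover; split=> [[u hu]|[i hi]]; last by exists (enum_val i).
by exists (enum_rank u); rewrite enum_rankK.
Qed.

Lemma ffact_fallq l m : ffact_prod (p := p) l ((p%:R : R) ^+ m) =
  (p%:R : R) ^+ (m * l) * fallq q m l.
Proof.
have p0 : (p%:R : R) != 0 by rewrite gt_eqF // prime_gt0R.
have [lm|ml] := leqP l m.
  transitivity (\prod_(j < l) ((p%:R : R) ^+ m * (1 - q ^+ (m - j)))); last first.
    by rewrite big_split prodr_const card_ord -exprM.
  apply: eq_bigr => j _; rewrite mulrBr mulr1; congr (_ - _).
  rewrite exprVn -[in RHS](subnK (ltnW (leq_trans (ltn_ord j) lm))) addnK exprD.
  by rewrite mulrAC mulfV ?mul1r // expf_neq0.
rewrite /ffact_prod (bigD1 (Ordinal ml)) //= subrr mul0r.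
by rewrite /fallq (bigD1 (Ordinal ml)) //= subnn expr0 subrr mul0r mulr0.
Qed.

Lemma fallq_gtn N x : (N < x)%N -> fallq q N x = 0.
Proof.
by move=> Nx; rewrite /fallq (bigD1 (Ordinal Nx)) //= subnn expr0 subrr mul0r.
Qed.

(* The weight of the partition conjugate to [xs], up to a constant: the factor [q ^ (y * y)]
   comes from the coset count, the factor [b ^ y] from [gammaZ]. *)
Fixpoint level_weight (b : R) (xs : seq nat) : R :=
  if xs is y :: xs' then
    q ^+ (y * y) * b ^+ y / qpoch q q (y - head 0%N xs') * level_weight b xs'
  else 1.

Lemma q_ge0 : 0 <= q. Proof. by rewrite invr_ge0 ltW // prime_gt0R. Qed.
Lemma q_lt1 : q < 1. Proof. by rewrite invf_lt1 ?prime_gt0R // prime_gt1R. Qed.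

Lemma qpoch_q_gt0 n : 0 < qpoch q q n.
Proof. by apply: qpoch_gt0; rewrite ?q_ge0 ?q_lt1. Qed.

Lemma level_weight_ge0 b xs : 0 <= b -> 0 <= level_weight b xs.
Proof.
move=> b0; elim: xs => [|y xs ih] //=.
by rewrite !mulr_ge0 ?exprn_ge0 ?q_ge0 ?invr_ge0 // ltW // qpoch_q_gt0.
Qed.

(** For N = x + n and y = x + l, the lifts contribute p to the exponent x^2 + 2xn + 2nl - l^2 = 2Ny
    - y^2, so q^(2Ny) cancels all but q^(y^2). If x > N, both sides are 0. *)
Lemma level_countE b N xs : sorted geq xs ->
  (level_count N xs)%:R * (b * q ^+ (2 * N)) ^+ sumn xs =
  fallq q N (head 0%N xs) ^+ 2 * level_weight b xs.
Proof.
have p0 : (p%:R : R) != 0 by rewrite gt_eqF // prime_gt0R.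
elim: xs => [|y xs ih] srt.
  by rewrite /= expr0 /fallq big_ord0; ring.
have /ih {}ih : sorted geq xs by case: xs srt {ih} => //= a l /andP[].
have xy : (head 0 xs <= y)%N by case: xs srt {ih} => //= a l /andP[].
rewrite /= xy; set x := head 0%N xs in ih xy *.
have [xN|Nx] := leqP x N; last first.
  by rewrite /= fallq_gtn ?(leq_trans Nx xy) // expr0n /= !mul0r.
have eN := subnKC xN; set n := (N - x)%N in eN *.
have ey := subnKC xy; set l := (y - x)%N in ey *.
have hl : qpoch q q l != 0 by rewrite gt_eqF // qpoch_q_gt0.
have hr : (card_rank p n n l)%:R = (p%:R : R) ^+ (2 * n * l) * q ^+ (l * l) * fallq q n l ^+ 2 /
  qpoch q q l.
  have := @card_rank_formula R p _ n n l; rewrite !ffact_fallq fallq_qpoch => h.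
  have h0 : (p%:R : R) ^+ (l * l) * qpoch q q l != 0 by rewrite mulf_neq0 ?expf_neq0.
  apply: (mulIf h0); rewrite h exprVn.
  have -> : (2 * n * l = n * l + n * l)%N by lia.
  rewrite exprD; field.
  by rewrite hl expf_neq0.
have key : (p%:R : R) ^+ (x * x + x * n + n * x) * (p%:R : R) ^+ (2 * n * l) *
    (q ^+ (l * l) * q ^+ (2 * N * y)) = q ^+ (y * y).
  rewrite -!exprD.
  have -> : (l * l + 2 * N * y = (x * x + x * n + n * x + 2 * n * l) + y * y)%N.
    by rewrite -eN -ey; lia.
  by rewrite [X in _ * X]exprD mulrA -exprMn divff // expr1n mul1r.
have -> : fallq q N y = fallq q N x * fallq q n l by rewrite -ey fallq_split.
rewrite exprD !natrM natrX hr.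
transitivity (((level_count N xs)%:R * (b * q ^+ (2 * N)) ^+ sumn xs) *
  (((p%:R : R) ^+ (x * x + x * n + n * x) * (p%:R : R) ^+ (2 * n * l) *
    (q ^+ (l * l) * q ^+ (2 * N * y))) * (b ^+ y * fallq q n l ^+ 2 / qpoch q q l))).
  by rewrite exprMn [q ^+ (2 * N * y)]exprM; ring.
by rewrite key ih; ring.
Qed.

End LevelSets.

Arguments level_set {R} p {K} absK N xs.
Arguments level_count p N xs : clear implicits.
Arguments level_weight {R} p b xs.

(** * The measures M_N and their limits *)

Section PartitionSums.

(* Partitions are enumerated by their codes, with gaps. *)
Definition part_of (n : nat) : option (seq nat) :=
  if pickle_inv n is Some xs then
    if is_partition xs then Some xs else None
  else None.

Lemma part_of_pickle xs : is_partition xs -> part_of (pickle xs) = Some xs.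
Proof. by move=> h; rewrite /part_of pickleK_inv h. Qed.

Lemma part_of_some n xs : part_of n = Some xs -> is_partition xs /\ pickle xs = n.
Proof.
rewrite /part_of; have := @pickle_invK (seq nat) n.
case: (pickle_inv n) => //= ys hys; case: ifP => // h [<-].
by split.
Qed.

Lemma partition_nth_inj xs ys : is_partition xs -> is_partition ys ->
  (forall i, nth 0%N xs i = nth 0%N ys i) -> xs = ys.
Proof.
move=> /andP[_ /allP hx] /andP[_ /allP hy] h.
have aux us vs : (forall x, x \in us -> (0 < x)%N) ->
    (forall i, nth 0%N us i = nth 0%N vs i) -> (size us <= size vs)%N.
  move=> hu huv; rewrite leqNgt; apply/negP => lt.
  have := hu (nth 0%N us (size vs)); rewrite mem_nth // => /(_ isT).
  by rewrite huv nth_default.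
apply: (@eq_from_nth _ 0%N) => [|i _]; last exact: h.
by apply/eqP; rewrite eqn_leq !aux.
Qed.

Definition partset T (A : seq nat -> set T) (n : nat) : set T :=
  if part_of n is Some xs then A xs else set0.

Definition pterm {R : realType} (f : seq nat -> \bar R) (n : nat) : \bar R :=
  if part_of n is Some xs then f xs else 0%E.

Lemma bigcup_partset T (A : seq nat -> set T) :
  \bigcup_n partset A n = [set x | exists xs, is_partition xs /\ A xs x].
Proof.
apply/seteqP; split=> [x [n _]|x [xs [hxs Ax]]]; last first.
  by exists (pickle xs) => //; rewrite /partset part_of_pickle.
by rewrite /partset; case e: (part_of n) => [xs|//] Ax; exists xs; split=> //;
  case: (part_of_some e).
Qed.

Lemma measurable_partset d (T : measurableType d) (A : seq nat -> set T) :
  (forall xs, is_partition xs -> measurable (A xs)) ->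
  forall n, measurable (partset A n).
Proof.
move=> mA n; rewrite /partset; case e: (part_of n) => [xs|//].
by apply: mA; case: (part_of_some e).
Qed.

Lemma measure_bigcup_partset d (T : measurableType d) {R : realType}
    (mu : {measure set T -> \bar R}) (A : seq nat -> set T) :
  (forall xs, is_partition xs -> measurable (A xs)) ->
  (forall xs ys x, is_partition xs -> is_partition ys -> A xs x -> A ys x -> xs = ys) ->
  mu (\bigcup_n partset A n) = (\sum_(0 <= n <oo) pterm (mu \o A) n)%E.
Proof.
move=> mA dA; rewrite measure_bigcup.
- transitivity (\sum_(0 <= i <oo) mu (partset A i))%E.
    by apply: eq_eseriesl => i; rewrite in_setT.
  apply: eq_eseriesr => n _; rewrite /partset /pterm.
  by case: (part_of n) => //; rewrite measure0.
- by move=> n _; exact: measurable_partset.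
- apply/trivIsetP => i j _ _ ij; rewrite -subset0 => x [].
  rewrite /partset; case ei: (part_of i) => [xs|//]; case ej: (part_of j) => [ys|//] h1 h2.
  have [hxs pi_] := part_of_some ei; have [hys pj] := part_of_some ej.
  by move/eqP: ij => []; rewrite -pi_ -pj (dA _ _ _ hxs hys h1 h2).
Qed.

End PartitionSums.

Section HuaPickrell.
Context {R : realType} {p : nat} {K : fieldType} {absK : K -> R}.
Context {Hp : prime_nat p} {HQ : Qp_field p absK}.
Context (s : R) (s_gt : -1 < s).
Context (vol : forall N : nat, {measure set (MatNm absK p N) -> \bar R}).
Context (vol_haar : is_haar vol).
Context (M : probability (MatInfm absK p) R).
Context (M_corner : forall (N : nat) (B : set (MatNm absK p N)),
  measurable B -> M (corner N @^-1` B) = MsN vol s B).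
Local Notation intm := (intm absK).
Local Notation xr := (xr absK).
Local Notation level_set := (level_set p absK).
Local Notation q := ((p%:R : R)^-1).
Local Notation a := ((p%:R : R) `^ (-1 - s)).
Local Notation b := ((p%:R : R) `^ (- s)).
Local Notation Cs N := (qpoch a q N ^+ 2 / qpoch a q (2 * N)).

Lemma pR_neq0 : (p%:R : R) != 0.
Proof. by rewrite gt_eqF // prime_gt0R. Qed.

Lemma a_gt0 : 0 < a. Proof. by rewrite powR_gt0 // prime_gt0R. Qed.
Lemma a_ge0 : 0 <= a. Proof. exact/ltW/a_gt0. Qed.
Lemma b_gt0 : 0 < b. Proof. by rewrite powR_gt0 // prime_gt0R. Qed.

Lemma a_lt1 : a < 1.
Proof.
have -> : -1 - s = - (1 + s) by rewrite opprD.
rewrite powRN invf_lt1 ?powR_gt0 ?prime_gt0R //.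
have s1 : 0 < 1 + s by rewrite -ltrBlDl sub0r.
rewrite /powR (negbTE pR_neq0) -[X in X < _]expR0 ltr_expR; apply: mulr_gt0 => //.
by apply: ln_gt0; exact: prime_gt1R.
Qed.

Lemma aE : a = q * b.
Proof.
rewrite powRD ?pR_neq0 ?implybT //.
by have -> : (p%:R : R) `^ (-1) = q by rewrite powRN powRr1 // ler0n.
Qed.

Lemma Cs_gt0 N : 0 < Cs N.
Proof.
by rewrite divr_gt0 ?exprn_gt0 ?qpoch_gt0 ?a_ge0 ?a_lt1 ?q_ge0 ?q_lt1.
Qed.

Lemma measurable_ball N A c : measurable (ballN absK p A c : set (MatNm absK p N)).
Proof. by apply: sub_sigma_algebra; exists A, c. Qed.

Lemma measurable_corner N (B : set (MatNm absK p N)) :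
  measurable B -> measurable (corner N @^-1` B : set (MatInfm absK p)).
Proof.
move=> mB; pose G := [set B : set (MatNm absK p N) |
  measurable (corner N @^-1` B : set (MatInfm absK p))].
suff : <<s @ballsN R K absK p N >> `<=` G by move=> /(_ B mB).
apply: smallest_sub => [|_ [A [c ->]]]; last first.
  by apply: sub_sigma_algebra; exists N, A, c.
split.
- by rewrite /G /= preimage_set0.
- by move=> A; rewrite /G /= setTD preimage_setC; exact: measurableC.
- by move=> F mF; rewrite /G /= preimage_bigcup; exact: bigcupT_measurable.
Qed.

Lemma gamma_pow N (Z : 'M[K]_N) g : gammaZ absK p Z = pw p g%:Z ->
  gammaZ absK p Z `^ (- s - (2 * N)%:R) = (b * q ^+ (2 * N)) ^+ g.
Proof.
move=> ->; have p0 : (0 : R) <= p%:R by rewrite ler0n.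
rewrite pw_nat -powR_mulrn // -powRrM mulrC powRrM powR_mulrn ?powR_ge0 //.
congr (_ ^+ g); rewrite powRD ?pR_neq0 ?implybT //.
by rewrite [X in _ * X]powRN powR_mulrn // exprVn.
Qed.

Lemma ballN_intm N (A Z : 'M[K]_N) : ballN absK p A 0 Z <-> intm (Z - A).
Proof.
split=> [h|/intmP h i j]; last by have := h i j; rewrite !mxE pwN pw0 invr1.
by apply/intmP => i j; have := h i j; rewrite !mxE pwN pw0 invr1.
Qed.

(** The density is constant on S, so its integral is this constant times the number of balls times
    the Haar volume of one ball. *)
Lemma measure_balls N n (c : 'I_n -> 'M[K]_N) (e : int) (S : set (MatNm absK p N)) g :
  (forall i j Z, ballN absK p (c i) e Z -> ballN absK p (c j) e Z -> i = j) ->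
  (forall Z, S Z <-> exists i, ballN absK p (c i) e Z) ->
  (forall Z : 'M[K]_N, S Z -> gammaZ absK p Z = pw p g%:Z) ->
  measurable S /\ M (corner N @^-1` S) =
   (Cs N * ((b * q ^+ (2 * N)) ^+ g * (n%:R * pw p (- e) ^+ (N * N))))%:E.
Proof.
move=> dB SE gS.
have eS : S = \big[setU/set0]_(i < n) (ballN absK p (c i) e : set (MatNm absK p N)).
  rewrite -bigcup_seq; apply/seteqP; split=> Z.
    by move=> /SE [i hi]; exists i => //=; exact: mem_index_enum.
  by move=> [i _ hi]; apply/SE; exists i.
have mS : measurable S.
  by rewrite eS; apply: bigsetU_measurable => i _; exact: measurable_ball.
split=> //; rewrite M_corner // /MsN [RHS]EFinM; congr (_ * _)%E.
rewrite (eq_integral (cst ((b * q ^+ (2 * N)) ^+ g)%:E)); last first.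
  by move=> Z; rewrite inE => /gS h /=; rewrite (gamma_pow h).
rewrite integral_cst // EFinM; congr (_ * _)%E.
rewrite eS measure_bigsetU_ord.
- rewrite (eq_bigr (fun=> (pw p (- e) ^+ (N * N))%:E)) => [|i _]; last exact: vol_haar.
  by rewrite sumEFin sumr_const card_ord mulr_natl.
- by move=> i; exact: measurable_ball.
- by apply/trivIsetP => i j _ _ ij; rewrite -subset0 => Z [h1 h2]; move/eqP: ij => [];
  exact: dB h1 h2.
Qed.

Lemma level_set_gamma N xs (Z : 'M[K]_N) : level_set N xs Z -> gammaZ absK p Z = pw p (sumn xs)%:Z.
Proof. exact: gammaZ_seq. Qed.

Lemma measure_level_set_cnt N xs : measurable (level_set N xs) /\
  M (corner N @^-1` level_set N xs) =
   (Cs N * ((level_count p N xs)%:R * (b * q ^+ (2 * N)) ^+ sumn xs))%:E.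
Proof.
have [c [cI cZ]] := level_set_cover N xs.
have [||Z|h ->] := @measure_balls N _ c 0 (level_set N xs) (sumn xs).
- move=> i j Z /ballN_intm hi /ballN_intm hj; apply: cI.
  have -> : c i - c j = (Z - c j) - (Z - c i) by rewrite opprB [RHS]addrC addrA subrK.
  by rewrite intmB.
- by move=> Z; rewrite cZ; split=> -[i hi]; exists i; apply/ballN_intm.
- exact: level_set_gamma.
- by split=> //; rewrite oppr0 pw0 expr1n mulr1; congr (_%:E); ring.
Qed.

Lemma measurable_level_set N xs : measurable (level_set N xs).
Proof. by have [] := measure_level_set_cnt N xs. Qed.

Lemma measure_level_set N xs : sorted geq xs ->
  M (corner N @^-1` level_set N xs) = (Cs N * (fallq q N (head 0%N xs) ^+ 2 * level_weight p b
    xs))%:E.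
Proof. by move=> h; have [_ ->] := measure_level_set_cnt N xs; rewrite level_countE. Qed.

(** A refinement of the level sets by the number y of singular numbers that are at least 0: division
    by p raises every singular number by one. It is a union of cosets of p times the integral
    matrices. *)
Definition level_set1 N y xs : set (MatNm absK p N) :=
  [set Z : 'M[K]_N | xr (p%:R^-1 *: Z) = y /\ level_set N xs Z].

Arguments level_set1 N y xs : clear implicits.

Lemma level_set1_cons N y xs (Z : 'M[K]_N) :
  level_set1 N y xs Z <-> level_set N (y :: xs) (p%:R^-1 *: Z).
Proof. by rewrite level_set_cons scalerA divff ?p_neq0 // scale1r. Qed.

(** Division by p maps this set onto [level_set N (y :: xs)]. Volumes differ by the factor p^(-N^2),
    and the exponent in [gammaZ] grows by y. *)
Lemma measure_level_set1 N y xs : measurable (level_set1 N y xs) /\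
  M (corner N @^-1` level_set1 N y xs) =
   ((q ^+ (N * N) / (b * q ^+ (2 * N)) ^+ y)%:E *
    M (corner N @^-1` level_set N (y :: xs)))%E.
Proof.
have [c [cI cZ]] := level_set_cover N (y :: xs).
have b1 (A Z : 'M[K]_N) : ballN absK p (p%:R *: A) 1 Z <-> intm (p%:R^-1 *: Z - A).
  have -> : p%:R^-1 *: Z - A = p%:R^-1 *: (Z - p%:R *: A).
    by rewrite scalerBr scalerA mulVf ?p_neq0 // scale1r.
  rewrite intm_pinvZ; split=> [h|/forallP h i j].
    by apply/forallP => i; apply/forallP => j; rewrite absK_lt1 !mxE; have := h i j; rewrite mxE.
  by have /forallP/(_ j) := h i; rewrite absK_lt1 !mxE.
have [||Z|h ->] := @measure_balls N _ (fun i => p%:R *: c i) 1 (level_set1 N y xs) (sumn xs).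
- move=> i j Z /b1 hi /b1 hj; apply: cI.
  have -> : c i - c j = (p%:R^-1 *: Z - c j) - (p%:R^-1 *: Z - c i).
    by rewrite opprB [RHS]addrC addrA subrK.
  by rewrite intmB.
- by move=> Z; rewrite level_set1_cons cZ; split=> -[i hi]; exists i; apply/b1.
- by move=> [_]; exact: level_set_gamma.
- split=> //; have [_ ->] := measure_level_set_cnt N (y :: xs).
  have B0 : (b * q ^+ (2 * N)) != 0.
    by rewrite mulf_neq0 ?expf_neq0 ?invr_eq0 ?gt_eqF ?b_gt0 ?prime_gt0R.
  have p1 : pw p 1 = p%:R :> R by rewrite /pw expr1z.
  rewrite -EFinM; congr (_%:E); rewrite [sumn (_ :: _)]/= exprD pwN p1.
  have := expf_neq0 y B0; move: (_ ^+ y) (_ ^+ sumn xs) (_ ^+ (N * N)) => By Bs Bn By0.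
  by move: (level_count p N (y :: xs)) (Cs N) => m C; field.
Qed.

End HuaPickrell.

Arguments level_set1 {R} p {K} absK N y xs.

Lemma measure_bigsetU_le d (T : measurableType d) (R : realType)
    (mu : {measure set T -> \bar R}) (I : Type) (r : seq I) (Q : pred I) (F : I -> set T) :
  (forall i, measurable (F i)) ->
  (mu (\big[setU/set0]_(i <- r | Q i) F i) <= \sum_(i <- r | Q i) mu (F i))%E.
Proof.
move=> mF; elim: r => [|i r ih]; first by rewrite !big_nil measure0.
rewrite !big_cons; case: (Q i) => //.
have mU : measurable (\big[setU/set0]_(j <- r | Q j) F j) by exact: bigsetU_measurable.
apply: le_trans (measureU2 _ (mF i) mU) _.
by rewrite leeD2l.
Qed.

Section QuadraticDecay.
Context {R : realType} {p : nat} {Hp : prime_nat p}.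
Local Notation q := ((p%:R : R)^-1).

(** For N > 2y the exponent N^2 - 2Ny is at least N, so a geometric sequence dominates. *)
Lemma cvg_quadratic (c : R) (y : nat) : 0 < c ->
  q ^+ (N * N) / (c * q ^+ (2 * N)) ^+ y @[N --> \oo] --> (0 : R).
Proof.
move=> c0.
have cq : `|q| < 1 by rewrite ger0_norm ?q_ge0 ?q_lt1.
have h : q ^+ N * (c ^+ y)^-1 @[N --> \oo] --> (0 : R).
  rewrite -[X in _ --> X](mul0r ((c ^+ y)^-1)).
  by apply: cvgM; [exact: cvg_expr|exact: cvg_cst].
apply: (squeeze_cvgr _ (cvg_cst 0) h); near=> N.
have N2 : (2 * y + 1 <= N)%N by near: N; exists (2 * y + 1)%N.
have bq0 : 0 <= (c * q ^+ (2 * N)) ^+ y.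
  apply: exprn_ge0; apply: mulr_ge0; first exact: ltW.
  by rewrite exprn_ge0 // q_ge0.
apply/andP; split; first by apply: divr_ge0 => //; apply: exprn_ge0; exact: q_ge0.
have -> : (N * N = 2 * N * y + N * (N - 2 * y))%N by nia.
have q0 : q != 0 by rewrite invr_eq0 pR_neq0.
have b0 : c != 0 by rewrite gt_eqF.
rewrite exprMn -(exprM q) exprD.
have h1 := expf_neq0 (2 * N * y) q0; have h2 := expf_neq0 y b0.
have -> : q ^+ (2 * N * y) * q ^+ (N * (N - 2 * y)) / (c ^+ y * q ^+ (2 * N * y)) =
    q ^+ (N * (N - 2 * y)) / c ^+ y.
  move: h1 h2; move: (q ^+ (2 * N * y)) (c ^+ y) (q ^+ _) => u v w u0 v0.
  by field; rewrite u0 v0.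
rewrite ler_wpM2r ?invr_ge0 ?exprn_ge0 ?(ltW c0) //.
have -> : (N * (N - 2 * y) = N + N * (N - 2 * y - 1))%N by nia.
by rewrite exprD ler_piMr ?exprn_ge0 ?q_ge0 // exprn_ile1 ?q_ge0 // ltW // q_lt1.
Unshelve. all: by end_near.
Qed.

End QuadraticDecay.

(** * Limits of the corner masses, and tightness *)

Section HuaPickrellLimits.
Context {R : realType} {p : nat} {K : fieldType} {absK : K -> R}.
Context {Hp : prime_nat p} {HQ : Qp_field p absK}.
Context (s : R) (s_gt : -1 < s).
Context (vol : forall N : nat, {measure set (MatNm absK p N) -> \bar R}).
Context (vol_haar : is_haar vol).
Context (M : probability (MatInfm absK p) R).
Context (M_corner : forall (N : nat) (B : set (MatNm absK p N)),
  measurable B -> M (corner N @^-1` B) = MsN vol s B).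
Local Notation xr := (xr absK).
Local Notation level_set := (level_set p absK).
Local Notation level_set1 := (level_set1 p absK).
Local Notation q := ((p%:R : R)^-1).
Local Notation a := ((p%:R : R) `^ (-1 - s)).
Local Notation b := ((p%:R : R) `^ (- s)).
Local Notation Cs N := (qpoch a q N ^+ 2 / qpoch a q (2 * N)).

(* The mass of [level_set N xs] under M_N, and its limit. *)
Definition level_mass N xs : R := Cs N * (fallq q N (head 0%N xs) ^+ 2 * level_weight p b xs).
Definition level_lim xs : R := qpoch_inf a q * level_weight p b xs.

Lemma qinf_gt0 : 0 < qpoch_inf a q.
Proof. by apply: qpoch_inf_gt0; rewrite ?a_ge0 ?a_lt1 ?q_ge0 ?q_lt1. Qed.

Lemma b_ge0 : 0 <= b. Proof. exact/ltW/b_gt0. Qed.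

Lemma level_lim_ge0 xs : 0 <= level_lim xs.
Proof. by rewrite mulr_ge0 ?(ltW qinf_gt0) ?level_weight_ge0 ?b_ge0. Qed.

Lemma cvg_Cs : Cs N @[N --> \oo] --> qpoch_inf a q.
Proof. by apply: cvg_qpoch_ratio; rewrite ?a_ge0 ?a_lt1 ?q_ge0 ?q_lt1. Qed.

Lemma cvg_level_mass xs : level_mass N xs @[N --> \oo] --> level_lim xs.
Proof.
rewrite /level_mass /level_lim; apply: cvgM; first exact: cvg_Cs.
have h : fallq q N (head 0%N xs) @[N --> \oo] --> (1 : R).
  by apply: cvg_fallq; rewrite ?q_ge0 ?q_lt1.
have h2 : fallq q N (head 0%N xs) ^+ 2 * level_weight p b xs @[N --> \oo] --> 1 * 1 * level_weight
  p b xs.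
  by apply: cvgM; [exact: cvgM|exact: cvg_cst].
by rewrite !mul1r in h2.
Qed.

(** The squared [fallq] is at most 1. The point is that the remaining factor does not depend on
    [xs], so the bound can be summed over all partitions. *)
Lemma level_mass_le N xs : level_mass N xs <= Cs N / qpoch_inf a q * level_lim xs.
Proof.
rewrite /level_mass /level_lim [X in _ <= X]mulrA mulfVK ?gt_eqF ?qinf_gt0 //.
rewrite ler_wpM2l ?(ltW (Cs_gt0 _ _)) // ler_piMl ?level_weight_ge0 ?b_ge0 // exprn_ile1 //.
  by rewrite fallq_ge0 ?q_ge0 ?ltW ?q_lt1.
by rewrite fallq_le1 ?q_ge0 ?ltW ?q_lt1.
Qed.

Lemma measure_corner_level_set N xs : is_partition xs ->
  M (corner N @^-1` level_set N xs) = (level_mass N xs)%:E.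
Proof. by move=> /andP[h _]; exact: measure_level_set. Qed.

Lemma measurable_corner_level_set N xs :
  measurable (corner N @^-1` level_set N xs : set (MatInfm absK p)).
Proof. by apply: measurable_corner; exact: (measurable_level_set vol_haar M_corner). Qed.

Lemma level_set_disjoint N xs ys (Z : 'M[K]_N) : is_partition xs -> is_partition ys ->
  level_set N xs Z -> level_set N ys Z -> xs = ys.
Proof.
by move=> hx hy h1 h2; apply: partition_nth_inj => // i; rewrite -h1 -h2.
Qed.

Lemma prob_le1r (A : set (MatInfm absK p)) : measurable A -> (M A <= 1)%E.
Proof. exact: probability_le1. Qed.

Lemma sum_level_mass_le1 N (L : seq (seq nat)) : uniq L -> all is_partition L ->
  \sum_(xs <- L) level_mass N xs <= 1.
Proof.
move=> uL aL; pose F (i : 'I_(size L)) := corner N @^-1` level_set N (nth [::] L i) :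
  set (MatInfm absK p).
have pL (i : 'I_(size L)) : is_partition (nth [::] L i).
  by move/allP: aL; apply; exact: mem_nth.
have mF i : measurable (F i) by exact: measurable_corner_level_set.
have := @measure_bigsetU_ord _ _ _ M _ xpredT F mF.
have tF : trivIset [set: 'I_(size L)] F.
  apply/trivIsetP => i j _ _ ij; rewrite -subset0 => Z [h1 h2]; move/eqP: ij => [].
  have eL : nth [::] L i = nth [::] L j := level_set_disjoint (pL i) (pL j) h1 h2.
  apply/val_inj/eqP; rewrite -(nth_uniq [::] (ltn_ord i) (ltn_ord j) uL).
  by rewrite eL.
move=> /(_ tF) e; rewrite -lee_fin.
have mU : measurable (\big[setU/set0]_(i < size L) F i) by apply: bigsetU_measurable.
apply: le_trans (prob_le1r mU); rewrite e (big_nth [::]) big_mkord -sumEFin.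
by apply: lee_sum => i _; rewrite -(measure_corner_level_set N (pL i)).
Qed.

Lemma sum_level_lim_le1 (L : seq (seq nat)) : uniq L -> all is_partition L ->
  \sum_(xs <- L) level_lim xs <= 1.
Proof.
move=> uL aL; have cv : (\sum_(xs <- L) level_mass N xs) @[N --> \oo] --> \sum_(xs <- L) level_lim
  xs.
  elim: L {uL aL} => [|xs L ih].
    under eq_fun do rewrite big_nil; rewrite big_nil; exact: cvg_cst.
  under eq_fun do rewrite big_cons; rewrite big_cons.
  by apply: cvgD => //; exact: cvg_level_mass.
rewrite -(cvg_lim _ cv) //; apply: limr_le; first by apply/cvg_ex; eexists; exact: cv.
by near=> N; exact: sum_level_mass_le1.
Unshelve. all: by end_near.
Qed.

Lemma level_set_bigcup N : \bigcup_n partset (fun xs => corner N @^-1` level_set N xs) n =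
  [set: MatInfm absK p].
Proof.
rewrite bigcup_partset; apply/seteqP; split=> // Z _.
by have [xs [h1 h2]] := Xfun_seq (corner N Z); exists xs.
Qed.

Definition pw_term (f : seq nat -> R) n : R := if part_of n is Some xs then f xs else 0.

(** No mass escapes: were all partial sums at most 1 - e, summing [level_mass_le] over the level
    sets, which cover everything, would give 1 <= r_N (1 - e) with r_N tending to 1. *)
Lemma sum_level_lim_gt (e : R) : 0 < e -> exists m, 1 - e < \sum_(n < m) pw_term level_lim n.
Proof.
move=> e0; apply: contrapT => h.
have {}h m : \sum_(n < m) pw_term level_lim n <= 1 - e.
  by rewrite leNgt; apply/negP => h1; apply: h; exists m.
have key N : 1 <= Cs N / qpoch_inf a q * (1 - e).
  rewrite -lee_fin -(probability_setT M) -(level_set_bigcup N) measure_bigcup_partset; last first.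
  - by move=> xs ys Z hx hy; exact: level_set_disjoint.
  - by move=> xs _; exact: measurable_corner_level_set.
  apply: lime_le; first by apply: is_cvg_nneseries => n _ _; rewrite /pterm; case: part_of.
  near=> m; rewrite big_mkord.
  apply: le_trans (_ : ((\sum_(n < m) Cs N / qpoch_inf a q * pw_term level_lim n)%:E <= _)%E);
    last first.
    rewrite lee_fin -mulr_sumr ler_wpM2l //.
    by rewrite divr_ge0 ?(ltW (Cs_gt0 _ _)) ?(ltW qinf_gt0).
  rewrite -sumEFin; apply: lee_sum => n _; rewrite /pterm /pw_term.
  case en: (part_of n) => [xs|]; last by rewrite mulr0.
  by rewrite /= measure_corner_level_set ?lee_fin ?level_mass_le //; case: (part_of_some en).
have cv : (Cs N / qpoch_inf a q * (1 - e)) @[N --> \oo] --> 1 * (1 - e).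
  apply: cvgM; last exact: cvg_cst.
  rewrite -[X in _ --> X](_ : qpoch_inf a q / qpoch_inf a q = _).
    by apply: cvgM; [exact: cvg_Cs|exact: cvg_cst].
  by rewrite divff // gt_eqF // qinf_gt0.
have : 1 <= 1 * (1 - e).
  rewrite -(cvg_lim _ cv) //; apply: limr_ge; first by apply/cvg_ex; eexists; exact: cv.
  by near=> N; exact: key.
by rewrite mul1r; lra.
Unshelve. all: by end_near.
Qed.

Definition xr_gt N r : set (MatNm absK p N) := [set Z : 'M[K]_N | (r < xr Z)%N].
Arguments xr_gt N r : clear implicits.

Lemma measurable_xr_gt N r : measurable (xr_gt N r).
Proof.
have -> : xr_gt N r =
    \bigcup_n partset (fun xs => if (r < head 0 xs)%N then level_set N xs else set0) n.
  rewrite bigcup_partset; apply/seteqP; split=> Z /=.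
    move=> h; have [xs [h1 h2]] := Xfun_seq (Z : 'M[K]_N); exists xs; split=> //.
    by rewrite -(level_set_headE h2) h.
  by move=> [xs [_]]; case: ifPn => // h1 h2; rewrite /xr_gt /= (level_set_headE h2).
apply: bigcupT_measurable; apply: measurable_partset => xs _.
by case: ifP => _; [exact: (measurable_level_set vol_haar M_corner)|exact: measurable0].
Qed.

(** Finitely many partitions carry limit mass above 1 - e, hence also mass above 1 - e for all large
    N. The bound r is the largest first entry among them. *)
Lemma xr_tight (e : R) : 0 < e -> exists r,
  \forall N \near \oo, (M (corner N @^-1` xr_gt N r) <= e%:E)%E.
Proof.
move=> e0; have [m hm] := sum_level_lim_gt e0.
pose r := (\max_(n < m) if part_of n is Some xs then head 0 xs else 0)%N.
exists r.
have cv : (\sum_(n < m) pw_term (level_mass N) n) @[N --> \oo] --> \sum_(n < m) pw_term level_lim n.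
  elim: (m) => [|k ih].
    under eq_fun do rewrite big_ord0; rewrite big_ord0; exact: cvg_cst.
  under eq_fun do rewrite big_ord_recr; rewrite big_ord_recr.
  apply: cvgD => //; rewrite /pw_term; case: part_of => [xs|]; last exact: cvg_cst.
  exact: cvg_level_mass.
have /cvgrPdist_lt/(_ _ (_ : 0 < \sum_(n < m) pw_term level_lim n - (1 - e))) := cv.
rewrite subr_gt0 => /(_ hm); apply: filterS => N hN.
have {}hN : 1 - e < \sum_(n < m) pw_term (level_mass N) n.
  by move: hN; rewrite ltr_norml => /andP[_]; lra.
pose F n := partset (fun xs => corner N @^-1` level_set N xs : set (MatInfm absK p)) n.
have mF n : measurable (F n).
  by apply: measurable_partset => xs _; exact: measurable_corner_level_set.
have mU : measurable (\big[setU/set0]_(n < m) F n) by apply: bigsetU_measurable.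
have eU : M (\big[setU/set0]_(n < m) F n) = (\sum_(n < m) pw_term (level_mass N) n)%:E.
  rewrite (measure_bigsetU_ord M xpredT) //; last first.
    apply/trivIsetP => i j _ _ ij; rewrite -subset0 => Z [].
    rewrite /F /partset; case ei: (part_of i) => [xs|//]; case ej: (part_of j) => [ys|//] h1 h2.
    have [hxs pi_] := part_of_some ei; have [hys pj] := part_of_some ej.
    move/eqP: ij => []; apply: val_inj; rewrite /= -pi_ -pj.
    by rewrite (level_set_disjoint hxs hys h1 h2).
  rewrite -sumEFin; apply: eq_bigr => n _; rewrite /F /partset /pw_term.
  case en: (part_of n) => [xs|]; last by rewrite measure0.
  by apply: measure_corner_level_set; case: (part_of_some en).
have mA : measurable (corner N @^-1` xr_gt N r : set (MatInfm absK p)).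
  by apply: measurable_corner; exact: measurable_xr_gt.
apply: le_trans (_ : (M (~` (\big[setU/set0]_(n < m) F n)) <= _)%E).
  apply: le_measure; rewrite ?inE //; first exact: measurableC.
  move=> Z hZ; rewrite -bigcup_mkord => -[n /= nm].
  rewrite /F /partset; case en: (part_of n) => [xs|//] h.
  move: hZ; rewrite /xr_gt /= (level_set_headE h) ltnNge => /negP; apply.
  have := @leq_bigmax _ (fun n : 'I_m => if part_of n is Some xs then head 0 xs else 0)%N (Ordinal
    nm).
  by rewrite /= en.
by rewrite probability_setC // eU -EFinB lee_fin; lra.
Qed.

(** At most J singular numbers are nonnegative. For a sequence k with k_J < 0, indices starting at
    0, this is almost sure under mu_k, while its M_N-mass tends to 0. *)
Definition xr1_le N J : set (MatNm absK p N) :=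
  [set Z : 'M[K]_N | (xr ((p%:R : K)^-1 *: Z) <= J)%N].
Arguments xr1_le N J : clear implicits.

Lemma xr1_leE N J : xr1_le N J =
  \bigcup_(y < J.+1) \bigcup_n partset (level_set1 N y) n.
Proof.
apply/seteqP; split=> Z /=.
  move=> h; exists (xr ((p%:R : K)^-1 *: (Z : 'M[K]_N))) => //.
  rewrite bigcup_partset; have [xs [h1 h2]] := Xfun_seq (Z : 'M[K]_N).
  by exists xs.
by move=> [y /= yJ]; rewrite bigcup_partset => -[xs [_ [h _]]]; rewrite /xr1_le /= h.
Qed.

Lemma measurable_xr1_le N J : measurable (xr1_le N J).
Proof.
rewrite xr1_leE; apply: bigcup_measurable => y _; apply: bigcupT_measurable.
by apply: measurable_partset => xs _; have [] := measure_level_set1 vol_haar M_corner N y xs.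
Qed.

(** The ratio in [measure_level_set1] does not depend on [xs], and the sets [level_set N (y :: xs)]
    are disjoint for distinct partitions, so their masses add up to at most 1. *)
Lemma measure_level_set1_sum N y :
  (M (\bigcup_n partset (fun xs => corner N @^-1` level_set1 N y xs) n) <=
   (q ^+ (N * N) / (b * q ^+ (2 * N)) ^+ y)%:E)%E.
Proof.
have k0 : 0 <= q ^+ (N * N) / (b * q ^+ (2 * N)) ^+ y.
  by rewrite divr_ge0 // exprn_ge0 ?q_ge0 // mulr_ge0 ?b_ge0 ?exprn_ge0 ?q_ge0.
rewrite measure_bigcup_partset; last first.
- by move=> xs ys Z hx hy [_ h1] [_ h2]; exact: (level_set_disjoint hx hy h1 h2).
- by move=> xs _; apply: measurable_corner; have [] := measure_level_set1 vol_haar M_corner N y xs.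
pose g := pterm (M \o (fun xs => corner N @^-1` level_set N (y :: xs))).
rewrite (eq_eseriesr (g := fun n => ((q ^+ (N * N) / (b * q ^+ (2 * N)) ^+ y)%:E * g n)%E));
  last first.
  move=> n _; rewrite /g /pterm; case: part_of => [xs|]; last by rewrite mule0.
  by have [_ h] := measure_level_set1 vol_haar M_corner N y xs; exact: h.
rewrite nneseriesZl; last by move=> n _; rewrite /g /pterm; case: part_of.
rewrite -[X in (_ <= X)%E]mule1; apply: lee_wpmul2l; first by rewrite lee_fin.
rewrite /g -measure_bigcup_partset.
- apply: prob_le1r; apply: bigcupT_measurable; apply: measurable_partset => xs _.
  exact: measurable_corner_level_set.
- by move=> xs _; exact: measurable_corner_level_set.
- move=> xs ys Z hx hy h1 h2; apply: partition_nth_inj => // i.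
  by rewrite -[LHS](h1 i.+1) -[RHS](h2 i.+1).
Qed.

Lemma xr1_le_small J (e : R) : 0 < e ->
  \forall N \near \oo, (M (corner N @^-1` xr1_le N J) <= e%:E)%E.
Proof.
move=> e0.
have cv (y : nat) := cvg_quadratic y (b_gt0 s).
have cv2 : (\sum_(y < J.+1) q ^+ (N * N) / (b * q ^+ (2 * N)) ^+ y) @[N --> \oo] --> (0 : R).
  elim: (J.+1) => [|k ih].
    under eq_fun do rewrite big_ord0; exact: cvg_cst.
  under eq_fun do rewrite big_ord_recr.
  have h2 : \sum_(y < k) q ^+ (N * N) / (b * q ^+ (2 * N)) ^+ y +
      q ^+ (N * N) / (b * q ^+ (2 * N)) ^+ k @[N --> \oo] --> (0 + 0 : R).
    by apply: cvgD => //; exact: cv.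
  by rewrite addr0 in h2; exact: h2.
have /cvgrPdist_lt/(_ _ e0) := cv2; apply: filterS => N.
rewrite sub0r normrN => hN.
apply: le_trans (_ : ((\sum_(y < J.+1) q ^+ (N * N) / (b * q ^+ (2 * N)) ^+ y)%:E <= _)%E);
  last first.
  by rewrite lee_fin; apply: le_trans (ltW hN); exact: ler_norm.
rewrite xr1_leE preimage_bigcup bigcup_mkord.
have mU y : measurable (corner N @^-1` (\bigcup_n partset (level_set1 N y) n) :
  set (MatInfm absK p)).
  apply: measurable_corner; apply: bigcupT_measurable.
  by apply: measurable_partset => xs _; have [] := measure_level_set1 vol_haar M_corner N y xs.
apply: le_trans (measure_bigsetU_le M (index_enum 'I_J.+1) xpredT (fun y => mU y)) _.
rewrite -sumEFin; apply: lee_sum => y _.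
apply: le_trans (measure_level_set1_sum N y); apply: le_measure; rewrite ?inE //.
  apply: bigcupT_measurable; apply: measurable_partset => xs _.
  by apply: measurable_corner; have [] := measure_level_set1 vol_haar M_corner N y xs.
move=> Z; rewrite /preimage /= !bigcup_partset => -[xs hxs]; by exists xs.
Unshelve. all: by end_near.
Qed.

End HuaPickrellLimits.

Arguments xr_gt {R} p {K} absK N r.
Arguments xr1_le {R} p {K} absK N J.
Arguments level_mass {R} p s N xs.
Arguments level_lim {R} p s xs.

(** * Measurability over the p-adic field *)

Section MeasurableKValued.
Context {R : realType} {p : nat} {K : fieldType} {absK : K -> R}.
Context {Hp : prime_nat p} {HQ : Qp_field p absK}.
Context {d : measure_display} {T : measurableType d}.
Implicit Types (f g : T -> K).

Definition Kball (x : K) (c : int) : set K := [set y | absK (y - x) <= pw p (- c)].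

(** Measurability of a K-valued map, tested on balls. Density of the rationals leaves only countably
    many balls, which is what makes this stable under continuous operations. *)
Definition Kmeas f : Prop := forall x c, measurable (f @^-1` Kball x c).

Lemma Kball_refl x c : Kball x c x.
Proof. by rewrite /Kball /= subrr absK0 pw_ge0. Qed.

Lemma Kball_shift x y c z : Kball x c y -> Kball x c z <-> Kball y c z.
Proof.
rewrite /Kball /= => hy; split=> hz.
  by rewrite -[z - y](subrKA x) absKD_le // absKB.
by rewrite -[z - x](subrKA y) absKD_le.
Qed.

Lemma exists_pw_lt (e : R) : 0 < e -> exists n : nat, pw p (- n%:Z) < e.
Proof.
move=> e0; have q1 : `|(p%:R : R)^-1| < 1 by rewrite ger0_norm ?q_ge0 ?q_lt1.
have /cvgrPdist_lt/(_ _ e0) [n _ hn] := cvg_expr q1; exists n.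
have := hn n (leqnn n); rewrite /= sub0r normrN ger0_norm ?exprn_ge0 ?q_ge0 //.
by rewrite pwN pw_nat exprVn.
Qed.

Lemma rat_in_ball x c : exists r : rat, Kball x c (ratr r).
Proof.
have h : 0 < pw p (- c) :> R by exact: pw_gt0.
by have [r hr] := rat_dense x h; exists r; rewrite /Kball /= absKB ltW.
Qed.

Lemma Kmeas_cst x : Kmeas (fun=> x).
Proof.
move=> y c; have [h|h] := pselect (Kball y c x).
  by rewrite (_ : _ @^-1` _ = setT) //; apply/seteqP; split.
by rewrite (_ : _ @^-1` _ = set0) //; apply/seteqP; split.
Qed.

(** The preimage of a ball is the union of the preimages of those boxes, with rational centres and
    integer exponents, that F sends into the ball. *)
Lemma Kmeas_comp2 (F : K -> K -> K) f g :
  (forall x y c, exists n, forall x' y', Kball x n x' -> Kball y n y' ->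
     Kball (F x y) c (F x' y')) ->
  Kmeas f -> Kmeas g -> Kmeas (fun w => F (f w) (g w)).
Proof.
move=> cF mf mg a c.
pose ok (u : rat * rat * int) := forall x' y', Kball (ratr u.1.1) u.2 x' ->
  Kball (ratr u.1.2) u.2 y' -> Kball a c (F x' y').
pose G (u : rat * rat * int) := if `[< ok u >] then
  f @^-1` Kball (ratr u.1.1) u.2 `&` g @^-1` Kball (ratr u.1.2) u.2 else set0.
have -> : (fun w => F (f w) (g w)) @^-1` Kball a c = \bigcup_u G u.
  apply/seteqP; split=> w /=.
    move=> hw; have [n hn] := cF (f w) (g w) c.
    have [r hr] := rat_in_ball (f w) n; have [t ht] := rat_in_ball (g w) n.
    have okn : ok (r, t, n).
      move=> x' y' /= hx hy; apply/(Kball_shift _ hw).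
      by apply: hn; [apply/(Kball_shift _ hr)|apply/(Kball_shift _ ht)].
    exists (r, t, n) => //; rewrite /G (asboolT okn).
    by split=> /=; [apply/(Kball_shift _ hr)|apply/(Kball_shift _ ht)]; exact: Kball_refl.
  by move=> [u _]; rewrite /G; case: asboolP => // h [h1 h2]; exact: h.
apply: countable_bigcupT_measurable; first exact: countableP.
move=> u; rewrite /G; case: ifP => _; last exact: measurable0.
by apply: measurableI; [exact: mf|exact: mg].
Qed.

Lemma KmeasD f g : Kmeas f -> Kmeas g -> Kmeas (fun w => f w + g w).
Proof.
apply: Kmeas_comp2 => x y c; exists c => x' y' hx hy.
by rewrite /Kball /= opprD addrACA absKD_le.
Qed.

Lemma exists_absK_le x : exists e : nat, absK x <= pw p e%:Z.
Proof.
have [->|x0] := eqVneq x 0; first by exists 0%N; rewrite absK0 pw_ge0.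
by have [c ->] := absK_pw x0; exists `|c|%N; rewrite ler_pw; lia.
Qed.

Lemma KmeasM f g : Kmeas f -> Kmeas g -> Kmeas (fun w => f w * g w).
Proof.
apply: Kmeas_comp2 => x y c.
have [e1 h1] := exists_absK_le x; have [e2 h2] := exists_absK_le y.
pose n : int := (`|c| + e1 + e2)%N%:Z.
exists n => x' y' hx hy; rewrite /Kball /=.
have -> : x' * y' - x * y = (x' - x) * y' + x * (y' - y) by ring.
have hy' : absK y' <= pw p e2%:Z.
  rewrite -[y'](subrK y) absKD_le //; apply: le_trans hy _.
  by rewrite ler_pw /n; lia.
apply: absKD_le; rewrite absKM.
  apply: le_trans (_ : pw p (- n) * pw p e2%:Z <= _).
    by rewrite ler_pM ?absK_ge0.
  by rewrite -pwD ler_pw /n; lia.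
apply: le_trans (_ : pw p e1%:Z * pw p (- n) <= _).
  by rewrite ler_pM ?absK_ge0.
by rewrite -pwD ler_pw /n; lia.
Qed.

Lemma Kmeas_sum I (r : seq I) (Q : pred I) (F : I -> T -> K) :
  (forall i, Kmeas (F i)) -> Kmeas (fun w => \sum_(i <- r | Q i) F i w).
Proof.
move=> mF; elim: r => [|i r ih].
  by under eq_fun do rewrite big_nil; exact: Kmeas_cst.
under eq_fun do rewrite big_cons.
by case: (Q i) => //; exact: KmeasD.
Qed.

Lemma Kconv_unique u (x y : K) : Kconv absK u x -> Kconv absK u y -> x = y.
Proof.
move=> hx hy; apply/eqP; rewrite -subr_eq0; apply/negPn/negP => xy.
have e0 : 0 < absK (x - y) by rewrite absK_gt0.
have [n1 h1] := hx _ e0; have [n2 h2] := hy _ e0.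
have := h1 _ (leq_maxl n1 n2); have := h2 _ (leq_maxr n1 n2).
move: (u _) => z hz1 hz2.
have h e : absK (z - y) < e -> absK (z - x) < e -> absK (x - y) < e.
  by move=> ey ex; rewrite -[x - y](subrKA z) absKD_lt // absKB.
by have := h _ hz1 hz2; rewrite ltxx.
Qed.

(** Balls are open and closed, so a limit lies in a ball exactly when the tail of the sequence
    does. *)
Lemma Kconv_ball u x y c : Kconv absK u x ->
  Kball y c x <-> exists n, forall m, (n <= m)%N -> Kball y c (u m).
Proof.
move=> hx; have e0 : 0 < pw p (- c) :> R by exact: pw_gt0.
have [n hn] := hx _ e0.
have h m : (n <= m)%N -> Kball x c (u m) by move=> /hn /ltW.
split=> [hy|[n' hn']].
  by exists n => m nm; apply/(Kball_shift _ hy); exact: h.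
have h1 := h _ (leq_maxl n n'); have h2 := hn' _ (leq_maxr n n').
apply/(Kball_shift x h2); apply/(Kball_shift x h1); exact: Kball_refl.
Qed.

Lemma Kconv_cauchy u : (exists x, Kconv absK u x) <->
  forall c : nat, exists n, forall m, (n <= m)%N -> forall m', (n <= m')%N ->
    Kball 0 c (u m - u m').
Proof.
split=> [[x hx] c|h].
  have e0 : 0 < pw p (- c%:Z) :> R by exact: pw_gt0.
  have [n hn] := hx _ e0; exists n => m nm m' nm'; rewrite /Kball /= subr0.
  rewrite -[_ - _](subrKA x); apply: absKD_le; first exact/ltW/hn.
  by rewrite absKB; exact/ltW/hn.
apply: K_complete => e e0; have [c hc] := exists_pw_lt e0.
have [n hn] := h c; exists n => m m' nm nm'.
by apply: le_lt_trans hc; have := hn _ nm _ nm'; rewrite /Kball /= subr0.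
Qed.

Definition Klimit (u : nat -> K) : K := xget 0 [set L | Kconv absK u L].

Lemma Klimit_eq u x : Kconv absK u x -> Klimit u = x.
Proof.
move=> h; rewrite /Klimit; case: xgetP => [y _ hy|/(_ x) []//].
exact: Kconv_unique hy h.
Qed.

(** The convergence set is measurable by the Cauchy criterion. On it the preimage of a ball is a
    tail event; off it the limit takes the default value 0. *)
Lemma Kmeas_limit (u : nat -> T -> K) : (forall n, Kmeas (u n)) ->
  Kmeas (fun w => Klimit (u^~ w)).
Proof.
move=> mu a c.
pose Cv := [set w | exists x, Kconv absK (u^~ w) x].
have mCv : measurable Cv.
  have -> : Cv = \bigcap_(c : nat) \bigcup_n \bigcap_(m in [set m | (n <= m)%N])
      \bigcap_(m' in [set m' | (n <= m')%N])
      ((fun w => u m w + -1 * u m' w) @^-1` Kball 0 c).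
    apply/seteqP; split=> w.
      move=> /Kconv_cauchy h c' _; have [n hn] := h c'; exists n => // m nm m' nm'.
      by rewrite /preimage /= mulN1r; exact: hn.
    move=> h; apply/Kconv_cauchy => c'; have [n _ hn] := h c' I; exists n => m nm m' nm'.
    by have := hn m nm m' nm'; rewrite /preimage /= mulN1r.
  apply: bigcapT_measurable => c'; apply: bigcupT_measurable => n.
  apply: bigcap_measurable => [|m _]; first by exists n => /=.
  apply: bigcap_measurable => [|m' _]; first by exists n => /=.
  by apply: KmeasD => //; apply: KmeasM => //; exact: Kmeas_cst.
pose Ev := \bigcup_n \bigcap_(m in [set m | (n <= m)%N]) (u m @^-1` Kball a c).
have mEv : measurable Ev.
  apply: bigcupT_measurable => n; apply: bigcap_measurable => [|m _]; last exact: mu.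
  by exists n => /=.
have -> : (fun w => Klimit (u^~ w)) @^-1` Kball a c =
    (Cv `&` Ev) `|` (~` Cv `&` (fun=> 0) @^-1` Kball a c).
  apply/seteqP; split=> w.
    have [[x hx]|nCv] := pselect (Cv w); rewrite /preimage /=.
      rewrite (Klimit_eq hx) => /(Kconv_ball _ _ hx) [n hn]; left; split; first by exists x.
      by exists n.
    move=> h; right; split=> //; move: h; rewrite /Klimit; case: xgetP => // x _ hx.
    by case: nCv; exists x.
  move=> [[[x hx] [n _ hn]]|[nCv]]; rewrite /preimage /=.
    by rewrite (Klimit_eq hx); apply/(Kconv_ball _ _ hx); exists n.
  rewrite /Klimit; case: xgetP => // x _ hx.
  by case: nCv; exists x.
apply: measurableU; first exact: measurableI.
by apply: measurableI; [exact: measurableC|exact: Kmeas_cst].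
Qed.

End MeasurableKValued.

Arguments Kball {R} p {K} absK x c.
Arguments Kmeas {R} p {K} absK {d T} f.
Arguments Klimit {R K} absK u.

(** * The random matrices A_k *)

Section RandomMatrix.
Context {R : realType} {p : nat} {K : fieldType} {absK : K -> R}.
Context {Hp : prime_nat p} {HQ : Qp_field p absK}.
Context {d : measure_display} {Omega : measurableType d} (P : probability Omega R).
Context (V : Idx -> Omega -> K) (iid : iid_haar_Zp absK p P V).
Local Notation intm := (intm absK).
Local Notation redm := (redm (p := p) absK).
Local Notation Kball := (Kball p absK).
Local Notation Kmeas := (Kmeas p absK).
Local Notation q := ((p%:R : R)^-1).
Local Notation Amat := (Amat absK p V).

Lemma Kmeas_V f : Kmeas (V f).
Proof.
move=> x c; case: iid => mV _ _; apply: mV; apply: sub_sigma_algebra.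
by exists x, c.
Qed.

(* The almost sure event on which no convergence issue arises. *)
Definition intV : set Omega := \bigcap_f (V f @^-1` Kball 0 0).

Lemma intV_le w f : intV w -> absK (V f w) <= 1.
Proof. by move=> /(_ f I); rewrite /Kball /preimage /= subr0 pwN pw0 invr1. Qed.

Lemma prob_V_ball f t (c : nat) : absK t <= 1 ->
  P (V f @^-1` Kball t c) = (pw p (- c%:Z))%:E.
Proof. by case: iid => _ hV _; exact: hV. Qed.

Lemma measurable_intV : measurable intV.
Proof.
rewrite -[intV]setCK; apply: measurableC; rewrite setC_bigcap.
apply: countable_bigcupT_measurable; first exact: countableP.
by move=> f; apply: measurableC; exact: Kmeas_V.
Qed.

Lemma prob_intVC : P (~` intV) = 0%E.
Proof.
pose F n := if unpickle n is Some f then ~` (V f @^-1` Kball 0 0) else set0.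
have mF n : measurable (F n).
  by rewrite /F; case: unpickle => // f; apply: measurableC; exact: Kmeas_V.
have -> : ~` intV = \bigcup_n F n.
  rewrite setC_bigcap; apply/seteqP; split=> w [].
    by move=> f _ hf; exists (pickle f) => //; rewrite /F pickleK.
  by move=> n _; rewrite /F; case: unpickle => // f hf; exists f.
apply/eqP; rewrite eq_le measure_ge0 andbT.
apply: le_trans (le_mu_bigcup P mF (bigcupT_measurable _ mF)) _.
rewrite eseries0 // => n _ _; rewrite /F; case: unpickle => [f|]; last exact: measure0.
etransitivity; first exact: (probability_setC P (Kmeas_V f 0 0)).
by rewrite (@prob_V_ball f 0 0) ?absK0 // oppr0 pw0 subee.
Qed.

Lemma prob_V_balls (I : finType) (h : I -> Idx) (t : I -> K) :
  injective h -> (forall i, absK (t i) <= 1) ->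
  P (\bigcap_i (V (h i) @^-1` Kball (t i) 1)) = (q ^+ #|I|)%:E.
Proof.
move=> hI ht; pose F := [seq h i | i <- enum I].
pose B (f : Idx) := if [pick i | h i == f] is Some i then Kball (t i) 1 else setT.
have Bh i : B (h i) = Kball (t i) 1.
  by rewrite /B; case: pickP => [j /eqP /hI ->|/(_ i)]; rewrite ?eqxx.
have uF : uniq F by rewrite map_inj_uniq ?enum_uniq.
have mB f : <<s Kballs absK p>> (B f).
  rewrite /B; case: pickP => [i _|_]; last first.
    by move=> X [[X0 XC _] _]; have := XC _ X0; rewrite setD0.
  by apply: sub_sigma_algebra; exists (t i), 1.
case: iid => _ _ /(_ F B uF mB) e.
have -> : \bigcap_i (V (h i) @^-1` Kball (t i) 1) =
    \bigcap_(f in [set f | f \in F]) (V f @^-1` B f).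
  apply/seteqP; split=> w hw.
    by move=> f /mapP [i _ ->]; rewrite Bh; exact: hw.
  move=> i _; have := hw (h i); rewrite /= Bh; apply.
  by apply: map_f; rewrite mem_enum.
rewrite e big_map (eq_bigr (fun=> q%:E)); last first.
  by move=> i _; rewrite Bh prob_V_ball // pwN /pw expr1z.
by rewrite big_enum /= prodEFin prodr_const.
Qed.

(** The shape of all lower bounds for mu_k: G can fail only on the bad event E or on the null set
    where some variable is not integral. *)
Lemma prob_ge_compl (G E : set Omega) (e : R) : measurable G -> measurable E ->
  (P E <= e%:E)%E -> (forall w, intV w -> ~ E w -> G w) -> ((1 - e)%:E <= P G)%E.
Proof.
move=> mG mE hE h; have hC : (P (~` G) <= e%:E)%E.
  apply: le_trans (_ : (P (~` intV `|` E) <= _)%E).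
    apply: le_measure; rewrite ?inE //; first exact: measurableC.
      by apply: measurableU => //; apply: measurableC; exact: measurable_intV.
    move=> w nG; have [hw|hw] := pselect (intV w); last by left.
    by right; apply: contrapT => nE; exact/nG/h.
  apply: le_trans (measureU2 _ _ mE) _; first by apply: measurableC; exact: measurable_intV.
  have h0 : (P (~` intV) <= 0)%E by rewrite prob_intVC.
  by rewrite -[X in (_ <= X)%E]add0e; apply: leeD.
move: hC; rewrite probability_setC // => hC.
rewrite EFinB leeBlDr //; move: hC.
by rewrite leeBlDr ?fin_num_measure // addeC.
Qed.

Definition Vmx m n (h : 'I_m -> 'I_n -> Idx) (w : Omega) : 'M[K]_(m, n) :=
  \matrix_(i, j) V (h i j) w.

Lemma intm_Vmx m n (h : 'I_m -> 'I_n -> Idx) w : intV w -> intm (Vmx h w).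
Proof. by move=> hw; apply/intmP => i j; rewrite mxE intV_le. Qed.

(** The entries are independent with uniform residues modulo p, so the reduced matrix is uniform
    over F_p. The event E is the union, over the matrices in Q, of the boxes of radius 1/p around
    their digit lifts. *)
Lemma redm_event m n (h : 'I_m -> 'I_n -> Idx) (Q : pred 'M['F_p]_(m, n)) :
  (forall i j i' j', h i j = h i' j' -> i = i' /\ j = j') ->
  exists E, [/\ measurable E, (P E <= (#|Q|%:R * q ^+ (m * n))%:E)%E
    & forall w, intV w -> Q (redm (Vmx h w)) -> E w].
Proof.
move=> hI; pose B (M : 'M['F_p]_(m, n)) :=
  \bigcap_(u : 'I_m * 'I_n) (V (h u.1 u.2) @^-1` Kball (tau (M u.1 u.2)) 1).
have mB M : measurable (B M).
  rewrite -[B M]setCK; apply: measurableC; rewrite setC_bigcap.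
  apply: countable_bigcupT_measurable; first exact: countableP.
  by move=> f; apply: measurableC; exact: Kmeas_V.
have pB M : P (B M) = (q ^+ (m * n))%:E.
  rewrite /B (@prob_V_balls _ (fun u : 'I_m * 'I_n => h u.1 u.2) (fun u => tau (M u.1 u.2))).
  - by rewrite card_prod !card_ord.
  - by move=> [i j] [i' j'] /= /hI [-> ->].
  - by move=> u; exact: absK_tau.
exists (\big[setU/set0]_(M | Q M) B M); split.
- by apply: bigsetU_measurable.
- apply: le_trans (measure_bigsetU_le _ _ _ mB) _.
  rewrite (eq_bigr (fun=> (q ^+ (m * n))%:E)) => [|M _]; last exact: pB.
  by rewrite sumEFin lee_fin sumr_const mulr_natl.
- move=> w hw hQ; rewrite (big_rem (redm (Vmx h w))) ?mem_index_enum //= hQ.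
  left => -[i j] _; rewrite /preimage /Kball /= -absK_lt1 !mxE.
  exact/red_close/intV_le.
Qed.

Lemma klim_eq (k : nat -> option int) c m :
  (forall n, (m <= n)%N -> k n = c) -> klim k = c.
Proof.
move=> h; rewrite /klim; case: xgetP => [c' _ [m' hm']|/(_ c) []]; last by exists m.
by rewrite -(hm' _ (leq_maxl m' m)) h // leq_maxr.
Qed.

Lemma oint_le_trans : transitive oint_le.
Proof. by move=> [y|] [x|] [z|] //=; exact: le_trans. Qed.

Lemma oint_le_mono (k : nat -> option int) : (forall n, oint_le (k n.+1) (k n)) ->
  forall m n, (m <= n)%N -> oint_le (k n) (k m).
Proof.
move=> hk m n /subnK <-; elim: (n - m)%N => [|i ih]; first by case: (k _) => //= c.
by rewrite addSn; exact: oint_le_trans (hk _) ih.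
Qed.

Section Sequence.
Context (k : nat -> option int) (k_mono : forall n, oint_le (k n.+1) (k n)).

Definition coef (n : nat) : K := if k n != klim k then expand_sing (p := p) (k n) else 0.

Lemma absK_expand_le u c : oint_le u (Some c) -> absK (expand_sing (p := p) u) <= pw p c.
Proof.
case: u => [e|_]; last by rewrite absK0 pw_ge0.
by rewrite absK_expand_sing ler_pw.
Qed.

Lemma klim_le c J : oint_le (k J) (Some c) -> oint_le (klim k) (Some c).
Proof.
move=> hJ; rewrite /klim; case: xgetP => // u _ [m hm].
rewrite -(hm _ (leq_maxl m J)); apply: oint_le_trans hJ.
by apply: oint_le_mono => //; exact: leq_maxr.
Qed.

Lemma coef_le c J n : oint_le (k J) (Some c) -> (J <= n)%N -> absK (coef n) <= pw p c.
Proof.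
move=> hJ Jn; rewrite /coef; case: ifP => _; last by rewrite absK0 pw_ge0.
by apply: absK_expand_le; apply: oint_le_trans hJ; exact: oint_le_mono.
Qed.

(* A nonincreasing integer sequence bounded below is eventually constant, so its terms beyond
   that point are excluded from the series. *)
Lemma coef_small c : exists J, forall n, (J <= n)%N -> absK (coef n) <= pw p c.
Proof.
have [[J hJ]|h] := pselect (exists J, oint_le (k J) (Some c)).
  by exists J => n; exact: coef_le.
have hk n : exists m : nat, k n = Some (c + 1 + m%:Z).
  case e: (k n) => [x|]; last by case: h; exists n; rewrite e.
  exists `|(x - c - 1)%R|%N; congr Some.
  have : ~~ (x <= c) by apply/negP => xc; apply: h; exists n; rewrite e.
  by rewrite -ltNge; lia.
have ex : exists m, `[< exists n, k n = Some (c + 1 + m%:Z) >].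
  by have [m hm] := hk 0%N; exists m; apply/asboolP; exists 0%N.
case: (ex_minnP ex) => m /asboolP [J hJ] hmin.
have kc n : (J <= n)%N -> k n = k J.
  move=> Jn; have := oint_le_mono k_mono Jn; have [m' hm'] := hk n.
  have mm : (m <= m')%N by apply: hmin; apply/asboolP; exists n.
  by rewrite hm' hJ /= => h1; congr (Some _); lia.
exists J => n Jn; rewrite /coef (klim_eq kc) (kc _ Jn) eqxx absK0 pw_ge0 //.
Qed.

Definition partsum w i j n : K :=
  \sum_(N < n) coef N * Xr V N i w * Yr V N j w.

Lemma ApartE w i j n : Apart p V k w i j n =
  partsum w i j n + expand_sing (p := p) (klim k) * Zr V i j w.
Proof.
rewrite /Apart /partsum; congr (_ + _); last by case: (klim k) => [c|]; rewrite /= ?mul0r.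
rewrite big_mkcond; apply: eq_bigr => N _; rewrite /coef.
case: (_ != _); last by rewrite !mul0r.
by case: (k N) => [c|] /=; rewrite ?mul0r.
Qed.

Lemma partsum_tail w i j J n e : intV w -> 0 <= e -> (J <= n)%N ->
  (forall m, (J <= m)%N -> absK (coef m) <= e) ->
  absK (partsum w i j n - partsum w i j J) <= e.
Proof.
move=> hw e0 /subnKC <- he; rewrite /partsum big_split_ord /=.
rewrite [X in absK (X - _)]addrC addrK.
apply: absK_sum_le => // m _; rewrite -mulrA absKM -[e]mulr1.
by rewrite ler_pM ?absK_ge0 ?he ?leq_addr // absKM_le1 // intV_le.
Qed.

Lemma Amat_conv w i j : intV w -> Kconv absK (Apart p V k w i j) (Amat k w i j).
Proof.
move=> hw; have [L hL] : exists L, Kconv absK (Apart p V k w i j) L.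
  apply/Kconv_cauchy => c; have [J hJ] := coef_small (- c%:Z).
  exists J => m Jm m' Jm'; rewrite /Kball /= subr0 !ApartE.
  have c0 : 0 <= pw p (- c%:Z) :> R by exact: pw_ge0.
  rewrite opprD addrACA subrr addr0 -(subrKA (partsum w i j J)).
  by apply: absKD_le; last rewrite absKB; exact: partsum_tail.
by have := Klimit_eq hL; rewrite /Klimit /Amat => ->.
Qed.

(** From index J on, the coefficients and the one of the term Z are bounded by p^c; the ultrametric
    inequality gives the same bound for the whole remainder. *)
Lemma Amat_approx w i j c J : intV w -> oint_le (k J) (Some c) ->
  absK (Amat k w i j - partsum w i j J) <= pw p c.
Proof.
move=> hw hJ; have c0 : 0 < pw p c :> R by exact: pw_gt0.
have [n hn] := Amat_conv i j hw c0.
have h := hn _ (leq_maxl n J).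
rewrite -(subrKA (Apart p V k w i j (maxn n J))); apply: absKD_le.
  by rewrite absKB ltW.
rewrite ApartE addrAC; apply: absKD_le.
  by apply: partsum_tail; rewrite ?leq_maxr ?ltW // => m; exact: coef_le.
rewrite absKM -[pw p c]mulr1 ler_pM ?absK_ge0 ?intV_le //.
by apply: absK_expand_le; exact: klim_le hJ.
Qed.

Lemma Amat_const w i j J : intV w -> (forall n, (J <= n)%N -> k n = k J) ->
  Amat k w i j = partsum w i j J + expand_sing (p := p) (klim k) * Zr V i j w.
Proof.
move=> hw hJ; apply: Klimit_eq => e e0; exists J => n Jn; rewrite !ApartE.
rewrite opprD addrACA subrr addr0.
apply: le_lt_trans e0; apply: partsum_tail => // m Jm.
by rewrite /coef (klim_eq hJ) hJ // eqxx absK0.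
Qed.

Lemma Kmeas_Amat i j : Kmeas (fun w => Amat k w i j).
Proof.
apply: (Kmeas_limit (u := fun n w => Apart p V k w i j n)) => n.
rewrite (_ : (fun w => _) = (fun w => partsum w i j n + expand_sing (p := p) (klim k) * Zr V i j
  w)); last first.
  by apply/funext => w; rewrite ApartE.
apply: KmeasD; last by apply: KmeasM; [exact: Kmeas_cst|exact: Kmeas_V].
apply: Kmeas_sum => N; apply: KmeasM; last exact: Kmeas_V.
by apply: KmeasM; [exact: Kmeas_cst|exact: Kmeas_V].
Qed.

(** A set stable under perturbations of size p^-c is a countable union of balls of that radius
    around rational matrices, and each ball is a finite condition on entries. *)
Lemma measurable_Amat N c (S : set (MatNm absK p N)) :
  (forall Z Z' : 'M[K]_N, ballN absK p Z c Z' -> S Z -> S Z') ->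
  measurable [set w | (corner N @^-1` S) (Amat k w)].
Proof.
move=> hS; pose B (A : 'M[rat]_N) := if `[< S (map_mx ratr A : 'M[K]_N) >] then
  \bigcap_(u : 'I_N * 'I_N) ((fun w => Amat k w u.1 u.2) @^-1` Kball (ratr (A u.1 u.2)) c)
  else set0.
have -> : [set w | (corner N @^-1` S) (Amat k w)] = \bigcup_A B A.
  apply/seteqP; split=> w /=.
    move=> hw; have ex (u : 'I_N * 'I_N) : exists r, Kball (Amat k w u.1 u.2) c (ratr r).
      exact: rat_in_ball.
    pose r (u : 'I_N * 'I_N) := projT1 (cid (ex u)).
    have hr (u : 'I_N * 'I_N) : Kball (Amat k w u.1 u.2) c (ratr (r u)) by rewrite /r; case: cid.
    pose A : 'M[rat]_N := \matrix_(i, j) r (i, j).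
    have hA : S (map_mx ratr A : 'M[K]_N).
      by apply: hS hw => i j; rewrite !mxE; exact: (hr (i, j)).
    exists A => //; rewrite /B asboolT // => -[i j] _.
    rewrite /preimage /= mxE; apply/(Kball_shift _ (hr (i, j))); exact: Kball_refl.
  move=> [A _]; rewrite /B; case: asboolP => // hA hw.
  apply: hS hA => i j; rewrite !mxE; exact: (hw (i, j) I).
apply: countable_bigcupT_measurable; first exact: countableP.
move=> A; rewrite /B; case: ifP => _; last exact: measurable0.
rewrite -[X in measurable X]setCK; apply: measurableC; rewrite setC_bigcap.
apply: countable_bigcupT_measurable; first exact: countableP.
by move=> f; apply: measurableC; exact: Kmeas_Amat.
Qed.

Definition Xmx J N w : 'M[K]_(N, J) := Vmx (fun (i : 'I_N) (n : 'I_J) => inl (inl (n : nat, i :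
  nat))) w.
Definition Ymx J N w : 'M[K]_(J, N) := Vmx (fun (n : 'I_J) (j : 'I_N) => inl (inr (n : nat, j :
  nat))) w.
Definition Zmx N w : 'M[K]_N := Vmx (fun (i j : 'I_N) => inr (i : nat, j : nat)) w.
Definition Dmx J : 'M[K]_J := diag_mx (\row_n coef n).

Lemma partsum_mx J N w (i j : 'I_N) :
  partsum w i j J = (Xmx J N w *m Dmx J *m Ymx J N w) i j.
Proof.
rewrite /partsum mxE; apply: eq_bigr => n _; rewrite mul_mx_diag !mxE.
by rewrite [coef n * _]mulrC.
Qed.

Lemma rank_XDY J N w : (\rank (Xmx J N w *m Dmx J *m Ymx J N w) <= J)%N.
Proof. exact: leq_trans (mxrankM_maxr _ _) (rank_leq_row _). Qed.

End Sequence.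

End RandomMatrix.

Arguments intV {R} p {K} absK {d Omega} V.
Arguments coef {p K} k n.

(** * Ranks of uniform matrices over F_p *)

Section RankAsymptotics.
Context {R : realType} {p : nat} {Hp : prime_nat p}.
Local Notation q := ((p%:R : R)^-1).

Lemma ffact_prod_gt0 l : 0 < ffact_prod (p := p) l ((p%:R : R) ^+ l).
Proof.
rewrite ffact_fallq fallq_qpoch mulr_gt0 ?exprn_gt0 ?prime_gt0R //.
exact: qpoch_q_gt0.
Qed.

Lemma pq_exp n : (p%:R : R) ^+ n * q ^+ n = 1.
Proof. by rewrite -exprMn mulfV ?expr1n // pR_neq0. Qed.

Lemma card_rank_col N J : (card_rank p N J J)%:R * q ^+ (N * J) = fallq q N J.
Proof.
have h : (card_rank p N J J)%:R * ffact_prod (p := p) J ((p%:R : R) ^+ J) =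
    ffact_prod (p := p) J ((p%:R : R) ^+ N) * ffact_prod (p := p) J ((p%:R :
      R) ^+ J) by exact: card_rank_formula.
have h0 := ffact_prod_gt0 J.
have -> : (card_rank p N J J)%:R = ffact_prod (p := p) J ((p%:R : R) ^+ N).
  by apply: (mulIf (lt0r_neq0 h0)).
by rewrite ffact_fallq mulrAC pq_exp mul1r.
Qed.

Lemma card_rank_row N J : (card_rank p J N J)%:R * q ^+ (J * N) = fallq q N J.
Proof.
have h : (card_rank p J N J)%:R * ffact_prod (p := p) J ((p%:R : R) ^+ J) =
    ffact_prod (p := p) J ((p%:R : R) ^+ J) * ffact_prod (p := p) J ((p%:R :
      R) ^+ N) by exact: card_rank_formula.
have h0 := ffact_prod_gt0 J.
have -> : (card_rank p J N J)%:R = ffact_prod (p := p) J ((p%:R : R) ^+ N).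
  by apply: (mulIf (lt0r_neq0 h0)); rewrite h mulrC.
by rewrite ffact_fallq mulrAC mulnC pq_exp mul1r.
Qed.

Lemma card_not_full m n l : (#|[pred M : 'M['F_p]_(m, n) | \rank M != l]|%:R : R) * q ^+ (m * n) =
  1 - (card_rank p m n l)%:R * q ^+ (m * n).
Proof.
have := cardC [pred M : 'M['F_p]_(m, n) | \rank M == l].
rewrite card_Fp_mx => e; have e2 : (card_rank p m n l + #|[pred M :
  'M['F_p]_(m, n) | \rank M != l]| = p ^ (m * n))%N.
  by rewrite -e; congr (_ + _)%N; apply: eq_card => M; rewrite !inE.
by rewrite -[X in _ = X - _](pq_exp (m * n)) -natrX -e2 natrD; ring.
Qed.

(** There are at most p^(2Nl) / c_l matrices of rank l, with c_l the number of ordered bases of a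
    space of dimension l. The right side is put in the form that [cvg_quadratic] handles with
    constant 1. *)
Lemma card_rank_square_le N l : (card_rank p N N l)%:R * q ^+ (N * N) <=
  (ffact_prod (p := p) l ((p%:R : R) ^+ l))^-1 * (q ^+ (N * N) / (1 * q ^+ (2 * N)) ^+ l).
Proof.
have h : (card_rank p N N l)%:R * ffact_prod (p := p) l ((p%:R : R) ^+ l) =
    ffact_prod (p := p) l ((p%:R : R) ^+ N) * ffact_prod (p := p) l ((p%:R :
      R) ^+ N) by exact: card_rank_formula.
have h0 := ffact_prod_gt0 l.
have -> : (card_rank p N N l)%:R = (ffact_prod (p := p) l ((p%:R : R) ^+ l))^-1 *
    ffact_prod (p := p) l ((p%:R : R) ^+ N) ^+ 2.
  by apply: (mulIf (lt0r_neq0 h0)); rewrite h; field; exact: lt0r_neq0.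
rewrite -mulrA ler_wpM2l ?invr_ge0 ?(ltW h0) // mulrC ler_wpM2l ?exprn_ge0 ?q_ge0 //.
rewrite mul1r -exprM -exprVn invrK ffact_fallq exprMn -exprM.
have -> : (N * l * 2 = 2 * N * l)%N by lia.
rewrite ler_piMr ?exprn_ge0 ?ler0n // exprn_ile1 //.
  by rewrite fallq_ge0 ?q_ge0 ?ltW ?q_lt1.
by rewrite fallq_le1 ?q_ge0 ?ltW ?q_lt1.
Qed.

Lemma cvg_low_rank t :
  #|[pred M : 'M['F_p]_N | (\rank M <= t)%N]|%:R * q ^+ (N * N) @[N --> \oo] --> (0 : R).
Proof.
pose c l := (ffact_prod (p := p) l ((p%:R : R) ^+ l))^-1.
pose u N := \sum_(l < t.+1) c l * (q ^+ (N * N) / (1 * q ^+ (2 * N)) ^+ l).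
have cu : u N @[N --> \oo] --> (0 : R).
  rewrite /u; elim: (t.+1) => [|m ih].
    under eq_fun do rewrite big_ord0; exact: cvg_cst.
  under eq_fun do rewrite big_ord_recr.
  have h2 : \sum_(l < m) c l * (q ^+ (N * N) / (1 * q ^+ (2 * N)) ^+ l) +
      c m * (q ^+ (N * N) / (1 * q ^+ (2 * N)) ^+ m) @[N --> \oo] --> (0 + c m * 0 : R).
    by apply: cvgD => //; apply: cvgM; [exact: cvg_cst|apply: cvg_quadratic; exact: ltr01].
  by rewrite mulr0 addr0 in h2; exact: h2.
apply: (squeeze_cvgr _ (cvg_cst 0) cu); near=> N.
rewrite mulr_ge0 ?ler0n ?exprn_ge0 ?q_ge0 //=.
apply: le_trans (_ : \sum_(l < t.+1) (card_rank p N N l)%:R * q ^+ (N * N) <= _); last first.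
  by apply: ler_sum => l _; exact: card_rank_square_le.
rewrite -mulr_suml ler_wpM2r ?exprn_ge0 ?q_ge0 // -natr_sum ler_nat.
have -> : (\sum_(l < t.+1) card_rank p N N l = \sum_(l < t.+1) \sum_(M :
  'M['F_p]_N | \rank M == l) 1)%N.
  by apply: eq_bigr => l _; rewrite sum1_card.
rewrite (exchange_big_dep xpredT) //= -sum1_card [X in (X <= _)%N]big_mkcond /=.
apply: leq_sum => M _; rewrite inE; case: ifP => // h.
by rewrite (bigD1 (Ordinal (h : (\rank M < t.+1)%N))).
Unshelve. all: by end_near.
Qed.

End RankAsymptotics.

Section Deterministic.
Context {R : realType} {p : nat} {K : fieldType} {absK : K -> R}.
Context {Hp : prime_nat p} {HQ : Qp_field p absK}.
Local Notation intm := (intm absK).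
Local Notation xr := (xr absK).
Local Notation redm := (redm (p := p) absK).

(** The case of [xr_block] with an empty large block. *)
Lemma xr_pinv n (Z : 'M[K]_n) : intm Z -> xr (p%:R^-1 *: Z) = \rank (redm Z).
Proof.
move=> iZ; pose e : 'rV[K]_0 := 0.
have h : xr (p%:R^-1 *: (block_mx (diag_mx e) 0 0 0 + (Z : 'M[K]_(0 + n)))) =
    \rank (redm (drsubmx (Z : 'M[K]_(0 + n)))).
  by apply: xr_block => // -[].
have -> : \rank (redm Z) = \rank (redm (drsubmx (Z : 'M[K]_(0 + n)))).
  congr (\rank (redm _)); apply/matrixP => i j; rewrite !mxE.
  by congr (Z _ _); apply: val_inj.
rewrite -h; congr (xr (_ *: _)); apply/matrixP => i j.
rewrite mxE [X in X + _](_ : _ = 0) ?add0r //.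
rewrite mxE; case: splitP => i'; first by case: i'.
by move=> _; rewrite mxE; case: splitP => j' _; rewrite mxE.
Qed.

(** One inequality is [xr_mul]. For the other, lifts of a left inverse of X and of a right inverse
    of Y modulo p compress X D Y to D between invertible integral factors. *)
Lemma xr_XDY N J (X : 'M[K]_(N, J)) (Y : 'M[K]_(J, N)) (dv : 'rV[K]_J) (A : 'M[K]_N) x :
  intm X -> intm Y -> \rank (redm X) = J -> \rank (redm Y) = J ->
  intm (A - X *m diag_mx dv *m Y) -> absK x <= 1 ->
  xr (x *: A) = #|[pred j | 1 < absK (x * dv 0 j)]|.
Proof.
move=> iX iY rX rY iA hx.
have eD : x *: diag_mx dv = diag_mx (x *: dv).
  by apply/matrixP => i j; rewrite !mxE mulrnAr.
have eA : xr (x *: A) = xr (X *m diag_mx (x *: dv) *m Y).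
  by apply: eq_xr; rewrite -eD -scalemxAr -scalemxAl -scalerBr; exact: intmZ.
have -> : #|[pred j | 1 < absK (x * dv 0 j)]| = xr (diag_mx (x *: dv)).
  by rewrite xr_diag; apply: eq_card => j; rewrite !inE mxE.
rewrite eA; apply/eqP; rewrite eqn_leq xr_mul //=.
have /row_fullP [B eB] : row_full (redm X) by rewrite /row_full rX.
have /row_freeP [C eC] : row_free (redm Y) by rewrite /row_free rY.
have gB : GLZp absK (taum B *m X).
  by apply: GLZp_red; rewrite ?intm_mul ?intm_tau // redmM ?intm_tau // taumK eB unitmx1.
have gC : GLZp absK (Y *m taum C).
  by apply: GLZp_red; rewrite ?intm_mul ?intm_tau // redmM ?intm_tau // taumK eC unitmx1.
rewrite -(xr_GL _ gB gC) !mulmxA -2!(mulmxA (taum B)) -(mulmxA _ _ (taum C)).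
rewrite !mulmxA -(mulmxA (taum B)) -(mulmxA (taum B)).
by apply: xr_mul; rewrite ?intm_tau.
Qed.

End Deterministic.

(** The conjugate partition. Its entry i counts the parts exceeding i and so equals [Xv lam i.+1]:
    the times of the chain start at 1, the entries at 0. *)
Definition conj_part (lam : seq nat) : seq nat := mkseq (fun i => count (ltn i) lam) (maxpart lam).

Lemma maxpart_ge lam x : x \in lam -> (x <= maxpart lam)%N.
Proof. by move=> h; rewrite /maxpart (big_rem x) //= leq_maxl. Qed.

Lemma nth_conj_part lam i : nth 0%N (conj_part lam) i = count (ltn i) lam.
Proof.
have [im|im] := ltnP i (maxpart lam); first by rewrite nth_mkseq.
rewrite nth_default ?size_mkseq //; apply/esym/eqP; rewrite -leqn0 leqNgt -has_count.
apply/hasPn => x /maxpart_ge h; rewrite -leqNgt; exact: leq_trans h im.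
Qed.

Lemma conj_part_partition lam : is_partition (conj_part lam).
Proof.
apply/andP; split.
  rewrite /conj_part /mkseq sorted_map; apply: sub_sorted (iota_sorted 0 _) => i j /= ij.
  by apply: sub_count => x /=; exact: leq_ltn_trans.
apply/allP => c /mapP [i]; rewrite mem_iota add0n => /andP [_ im] ->.
rewrite -has_count; apply/hasP; move: im; rewrite /maxpart => im.
elim: lam im => [|x lam ih]; rewrite ?big_nil // big_cons leq_max => /orP[h|/ih [y hy iy]].
  by exists x; rewrite ?mem_head.
by exists y; rewrite ?inE ?hy ?orbT.
Qed.

(** * Corner events of probability near 1 under mu_k *)

Section LowerBounds.
Context {R : realType} {p : nat} {K : fieldType} {absK : K -> R}.
Context {Hp : prime_nat p} {HQ : Qp_field p absK}.
Context {d : measure_display} {Omega : measurableType d} (P : probability Omega R).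
Context (V : Idx -> Omega -> K) (iid : iid_haar_Zp absK p P V).
Local Notation intm := (intm absK).
Local Notation xr := (xr absK).
Local Notation redm := (redm (p := p) absK).
Local Notation q := ((p%:R : R)^-1).
Local Notation Amat := (Amat absK p V).
Local Notation mu := (mu absK p P V).
Local Notation level_set := (level_set p absK).
Local Notation xr_gt := (xr_gt p absK).
Local Notation xr1_le := (xr1_le p absK).

(** The terms from index J on are divisible by p, and the first J terms form a matrix of rank at
    most J. *)
Lemma mu_xr1_le (k : nat -> option int) J N :
  (forall n, oint_le (k n.+1) (k n)) -> oint_le (k J) (Some (- 1)) ->
  (1 <= mu k (corner N @^-1` xr1_le N J))%E.
Proof.
move=> km kJ.
have mG : measurable [set w | (corner N @^-1` xr1_le N J) (Amat k w)].
  apply: (measurable_Amat iid k (c := 1)) => // Z Z' hZ; rewrite /xr1_le /= => h.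
  rewrite (@eq_xr _ _ _ _ _ _ _ _ (p%:R^-1 *: Z)) // -scalerBr intm_pinvZ.
  by apply/forallP => i; apply/forallP => j; rewrite absK_lt1 !mxE; exact: hZ.
rewrite -[X in (X%:E <= _)%E]subr0.
apply: (prob_ge_compl iid mG measurable0); first by rewrite measure0.
move=> w hw _; rewrite /= /xr1_le /=.
pose B := Xmx V J N w *m Dmx (p := p) k J *m Ymx V J N w.
have rB : (\rank B <= J)%N by exact: rank_XDY.
apply: leq_trans rB.
apply: leq_trans (_ : (\rank (p%:R^-1 *: B) <= _)%N); last exact: mxrank_scale.
apply: xr_le; rewrite -scalerBr intm_pinvZ; apply/forallP => i; apply/forallP => j.
rewrite absK_lt1 mxE [X in _ + X]mxE -(partsum_mx V k J w i j) mxE.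
exact: Amat_approx.
Qed.

(** Apart from J terms of rank one, which change [xr] by at most J, the corner is Z / p^c with c >=
    1. Its [xr] is at least that of Z / p, the rank of Z modulo p, and this rank exceeds r + J with
    probability tending to 1. *)
Lemma mu_xr_gt (k : nat -> option int) J c r (e : R) :
  1 <= c -> (forall n, (J <= n)%N -> k n = Some c) -> 0 < e ->
  \forall N \near \oo, ((1 - e)%:E <= mu k (corner N @^-1` xr_gt N r))%E.
Proof.
move=> c1 kc e0; have kJ n : (J <= n)%N -> k n = k J by move=> Jn; rewrite !kc.
have kl : klim k = Some c by exact: klim_eq kc.
have cl : #|[pred M : 'M['F_p]_N | (\rank M <= r + J)%N]|%:R * q ^+ (N * N) @[N --> \oo] --> (0 :
  R).
  exact: cvg_low_rank.
have /cvgrPdist_lt/(_ _ e0) := cl.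
apply: filterS => N; rewrite sub0r normrN => hN.
pose Q (M : 'M['F_p]_N) := (\rank M <= r + J)%N.
have [i j i' j' /= [/val_inj -> /val_inj ->] //|E [mE pE EV]] :=
  redm_event iid (h := fun (i j : 'I_N) => inr (i : nat, j : nat)) Q.
have mG : measurable [set w | (corner N @^-1` xr_gt N r) (Amat k w)].
  apply: (measurable_Amat iid k (c := 0)) => // Z Z' hB.
  have hZ : intm (Z' - Z) by apply/(ballN_intm (p := p)).
  by rewrite /xr_gt /= (eq_xr (p := p) hZ).
apply: (prob_ge_compl iid mG mE).
  apply: le_trans pE _; rewrite lee_fin; apply: le_trans (ltW hN).
  exact: ler_norm.
move=> w hw nE; rewrite /= /xr_gt /= ltnNge; apply/negP => hr; apply: nE; apply: EV => //.
have iZ : intm (Zmx V N w) by exact: (intm_Vmx (p := p)).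
rewrite /Q -(xr_pinv iZ).
set A := corner N (Amat k w) in hr.
have eA : ((p%:R : K) ^ (- c)) *: Zmx V N w = A - Xmx V J N w *m Dmx (p := p) k J *m Ymx V J N w.
  apply/matrixP => i j; rewrite mxE [X in _ = X]mxE [X in _ = _ + X]mxE -partsum_mx.
  rewrite [A i j]mxE (Amat_const i j hw kJ) kl /= addrAC subrr add0r.
  by rewrite [Zmx _ _ _ _ _]mxE.
apply: leq_trans (_ : (xr ((p%:R : K) ^ (- c) *: Zmx V N w) <= _)%N).
  have -> : p%:R^-1 *: Zmx V N w = (p%:R : K) ^ (c - 1) *: ((p%:R : K) ^ (- c) *: Zmx V N w).
    rewrite scalerA -expfzDr ?p_neq0 //; congr (_ *: _).
    by have -> : c - 1 - c = -1 by lia.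
  apply: xr_scale; rewrite absK_pz -(@pw0 R p) ler_pw; lia.
rewrite eA; apply: leq_trans (xr_addr (p := p) _ _) _; rewrite leq_add //.
by rewrite mxrank_opp rank_XDY.
Qed.

Lemma padf_mono lam : sorted geq lam -> forall n, oint_le (padf lam n.+1) (padf lam n).
Proof.
move=> hl n; rewrite /padf /= lez_nat.
have [h|h] := ltnP n.+1 (size lam); last by rewrite nth_default.
have gt : transitive geq by move=> x y z /= h1 h2; exact: leq_trans h2 h1.
exact: (sorted_leq_nth gt leqnn 0%N hl n n.+1 (ltnW h) h (leqnSn n)).
Qed.

Lemma klim_padf lam : klim (padf lam) = Some 0.
Proof. by apply: (@klim_eq _ _ (size lam)) => n h; rewrite /padf nth_default. Qed.

(** Modulo integral matrices the corner is X D Y, with J the number of parts. If X and Y have rank J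
    modulo p, the singular numbers above 0 are the parts of [lam]. Each of the two ranks is
    deficient with probability at most 1 - [fallq q N J], which is made at most e / 2. *)
Lemma mu_level_set lam (e : R) : is_partition lam -> 0 < e ->
  \forall N \near \oo, ((1 - e)%:E <= mu (padf lam) (corner N @^-1` level_set N (conj_part lam)))%E.
Proof.
move=> /andP[hs hpos] e0; set k := padf lam; set J := size lam.
have km := padf_mono hs; have kl := klim_padf lam.
have kJ : oint_le (k J) (Some 0) by rewrite /k /padf nth_default.
have e2 : 0 < e / 2 by rewrite divr_gt0.
have cl : fallq q N J @[N --> \oo] --> (1 : R) by apply: cvg_fallq; rewrite ?q_ge0 ?q_lt1.
have /cvgrPdist_lt/(_ _ e2) := cl.
apply: filterS => N hN.
have {}hN : 1 - fallq q N J <= e / 2 by apply: le_trans (ltW hN); exact: ler_norm.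
have [i j i' j' /= [/val_inj -> /val_inj ->] //|E1 [mE1 pE1 EV1]] :=
  redm_event iid (h := fun (i : 'I_N) (n : 'I_J) => inl (inl (n : nat, i : nat)))
    (fun M => \rank M != J).
have [i j i' j' /= [/val_inj -> /val_inj ->] //|E2 [mE2 pE2 EV2]] :=
  redm_event iid (h := fun (n : 'I_J) (j : 'I_N) => inl (inr (n : nat, j : nat)))
    (fun M => \rank M != J).
have mG : measurable [set w | (corner N @^-1` level_set N (conj_part lam)) (Amat k w)].
  apply: (measurable_Amat iid k (c := 0)) => // Z Z' hB.
  have hZ : intm (Z' - Z) by apply/(ballN_intm (p := p)).
  by apply: (level_set_int (p := p)); rewrite (intmBC (p := p)).
apply: (prob_ge_compl iid mG (measurableU _ _ mE1 mE2)).
  apply: le_trans (measureU2 _ mE1 mE2) _.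
  apply: le_trans (leeD pE1 pE2) _; rewrite -EFinD lee_fin.
  by rewrite !card_not_full card_rank_col card_rank_row; lra.
move=> w hw /not_orP [nE1 nE2].
have iX : intm (Xmx V J N w) by exact: (intm_Vmx (p := p)).
have iY : intm (Ymx V J N w) by exact: (intm_Vmx (p := p)).
have rX : \rank (redm (Xmx V J N w)) = J.
  by apply/eqP/negPn/negP => h; apply: nE1; exact: EV1.
have rY : \rank (redm (Ymx V J N w)) = J.
  by apply/eqP/negPn/negP => h; apply: nE2; exact: EV2.
set A := corner N (Amat k w).
have iA : intm (A - Xmx V J N w *m diag_mx (\row_n coef (p := p) k n) *m Ymx V J N w).
  apply/intmP => i j; rewrite mxE [X in _ + X]mxE -(partsum_mx V k J w i j) mxE.
  rewrite -(@pw0 R p); exact: Amat_approx.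
move=> i; rewrite nth_conj_part /Xfun.
rewrite (xr_XDY iX iY rX rY iA); last by rewrite absKX exprn_ile1 ?absK_ge0 // absK_nat.
rewrite -sum1_count (big_nth 0%N) big_mkord sum1_card; apply: eq_card => j.
rewrite !inE mxE /coef kl.
have lj : (0 < nth 0%N lam j)%N by move/allP: hpos; apply; exact: mem_nth.
have -> : k j != Some 0 by rewrite /k /padf; apply/negP => /eqP [] h; rewrite h in lj.
rewrite absKM absK_expand_sing exprnP absK_pz -pwD -(@pw0 R p) ltr_pw.
by transitivity (i < nth 0%N lam j)%N; first by lia.
Qed.

End LowerBounds.

(** * The chain and the closed formula *)

Section Transposition.

(** Both sides say that the box in row i and column j belongs to the Young diagram of [mu]. *)
Lemma leq_count_gt mu i j : sorted geq mu -> (i < count (ltn j) mu)%N = (j < nth 0%N mu i)%N.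
Proof.
have gt : transitive geq by move=> x y z /= h1 h2; exact: leq_trans h2 h1.
elim: mu i => [|x mu ih] [|i] // hs.
  rewrite /=; case: (ltnP j x) => jx; first by rewrite add1n.
  rewrite add0n; apply/negbTE; rewrite -has_count; apply/hasPn => y hy /=.
  have /allP h := order_path_min gt hs; have := h _ hy => /= yx.
  by rewrite -leqNgt; exact: leq_trans yx jx.
have hs' : sorted geq mu by exact: path_sorted hs.
rewrite /= -ih //; case: (ltnP j x) => jx; first by rewrite add1n ltnS.
have -> : count (ltn j) mu = 0%N.
  apply/eqP; rewrite -leqn0 leqNgt -has_count; apply/hasPn => y hy /=.
  have /allP h := order_path_min gt hs; have := h _ hy => /= yx.
  by rewrite -leqNgt; exact: leq_trans yx jx.
by rewrite !ltn0.
Qed.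

Lemma conj_partK lam : is_partition lam -> conj_part (conj_part lam) = lam.
Proof.
move=> hl; apply: partition_nth_inj => // [|i]; first exact: conj_part_partition.
have /andP[hs _] := hl; have /andP[ht _] := conj_part_partition lam.
rewrite nth_conj_part; apply/eqP; rewrite eqn_leq; apply/andP; split; rewrite leqNgt; apply/negP.
  by rewrite leq_count_gt // nth_conj_part leq_count_gt // ltnn.
rewrite -(leq_count_gt _ _ hs) -nth_conj_part -leq_count_gt // => h.
by rewrite ltnn in h.
Qed.

Lemma nth_filter_pos s i : sorted geq s -> nth 0%N (seq.filter (ltn 0) s) i = nth 0%N s i.
Proof.
have gt : transitive geq by move=> x y z /= h1 h2; exact: leq_trans h2 h1.
elim: s i => [|x s ih] i hs; first by [].
have hs' : sorted geq s by exact: path_sorted hs.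
have [x0|x0] := posnP x; last by case: i => [|i]; rewrite /= x0 //= ih.
have /allP h := order_path_min gt hs; rewrite /= x0 ltnn.
have z j : nth 0%N s j = 0%N.
  have [hj|hj] := ltnP j (size s); last by rewrite nth_default.
  by have := h _ (mem_nth 0%N hj); rewrite /= x0 leqn0 => /eqP.
by rewrite ih // z; case: i => //= i; rewrite z.
Qed.

Lemma partition_of_seq s : sorted geq s -> is_partition (seq.filter (ltn 0) s).
Proof.
move=> hs; have gt : transitive geq by move=> x y z /= h1 h2; exact: leq_trans h2 h1.
by rewrite /is_partition (sorted_filter gt) //=; apply/allP => x; rewrite mem_filter => /andP[].
Qed.

Lemma sum_count_mem lam i m : (forall x, x \in lam -> (x <= m)%N) ->
  (\sum_(i <= j < m.+1) count_mem j lam = count (leq i) lam)%N.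
Proof.
elim: lam => [|x lam ih] h; first by rewrite big1.
rewrite /= big_split /= ih => [|y hy]; last by apply: h; rewrite inE hy orbT.
congr (_ + _)%N; have xm : (x <= m)%N by apply: h; rewrite mem_head.
have [ix|ix] := leqP i x.
  rewrite (bigD1_seq x) ?iota_uniq ?mem_index_iota ?ix ?ltnS //= eqxx big1 // => j /negbTE.
  by rewrite eq_sym => ->.
rewrite big_nat big1 // => j /andP[ij _]; case: eqP => // e; lia.
Qed.

Lemma Xv_count lam i : Xv lam i.+1 = count (ltn i) lam.
Proof. by rewrite /Xv /lv sum_count_mem // => x; exact: maxpart_ge. Qed.

Lemma sum_parts lam m : (forall x, x \in lam -> (x <= m)%N) ->
  (\sum_(1 <= i < m.+1) i * count_mem i lam = \sum_(i < m) count (ltn i) lam)%N.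
Proof.
elim: lam => [|x lam ih] h; first by rewrite !big1 // => i _; rewrite muln0.
have xm : (x <= m)%N by apply: h; rewrite mem_head.
under eq_bigr do rewrite /= mulnDr.
rewrite /= !big_split /= ih => [|y hy]; last by apply: h; rewrite inE hy orbT.
congr (_ + _)%N.
rewrite big_add1 /= big_mkord; elim: m xm {h ih} => [|m ih] xm.
  by rewrite !big_ord0.
rewrite !big_ord_recr /=; move: xm; rewrite leq_eqVlt ltnS => /predU1P[->|xm].
  rewrite eqxx ltnSn muln1 big1 ?add0n => [|i _]; last first.
    by rewrite eqSS gtn_eqF ?muln0.
  rewrite (eq_bigr (fun _ => 1%N)) ?sum1_card ?card_ord ?addn1 // => i _.
  by rewrite ltnS ltnW.
rewrite ih // ltnNge xm /=; case: eqP => e; lia.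
Qed.

End Transposition.

Section ChainFormula.
Context {R : realType} {p : nat} {Hp : prime_nat p}.
Context (s : R) (s_gt : -1 < s).
Local Notation q := ((p%:R : R)^-1).
Local Notation a := ((p%:R : R) `^ (-1 - s)).
Local Notation b := ((p%:R : R) `^ (- s)).
Local Notation level_lim := (level_lim p s).

Lemma powR_sum_formula m n : (p%:R : R) `^ (- m%:R - s * n%:R) = q ^+ m * b ^+ n.
Proof.
rewrite powRD; last by rewrite pR_neq0 implybT.
rewrite (powRN _ m%:R) powR_mulrn ?ler0n // exprVn; congr (_ * _).
by rewrite -mulNr powRrM powR_mulrn // powR_ge0.
Qed.

Lemma level_weight_nth c xs n : (size xs <= n)%N ->
  level_weight p c xs = \prod_(i < n) (q ^+ (nth 0%N xs i ^ 2) * c ^+ nth 0%N xs i /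
     qpoch q q (nth 0%N xs i - nth 0%N xs i.+1)).
Proof.
elim: n xs => [|n ih] [|x xs] //= h; first by rewrite big_ord0.
  by rewrite big1 // => i _; rewrite !nth_nil !expr0 qpoch0 invr1 !mulr1.
by rewrite big_ord_recl (ih xs) //= -nth0 mulnn.
Qed.

(** In terms of the conjugate partition, X_(i+1) is entry i, l_(i+1) is the difference of entries i
    and i + 1, and the sum of the i l_i is the sum of all entries. *)
Lemma nu_formulaE lam : nu_formula p s lam = level_lim (conj_part lam).
Proof.
rewrite /nu_formula /level_lim (@level_weight_nth b _ (maxpart lam)) ?size_mkseq // -mulrA;
  congr (_ * _).
rewrite sum_parts; last by move=> x; exact: maxpart_ge.
rewrite powR_sum_formula !big_add1 /= !big_mkord !expr_sum -!big_split /=.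
apply: eq_bigr => i _; rewrite !nth_conj_part Xv_count; congr (_ * _ / qpoch _ _ _).
rewrite /lv -[X in (X - _)%N](@sum_count_mem _ i.+1 (maxpart lam)); last by move=> x;
  exact: maxpart_ge.
rewrite (@big_ltn _ _ _ i.+1) ?ltnS // sum_count_mem; last by move=> x; exact: maxpart_ge.
by rewrite addnK.
Qed.

Definition chain_weight (x : nat -> nat) n : R :=
  pi_s p s (x 1%N) * \prod_(1 <= i < n) P_s p s (x i) (x i.+1).

Lemma chain_weightS x n : (0 < n)%N ->
  chain_weight x n.+1 = chain_weight x n * P_s p s (x n) (x n.+1).
Proof. by move=> n0; rewrite /chain_weight big_nat_recr //= mulrA. Qed.

(** Cancelling the Pochhammer symbols of index y against those of index x turns the row sum into
    [vsum q x a]. *)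
Lemma sum_P_s x : \sum_(y < x.+1) P_s p s x y = 1.
Proof.
rewrite -[RHS](vsumE q x a); apply: eq_bigr => y _.
have yx : (y <= x)%N by rewrite -ltnS.
rewrite /P_s yx powR_sum_formula.
have qp n : 0 < qpoch q q n by exact: qpoch_q_gt0.
have ap n : 0 < qpoch a q n by apply: qpoch_gt0; rewrite ?a_ge0 ?a_lt1 ?q_ge0 ?q_lt1.
rewrite -(gauss_binom_formula q yx).
have -> : qpoch a q x = qpoch a q y * qpoch (a * q ^+ y) q (x - y).
  rewrite -{1}(subnKC yx) /qpoch big_split_ord /=; congr (_ * _).
  by apply: eq_bigr => i _; rewrite exprD mulrA.
have -> : q ^+ (y ^ 2) * b ^+ y = q ^+ (y * y.-1) * a ^+ y.
  rewrite aE exprMn mulrA -exprD; congr (q ^+ _ * _).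
  by case: (y : nat) => //= n; rewrite -mulnn; lia.
have := lt0r_neq0 (qp y); have := lt0r_neq0 (qp (x - y)%N); have := lt0r_neq0 (ap y).
move: (gauss_binom q x y) (qpoch q q y) (qpoch q q _) (qpoch a q y) (qpoch (a * _) q _) =>
  c u v w z w0 v0 u0.
by field; rewrite u0 v0 w0.
Qed.

Lemma P_s_diag x : P_s p s x x = q ^+ (x * x.-1) * a ^+ x.
Proof.
have qp n : 0 < qpoch q q n by exact: qpoch_q_gt0.
have ap n : 0 < qpoch a q n by apply: qpoch_gt0; rewrite ?a_ge0 ?a_lt1 ?q_ge0 ?q_lt1.
rewrite /P_s leqnn subnn qpoch0 powR_sum_formula mulr1.
have -> : q ^+ (x ^ 2) * b ^+ x = q ^+ (x * x.-1) * a ^+ x.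
  rewrite aE exprMn mulrA -exprD; congr (q ^+ _ * _).
  by case: x => //= n; rewrite -mulnn; lia.
have := lt0r_neq0 (qp x); have := lt0r_neq0 (ap x) => w0 v0.
by field; rewrite v0 w0.
Qed.

Lemma P_s_diag_lt1 x : (0 < x)%N -> 0 <= P_s p s x x < 1.
Proof.
move=> x0; rewrite P_s_diag mulr_ge0 ?exprn_ge0 ?q_ge0 ?a_ge0 //=.
apply: le_lt_trans (_ : a ^+ x < 1); last by rewrite exprn_ilt1 ?a_ge0 ?a_lt1 // -lt0n.
by rewrite ler_piMl ?exprn_ge0 ?a_ge0 // exprn_ile1 ?q_ge0 // ltW // q_lt1.
Qed.

(** The product telescopes: the symbols (q;q) and (a;q) at x_i in the numerator of one transition
    cancel those in the denominator of the preceding factor, so only those at the last value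
    survive. *)
Lemma chain_weight_prod x n : (forall i, (0 < i <= n)%N -> (x i.+1 <= x i)%N) ->
  chain_weight x n.+1 = qpoch_inf a q *
    \prod_(i < n.+1) (q ^+ (x i.+1 ^ 2) * b ^+ x i.+1) *
    \prod_(i < n) (qpoch q q (x i.+1 - x i.+2))^-1 /
    (qpoch q q (x n.+1) * qpoch a q (x n.+1)).
Proof.
have qp m : 0 < qpoch q q m by exact: qpoch_q_gt0.
have ap m : 0 < qpoch a q m by apply: qpoch_gt0; rewrite ?a_ge0 ?a_lt1 ?q_ge0 ?q_lt1.
elim: n => [|n ih] hx.
  rewrite /chain_weight big_geq // big_ord1 big_ord0 /pi_s powR_sum_formula; ring.
rewrite chain_weightS // ih; last by move=> i /andP[i0 i1]; rewrite hx // i0 leqW.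
rewrite /P_s hx ?ltnSn // powR_sum_formula [\prod_(i < n.+2) _]big_ord_recr /=.
rewrite [\prod_(i < n.+1) (qpoch _ _ _)^-1]big_ord_recr /=.
have := lt0r_neq0 (qp (x n.+1)); have := lt0r_neq0 (qp (x n.+2)).
have := lt0r_neq0 (ap (x n.+1)); have := lt0r_neq0 (ap (x n.+2)).
have := lt0r_neq0 (qp (x n.+1 - x n.+2)%N).
move: (qpoch q q _) (qpoch q q _) (qpoch q q _) (qpoch a q _) (qpoch a q _).
move: (\prod_(i < n.+1) _) (\prod_(i < n) _) (qpoch_inf _ _) (q ^+ _ * b ^+ _).
move=> e1 e2 e3 e4 d1 d2 d3 d4 d5 h1 h2 h3 h4 h5.
by field; rewrite ?h1 ?h2 ?h3 ?h4 ?h5.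
Qed.

Lemma chain_weight_eq0 x n i : (0 < i < n)%N -> (x i < x i.+1)%N -> chain_weight x n = 0.
Proof.
move=> /andP[i0 hi] xi; rewrite /chain_weight (bigD1_seq i) ?iota_uniq ?mem_index_iota ?i0 //=.
by rewrite /P_s leqNgt xi /= mul0r mulr0.
Qed.

(** A nonincreasing path that has reached 0 is, with its zeros dropped, a complete conjugate
    partition. At the last value 0 the surviving symbols are 1, and the telescoped weight is the
    closed formula. *)
Lemma chain_weight_partition x n : (0 < n)%N ->
  (forall i, (0 < i < n)%N -> (x i.+1 <= x i)%N) -> x n = 0%N ->
  exists lam, [/\ is_partition lam,
    forall i, count (ltn i) lam = if (i < n)%N then x i.+1 else 0%N
    & chain_weight x n = level_lim (conj_part lam)].
Proof.
case: n => // n _ hx x0; pose l := mkseq (fun i => x i.+1) n.+1.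
have sl : sorted geq l.
  apply/(sortedP 0%N) => i; rewrite size_mkseq => hi.
  by rewrite !nth_mkseq ?(ltnW hi) //=; apply: hx; rewrite /= -ltnS.
have pl := partition_of_seq sl; exists (conj_part (seq.filter (ltn 0) l)); split.
- exact: conj_part_partition.
- move=> i; rewrite -nth_conj_part conj_partK // nth_filter_pos //; case: ifP => hi;
  first by rewrite nth_mkseq.
  by rewrite nth_default // size_mkseq leqNgt hi.
rewrite conj_partK // chain_weight_prod => [|i /andP[i0 hi]]; last by apply: hx; rewrite i0 ltnS.
rewrite x0 !qpoch0 !mulr1 invr1 mulr1 /level_lim -mulrA; congr (_ * _).
rewrite (@level_weight_nth b _ n.+1); last by rewrite size_filter -[X in (_ <= X)%N](size_mkseq
  (fun i => x i.+1) n.+1) count_size.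
have -> : \prod_(i < n) (qpoch q q (x i.+1 - x i.+2))^-1 =
    \prod_(i < n.+1) (qpoch q q (x i.+1 - x i.+2))^-1.
  by rewrite big_ord_recr /= x0 sub0n qpoch0 invr1 mulr1.
rewrite -big_split; apply: eq_bigr => i _; rewrite !nth_filter_pos // nth_mkseq //.
congr (_ * (qpoch _ _ _)^-1); have := ltn_ord i; rewrite leq_eqVlt eqSS => /predU1P[e|hi].
  by rewrite e x0 !sub0n.
by rewrite nth_mkseq.
Qed.

End ChainFormula.

(** * The mixing measure *)

(* The integrand need not be measurable: the integral of a nonnegative function is a supremum
   over the simple functions below it. *)
Lemma integral_ge_indic d (T : measurableType d) (R : realType) (m : {measure set T -> \bar R})
    (f : T -> \bar R) (A : set T) (c : R) : measurable A -> 0 <= c ->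
  (forall x, (0 <= f x)%E) -> (forall x, A x -> (c%:E <= f x)%E) ->
  (c%:E * m A <= \int[m]_x f x)%E.
Proof.
move=> mA c0 f0 fA; rewrite ge0_integralTE //.
apply: ereal_sup_ubound; exists (scale_nnsfun (indic_nnsfun R mA) c0).
  move=> x; change ((c * \1_A x)%:E <= f x)%E.
  rewrite indicE; case: (boolP (x \in A)) => xA; last by rewrite mulr0.
  by rewrite mulr1; apply: fA; rewrite inE in xA.
by rewrite sintegralrM sintegral_indic.
Qed.

Section MeasurableDelta.

Lemma measurable_coord n v : measurable [set k : Deltam | sval k n = v].
Proof. by apply: sub_sigma_algebra; exists n, v. Qed.

Lemma measurable_point (u : nat -> option int) : measurable [set k : Deltam | sval k = u].
Proof.
have -> : [set k : Deltam | sval k = u] = \bigcap_n [set k : Deltam | sval k n = u n].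
  apply/seteqP; split=> k /= h; first by move=> n _; rewrite /= h.
  by apply/funext => n; exact: h.
by apply: bigcapT_measurable => n; exact: measurable_coord.
Qed.

Definition below1 J : set Deltam := [set k | oint_le (sval k J) (Some (- 1))].

Lemma below1E J : below1 J = ~` \bigcup_c [set k : Deltam | sval k J = Some (c%:Z : int)].
Proof.
apply/seteqP; split=> k; rewrite /below1 /=.
  by move=> h [c _] /= e; rewrite e /= in h; lia.
move=> h; case e: (sval k J) => [z|] //=; rewrite leNgt; apply/negP => z0; apply: h.
by exists `|z|%N => //=; rewrite e; congr Some; lia.
Qed.

Lemma measurable_below1 J : measurable (below1 J).
Proof.
rewrite below1E; apply: measurableC; apply: bigcupT_measurable => c; exact: measurable_coord.
Qed.

Definition lam_set (lam : seq nat) : set Deltam := [set k | sval k = padf lam].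

Lemma measurable_lam_set lam : measurable (lam_set lam).
Proof. exact: measurable_point. Qed.

(** Raising a partition by its limit c. For every c these sets are countably many singletons, which
    lets a union bound over them work. *)
Definition shift_set (c : nat) (lam : seq nat) : set Deltam :=
  [set k | sval k = fun n => Some ((c + nth 0%N lam n)%N%:Z : int)].

(** The minimum c of the sequence is attained, and the sequence stays there; subtracting c leaves
    finitely many positive entries. *)
Lemma Delta_nat (k : Deltam) : (forall n, exists c : nat, sval k n = Some (c%:Z : int)) ->
  exists c lam, is_partition lam /\ shift_set c lam k.
Proof.
move=> hk; have [x hx] := choice hk.
have xS n : (x n.+1 <= x n)%N by have := svalP k n; rewrite !hx /= lez_nat.
have xmono m n : (m <= n)%N -> (x n <= x m)%N.
  by elim: n => [|n ih]; rewrite leq_eqVlt => /predU1P[->//|//] h; apply: leq_trans (xS n) (ih h).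
have ex : exists c, `[< exists n, x n = c >] by exists (x 0%N); apply/asboolP; exists 0%N.
case: (ex_minnP ex) => c /asboolP[m xm] cmin.
have cle n : (c <= x n)%N by apply: cmin; apply/asboolP; exists n.
pose l := mkseq (fun n => x n - c)%N m.
have sl : sorted geq l.
  apply/(sortedP 0%N) => i; rewrite size_mkseq => hi.
  by rewrite !nth_mkseq ?(ltnW hi) //=; rewrite leq_sub2r.
exists c, (seq.filter (ltn 0) l); split; first exact: partition_of_seq.
apply/funext => n; rewrite hx nth_filter_pos //; congr (Some _%:Z).
have [nm|mn] := ltnP n m; first by rewrite nth_mkseq // subnKC.
rewrite nth_default ?size_mkseq // addn0; apply/eqP; rewrite eqn_leq cle andbT -xm.
exact: xmono.
Qed.

Lemma Delta0E : Delta0 = \bigcup_n partset lam_set n.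
Proof.
rewrite bigcup_partset; apply/seteqP; split=> k /=.
  move=> [h [m hm]]; have [c [lam [hl e]]] := Delta_nat h; exists lam; split=> //.
  rewrite /lam_set /=; rewrite /shift_set /= in e.
  suff c0 : c = 0%N by rewrite e c0; apply/funext => n; rewrite add0n.
  have := hm (m + size lam)%N (leq_addr _ _); rewrite e => -[] /eqP.
  by rewrite addn_eq0 => /andP[/eqP].
move=> [lam [hl e]]; rewrite /lam_set /= in e; split; first by move=> n; exists (nth 0%N lam n);
  rewrite e.
by exists (size lam) => n h; rewrite e /padf nth_default.
Qed.

Lemma padf_inj lam lam' : is_partition lam -> is_partition lam' -> padf lam = padf lam' ->
  lam = lam'.
Proof.
move=> hx hy e; apply: partition_nth_inj => // i.
by have := congr1 (fun u => u i) e; rewrite /padf => -[].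
Qed.

Lemma lam_set_inj xs ys k : is_partition xs -> is_partition ys ->
  lam_set xs k -> lam_set ys k -> xs = ys.
Proof. by move=> hx hy; rewrite /lam_set /= => -> /padf_inj; exact. Qed.

Lemma Delta0C : ~` Delta0 `<=` \bigcup_J below1 J `|` \bigcup_c \bigcup_n partset (shift_set c.+1)
  n.
Proof.
move=> k nk; have [h|h] := pselect (exists J, below1 J k); first by left; case: h => J hJ; exists J.
have hk n : exists c : nat, sval k n = Some (c%:Z : int).
  apply: contrapT => hn; apply: h; exists n; rewrite below1E => -[c _ /= e].
  by apply: hn; exists c.
right; have [[|c] [lam [hl e]]] := Delta_nat hk.
  exfalso; apply: nk; by rewrite Delta0E bigcup_partset /=; exists lam.
by exists c => //; rewrite bigcup_partset; exists lam.
Qed.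

End MeasurableDelta.

Section Mixture.
Context {R : realType} {p : nat} {K : fieldType} {absK : K -> R}.
Context {Hp : prime_nat p} {HQ : Qp_field p absK}.
Context (s : R) (s_gt : -1 < s).
Context (vol : forall N : nat, {measure set (MatNm absK p N) -> \bar R}).
Context (vol_haar : is_haar vol).
Context (M : probability (MatInfm absK p) R).
Context (M_corner : forall (N : nat) (B : set (MatNm absK p N)),
  measurable B -> M (corner N @^-1` B) = MsN vol s B).
Context {d : measure_display} {Omega : measurableType d} (P : probability Omega R).
Context (V : Idx -> Omega -> K) (iid : iid_haar_Zp absK p P V).
Context (nu : probability Deltam R).
Context (nu_mix : forall A : set (MatInfm absK p), measurable A ->
  M A = (\int[nu]_k mu absK p P V (sval k) A)%E).
Local Notation mu := (mu absK p P V).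
Local Notation level_set := (level_set p absK).
Local Notation xr_gt := (xr_gt p absK).
Local Notation xr1_le := (xr1_le p absK).
Local Notation level_lim := (level_lim p s).

Lemma nu_fin (T : set Deltam) : measurable T -> nu T = (fine (nu T))%:E.
Proof. by move=> mT; rewrite fineK // fin_num_measure. Qed.

Lemma mixture_ge (T : set Deltam) N (A : set (MatNm absK p N)) (c r : R) :
  measurable T -> measurable A -> 0 <= c ->
  (forall k, T k -> (c%:E <= mu (sval k) (corner N @^-1` A))%E) ->
  (M (corner N @^-1` A) <= r%:E)%E -> c * fine (nu T) <= r.
Proof.
move=> mT mA c0 h hr; rewrite -lee_fin EFinM -nu_fin //.
apply: le_trans hr; rewrite nu_mix; last exact: measurable_corner.
by apply: integral_ge_indic => // k; exact: measure_ge0.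
Qed.

Lemma nu_below1 J : nu (below1 J) = 0%E.
Proof.
rewrite (nu_fin (measurable_below1 J)); congr (_%:E); apply/eqP;
  rewrite eq_le fine_ge0 ?measure_ge0 // andbT.
apply/ler_addgt0Pr => e e0; rewrite add0r.
have h : \forall N \near \oo, (M (corner N @^-1` xr1_le N J) <= e%:E)%E.
  exact: (xr1_le_small vol_haar M_corner).
have [N hN] := filter_ex h; rewrite -[X in X <= _]mul1r.
apply: (mixture_ge _ _ ler01 _ hN); first exact: measurable_below1.
  exact: (measurable_xr1_le vol_haar M_corner).
move=> k hk; apply: mu_xr1_le => //; exact: (svalP k).
Qed.

Lemma nu_shift c lam : nu (shift_set c.+1 lam) = 0%E.
Proof.
rewrite (nu_fin (measurable_point _)); congr (_%:E); apply/eqP;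
  rewrite eq_le fine_ge0 ?measure_ge0 // andbT.
apply/ler_addgt0Pr => e e0; rewrite add0r.
(* The event has mu_k-probability at least 1/2 on the set in question, so an M-mass of at most e / 2
   bounds nu by e. *)
have e2 : 0 < e / 2 by rewrite divr_gt0.
have h2 : (0 : R) < 1 / 2 by rewrite divr_gt0.
have [r hr] : exists r, \forall N \near \oo, (M (corner N @^-1` xr_gt N r) <= (e / 2)%:E)%E.
  exact: (xr_tight s_gt vol_haar M_corner).
pose k0 n : option int := Some ((c.+1 + nth 0%N lam n)%N%:Z : int).
have hm : \forall N \near \oo, ((1 - 1 / 2)%:E <= mu k0 (corner N @^-1` xr_gt N r))%E.
  apply: (@mu_xr_gt _ _ _ _ _ _ _ _ _ _ iid k0 (size lam) (c.+1%:Z)) => // n hn.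
  by rewrite /k0 nth_default // addn0.
have [N [h1 h3]] := filter_ex (filterI hr hm).
have : (1 - 1 / 2) * fine (nu (shift_set c.+1 lam)) <= e / 2; last by lra.
apply: (mixture_ge _ _ _ _ h1); first exact: measurable_point.
- exact: (measurable_xr_gt vol_haar M_corner).
- by lra.
- by move=> k; rewrite /shift_set /= => ->.
Qed.

Lemma nu_lam_le lam : is_partition lam -> fine (nu (lam_set lam)) <= level_lim (conj_part lam).
Proof.
move=> hl; apply/ler_addgt0Pr => e e0.
have e2 : 0 < e / 2 by rewrite divr_gt0.
have cv : level_mass p s N (conj_part lam) @[N --> \oo] --> level_lim (conj_part lam) by exact:
  cvg_level_mass.
have /cvgrPdist_lt/(_ _ e2) h1 := cv.
have h2 : \forall N \near \oo,
    ((1 - e / 2)%:E <= mu (padf lam) (corner N @^-1` level_set N (conj_part lam)))%E by exact: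
      mu_level_set.
have [N [h3 h4]] := filter_ex (filterI h1 h2).
have hM : (M (corner N @^-1` level_set N (conj_part lam)) <= (level_lim (conj_part lam) + e /
  2)%:E)%E.
  rewrite (measure_corner_level_set vol_haar M_corner); last exact: conj_part_partition.
  by rewrite lee_fin; move: h3; rewrite ltr_norml => /andP[+ _]; lra.
have f1 : fine (nu (lam_set lam)) <= 1.
  have ml := measurable_lam_set lam; by rewrite -lee_fin -nu_fin //; exact: probability_le1.
have f0 : 0 <= fine (nu (lam_set lam)) by rewrite fine_ge0.
(* For e > 2 the lower bound 1 - e / 2 is negative and of no use, but then nu <= 1 <= e is
   enough. *)
have [e1|e1] := lerP (e / 2) 1; last first.
  by have h : 0 <= level_lim (conj_part lam) by [exact: level_lim_ge0]; apply: le_trans f1 _; lra.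
(* One half of e pays for the limit of the masses, the other for the factor 1 - e / 2, since nu is
   at most 1. *)
have : (1 - e / 2) * fine (nu (lam_set lam)) <= level_lim (conj_part lam) + e / 2.
  apply: (mixture_ge _ _ _ _ hM); first exact: measurable_lam_set.
  - exact: (measurable_level_set vol_haar M_corner).
  - by lra.
  - by move=> k; rewrite /lam_set /= => ->.
by nra.
Qed.

Lemma measurable_Delta0 : measurable Delta0.
Proof.
by rewrite Delta0E; apply: bigcupT_measurable; apply: measurable_partset => xs _;
  exact: measurable_lam_set.
Qed.

Lemma nu_Delta0 : nu Delta0 = 1%E.
Proof.
have mC : measurable (~` Delta0) by apply: measurableC; exact: measurable_Delta0.
have h0 : nu (~` Delta0) = 0%E.
  apply/(negligibleP nu mC); apply: negligibleS Delta0C _; apply: negligibleU.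
    apply: negligible_bigcup => J; apply/negligibleP; [exact: measurable_below1|exact: nu_below1].
  apply: negligible_bigcup => c; apply: negligible_bigcup => n; rewrite /partset.
  case: (part_of n) => [lam|]; last exact: negligible_set0.
  by apply/negligibleP; [exact: measurable_point|exact: nu_shift].
by rewrite -[Delta0]setCK probability_setC // h0 sube0.
Qed.

Lemma nu_lam lam0 : is_partition lam0 -> nu (lam_set lam0) = (level_lim (conj_part lam0))%:E.
Proof.
move=> hl0; rewrite (nu_fin (measurable_lam_set _)); congr (_%:E); apply/eqP;
  rewrite eq_le nu_lam_le //=.
(* The lower bound is obtained on the complement: all other partitions together have mass at most 1
   minus the claimed value at [lam0]. *)
pose A lam : set Deltam := if lam == lam0 then set0 else lam_set lam.
have mA lam : measurable (A lam) by rewrite /A; case: ifP => // _; exact: measurable_lam_set.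
have mU : measurable (\bigcup_n partset A n).
  by apply: bigcupT_measurable; apply: measurable_partset => lam _; exact: mA.
have hU : (nu (\bigcup_n partset A n) <= (1 - level_lim (conj_part lam0))%:E)%E.
  rewrite measure_bigcup_partset //; last first.
    by move=> xs ys k hx hy; rewrite /A; case: ifP => // _; case: ifP => // _; exact: lam_set_inj.
  apply: lime_le; first by apply: is_cvg_nneseries => n _ _; rewrite /pterm; case: part_of.
  near=> m; rewrite big_mkord.
  (* The partitions with code below m, except [lam0]. As conjugation is injective on partitions,
     [lam0 :: L] gives distinct level sets, and [sum_level_lim_le1] applies. *)
  pose L := [seq lam <- pmap part_of (iota 0 m) | lam != lam0].
  have pL lam : lam \in L -> is_partition lam.
    rewrite mem_filter => /andP[_]; rewrite mem_pmap => /mapP[n _ e].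
    by case: (part_of_some (esym e)).
  apply: le_trans (_ : ((\sum_(lam <- L) level_lim (conj_part lam))%:E <= _)%E).
    have -> : \sum_(lam <- L) level_lim (conj_part lam) =
        \sum_(n < m) oapp (fun lam => if lam != lam0 then level_lim (conj_part lam) else 0) 0
          (part_of n).
      by rewrite /L big_filter big_mkcond big_pmap -[in LHS](subn0 m) big_mkord.
    rewrite -sumEFin; apply: lee_sum => n _; rewrite /pterm.
    case en: (part_of n) => [lam|] //=; have [hl _] := part_of_some en.
    rewrite /A; case: eqP => [_|_] /=; first by rewrite measure0.
    by rewrite (nu_fin (measurable_lam_set _)) lee_fin nu_lam_le.
  rewrite lee_fin lerBrDr addrC.
  have -> : level_lim (conj_part lam0) + \sum_(lam <- L) level_lim (conj_part lam) =
      \sum_(xs <- [seq conj_part lam | lam <- lam0 :: L]) level_lim xs by rewrite big_map big_cons.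
  apply: (sum_level_lim_le1 s_gt vol_haar M_corner).
    rewrite map_inj_in_uniq.
      rewrite cons_uniq mem_filter eqxx /= filter_uniq //.
      apply: (@pmap_uniq _ _ part_of pickle); last exact: iota_uniq.
      by move=> n; case e: (part_of n) => [lam|] //=; case: (part_of_some e).
    move=> x y hx hy e; rewrite -(conj_partK (lam := x)) ?e ?conj_partK //.
    - by move: hy; rewrite inE => /predU1P[->|/pL].
    - by move: hx; rewrite inE => /predU1P[->|/pL].
  by apply/allP => xs /mapP[lam _ ->]; exact: conj_part_partition.
have h1 : (1 <= nu (lam_set lam0) + nu (\bigcup_n partset A n))%E.
  rewrite -nu_Delta0; apply: le_trans (measureU2 _ _ _) => //; last exact: measurable_lam_set.
  apply: le_measure; rewrite ?inE; [exact: measurable_Delta0| |].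
    by apply: measurableU => //; exact: measurable_lam_set.
  rewrite Delta0E !bigcup_partset => k [lam [hl hk]].
  have [e|ne] := eqVneq lam lam0; first by left; rewrite -e.
  by right; exists lam; split=> //; rewrite /A (negbTE ne).
have := le_trans h1 (leeD (lexx _) hU).
by rewrite (nu_fin (measurable_lam_set _)) -EFinD lee_fin; lra.
Unshelve. all: by end_near.
Qed.

End Mixture.

(** * Finite-dimensional laws of the chain *)

Section Prefixes.
Context {R : realType} {p : nat} {Hp : prime_nat p}.
Context (s : R) (s_gt : -1 < s).
Context (nu : probability Deltam R).
Context (nu_lam : forall lam, is_partition lam ->
  nu (lam_set lam) = (level_lim p s (conj_part lam))%:E).
Local Notation cw := (chain_weight (p := p) s).

Definition prefix_set n (x : nat -> nat) : set Deltam :=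
  [set k : Deltam | exists lam : seq nat,
     [/\ is_partition lam, sval k = padf lam
       & forall i : nat, (1 <= i <= n)%N -> Xv lam i = x i]].

Lemma measurable_prefix n x : measurable (prefix_set n x).
Proof.
pose A lam : set Deltam :=
  if `[< forall i, (1 <= i <= n)%N -> Xv lam i = x i >] then lam_set lam else set0.
have -> : prefix_set n x = \bigcup_m partset A m.
  rewrite bigcup_partset; apply/seteqP; split=> k /=.
    by move=> [lam [h1 h2 h3]]; exists lam; split=> //; rewrite /A asboolT.
  by move=> [lam [h1]]; rewrite /A; case: asboolP => // h3 h2; exists lam.
apply: bigcupT_measurable; apply: measurable_partset => lam _; rewrite /A.
by case: asboolP => // _; exact: measurable_lam_set.
Qed.

Lemma Xv_decr lam i j : (0 < i <= j)%N -> (Xv lam j <= Xv lam i)%N.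
Proof.
case: i j => [|i] [|j] // h; rewrite !Xv_count; apply: sub_count => y /=.
by apply: leq_ltn_trans.
Qed.

(** Read up to time n + 1, this chooses the next value y; read further, it is the path that stays at
    y forever. *)
Definition upd (x : nat -> nat) n y i : nat := if (i <= n)%N then x i else y.

Lemma prefix_upd n x y : prefix_set n (upd x n y) = prefix_set n x.
Proof.
by apply/seteqP; split=> k /= [lam [h1 h2 h3]]; exists lam; split=> // i hi; have := h3 i hi;
  rewrite /upd; move/andP: hi => [_ ->].
Qed.

Lemma prefix_split n x : (0 < n)%N ->
  prefix_set n x = \big[setU/set0]_(y < (x n).+1) prefix_set n.+1 (upd x n y).
Proof.
move=> n0; apply/seteqP; split=> k.
  move=> [lam [h1 h2 h3]]; rewrite -(bigcup_mkord _ (fun y => prefix_set n.+1 (upd x n y)));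
    exists (Xv lam n.+1) => /=.
    by rewrite ltnS -(h3 n) ?n0 ?leqnn // Xv_decr // n0 leqnSn.
  exists lam; split=> // i /andP[i0 hi]; rewrite /upd; case: leqP => hin; first by rewrite h3 ?i0.
  by congr (Xv lam _); lia.
rewrite -(bigcup_mkord _ (fun y => prefix_set n.+1 (upd x n y))) => -[y _ [lam [h1 h2 h3]]];
  exists lam; split=> // i /andP[i0 hi].
by rewrite h3 ?i0 ?leqW // /upd hi.
Qed.

Lemma prefix_sum n x : (0 < n)%N ->
  nu (prefix_set n x) = (\sum_(y < (x n).+1) nu (prefix_set n.+1 (upd x n y)))%E.
Proof.
move=> n0; rewrite {1}prefix_split //.
rewrite (measure_bigsetU_ord nu xpredT) // => [y|]; first exact: measurable_prefix.
apply/trivIsetP => i j _ _ ij; rewrite -subset0 => k [[lam [h1 h2 h3]] [lam' [h4 h5 h6]]].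
have e : lam = lam' by apply: padf_inj; rewrite // -h2 -h5.
move/eqP: ij => []; apply: val_inj; have := h3 n.+1; have := h6 n.+1.
by rewrite /upd ltnn leqnn /= e => <- // <-.
Qed.

Lemma chain_weight_upd n x y : (0 < n)%N ->
  cw (upd x n y) n.+1 = cw x n * P_s p s (x n) y.
Proof.
move=> n0; rewrite chain_weightS // /upd leqnn ltnn; congr (_ * _).
rewrite /chain_weight n0; congr (_ * _); apply: eq_big_nat => i /andP[_ hi].
by rewrite (ltnW hi) hi.
Qed.

Lemma prefix_eq0 n x i : (0 < i < n)%N -> (x i < x i.+1)%N -> prefix_set n x = set0.
Proof.
move=> /andP[i0 hi] xi; rewrite -subset0 => k [lam [_ _ h]].
move: xi; rewrite -(h i) ?i0 ?(ltnW hi) // -(h i.+1) // ltnNge => /negP; apply.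
by apply: Xv_decr; rewrite i0 leqnSn.
Qed.

(** Once the path has reached 0 the prefix determines the partition, so the event is a single point
    of known mass. *)
Lemma prefix_zero n x : (0 < n)%N -> (forall i, (0 < i < n)%N -> (x i.+1 <= x i)%N) -> x n = 0%N ->
  nu (prefix_set n x) = (cw x n)%:E.
Proof.
move=> n0 hx x0; have [lam [hl cl ->]] := @chain_weight_partition _ _ _ _ s_gt x n n0 hx x0.
rewrite -nu_lam //; congr (nu _); apply/seteqP; split=> k; rewrite /lam_set /=; last first.
  move=> e; exists lam; split=> // -[//|i] /= hi; by rewrite Xv_count cl hi.
move=> [lam' [h1 -> h3]]; congr padf.
rewrite -(conj_partK hl) -(conj_partK h1); congr conj_part; apply: partition_nth_inj;
  try exact: conj_part_partition.
move=> i; rewrite !nth_conj_part cl; case: ltnP => hi; first by rewrite -Xv_count h3.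
by apply/eqP; rewrite -leqn0 -Xv_count -x0 -(h3 n) ?n0 ?leqnn // Xv_decr // n0 leqW.
Qed.

(** The events decrease with m, and their intersection is empty because X_i = 0 for i beyond the
    largest part; continuity from above applies. *)
Lemma cvg_prefix n x v : (0 < n)%N -> (0 < v)%N ->
  fine (nu (prefix_set (n + m) (upd x n v))) @[m --> \oo] --> (0 : R).
Proof.
move=> n0 v0; pose F m := prefix_set (n + m) (upd x n v).
have F0 : \bigcap_m F m = set0.
  rewrite -subset0 => k hk; have [lam [h1 h2 h3]] := hk 0%N I.
  (* This horizon lies beyond the largest part, where v > 0 is contradicted. *)
  have [lam' [h4 h5 h6]] := hk (maxpart lam).+1 I.
  have e : lam = lam' by apply: padf_inj; rewrite // -h2 -h5.
  have := h6 (n + (maxpart lam).+1)%N; rewrite leqnn andbT addn_gt0 n0 => /(_ isT).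
  rewrite /upd leqNgt -[X in (X < _)%N]addn0 ltn_add2l /= -e addnS Xv_count => e2.
  have : (0 < count (ltn (n + maxpart lam)) lam)%N by rewrite e2.
  rewrite -has_count => /hasP[y /maxpart_ge hy /= hy2]; lia.
have h : nu \o F @ \oo --> nu (\bigcap_m F m).
  apply: nonincreasing_cvg_mu.
  - by rewrite -ge0_fin_numE // fin_num_measure //; exact: measurable_prefix.
  - by move=> m; exact: measurable_prefix.
  - by rewrite F0; exact: measurable0.
  - move=> m m' hm; apply/subsetPset => k [lam [h1 h2 h3]]; exists lam; split=> // i /andP[i0 hi].
    by apply: h3; rewrite i0 (leq_trans hi) // leq_add2l.
rewrite F0 measure0 in h.
exact: (fine_cvg h).
Qed.

Lemma nu_prefix_decr v n x : (0 < n)%N -> (forall i, (0 < i < n)%N -> (x i.+1 <= x i)%N) ->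
  x n = v -> nu (prefix_set n x) = (cw x n)%:E.
Proof.
elim/ltn_ind: v n x => v ih n x n0 hx xn.
have [v0|v0] := posnP v; first by apply: prefix_zero; rewrite // xn.
(* The path staying at v after time n. Its prefix event at time n is that of [x]. *)
pose x' := upd x n v.
have xv N : (n <= N)%N -> x' N = v.
  by rewrite /x' /upd; case: ltngtP => // <- _; rewrite xn.
have hx' i : (0 < i)%N -> (x' i.+1 <= x' i)%N.
  move=> i0; have [hi|hi] := ltnP i n; last by rewrite !xv // leqW.
  by rewrite /x' /upd hi (ltnW hi) hx // i0.
pose g N := fine (nu (prefix_set N x')); pose w N := cw x' N.
have gE N : nu (prefix_set N x') = (g N)%:E.
  by rewrite fineK // fin_num_measure //; exact: measurable_prefix.
have wS N : (n <= N)%N -> w N.+1 = w N * P_s p s v v.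
  by move=> hN; rewrite /w chain_weightS ?xv ?leqW //; exact: leq_trans n0 hN.
(* Both [g N] and [w N] split into the moves to y < v, which agree by the induction hypothesis, and
   the stay at v. For [w] the splitting is the fact that the rows of the kernel sum to 1. *)
have step N : (n <= N)%N -> g N.+1 - w N.+1 = g N - w N.
  move=> hN; have N0 : (0 < N)%N by exact: leq_trans n0 hN.
  have updv : upd x' N v = x'.
    by apply/funext => i; rewrite /upd; case: leqP => // hi; rewrite xv // (leq_trans hN) // ltnW.
  have gs : g N = \sum_(y < v) w N * P_s p s v y + g N.+1.
    apply: EFin_inj; rewrite -gE prefix_sum // xv // EFinD big_ord_recr /= updv gE; congr (_ + _)%E.
    rewrite -sumEFin; apply: eq_bigr => y _.
    rewrite (ih y (ltn_ord y)) ?chain_weight_upd ?xv //; last by rewrite /upd ltnn.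
    move=> i /andP[i0 hi]; rewrite /upd; have iN : (i <= N)%N by rewrite -ltnS.
    rewrite iN; case: ltnP => hi2; first exact: hx'.
    have -> : i = N by lia.
    by rewrite xv // ltnW.
  rewrite gs wS // -mulr_sumr -[X in _ = _ - X]mulr1 -(sum_P_s s_gt v) big_ord_recr /=; ring.
pose D := g n - w n.
have Dm m : g (n + m)%N - w (n + m)%N = D.
  by elim: m => [|m ihm]; rewrite ?addn0 // addnS step ?leq_addr.
have wm m : w (n + m)%N = w n * P_s p s v v ^+ m.
  elim: m => [|m ihm]; first by rewrite addn0 expr0 mulr1.
  by rewrite addnS wS ?leq_addr // ihm exprSr mulrA.
(* Along the stay at v, [g] tends to 0 because no partition allows it forever, and [w] because it is
   multiplied at each step by a holding probability below 1. *)
have D0 : D = 0.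
  have cg : g (n + m)%N @[m --> \oo] --> (0 : R) by exact: cvg_prefix.
  have cw : w n * P_s p s v v ^+ m @[m --> \oo] --> (w n * 0 : R).
    apply: cvgM; first exact: cvg_cst.
    by have /andP[h1 h2] : 0 <= P_s p s v v < 1 by [exact: P_s_diag_lt1]; apply: cvg_expr;
      rewrite ger0_norm.
  have cd : g (n + m)%N - w n * P_s p s v v ^+ m @[m --> \oo] --> (0 - w n * 0 : R) by exact: cvgB.
  rewrite mulr0 subr0 in cd.
  have e : (fun m => g (n + m)%N - w n * P_s p s v v ^+ m) = (fun=> D).
    by apply/funext => m; rewrite -wm Dm.
  rewrite e in cd; exact: (cvg_unique _ (cvg_cst D) cd).
have -> : prefix_set n x = prefix_set n x' by rewrite prefix_upd.
rewrite gE; congr (_%:E); transitivity (w n); first by apply/eqP; rewrite -subr_eq0 -/D D0.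
rewrite /w /chain_weight /x' /upd n0; congr (_ * _); apply: eq_big_nat => i /andP[_ hi].
by rewrite hi (ltnW hi).
Qed.

Lemma nu_prefix n x : (0 < n)%N -> nu (prefix_set n x) = (cw x n)%:E.
Proof.
move=> n0; have [hx|] := pselect (forall i, (0 < i < n)%N -> (x i.+1 <= x i)%N); last first.
  move=> h; have [i hi xi] : exists2 i, (0 < i < n)%N & (x i < x i.+1)%N.
    apply: contrapT => h2; apply: h => i hi; rewrite leqNgt; apply/negP => h3; apply: h2.
    by exists i.
  by rewrite (prefix_eq0 hi xi) measure0 (chain_weight_eq0 s hi xi).
exact: (nu_prefix_decr n0 hx (erefl (x n))).
Qed.

End Prefixes.

Theorem theorem1p8 (R : realType) (p : nat) (s : R)
  (K : fieldType) (absK : K -> R)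
  (vol : forall N : nat, {measure set (MatNm absK p N) -> \bar R})
  (M : probability (MatInfm absK p) R)
  (d : measure_display) (Omega : measurableType d) (P : probability Omega R)
  (V : Idx -> Omega -> K)
  (nu : probability Deltam R) :
  prime p -> -1 < s ->
  is_Qp p absK ->
  is_haar vol ->
  (forall (N : nat) (B : set (MatNm absK p N)), measurable B ->
     M (corner N @^-1` B) = MsN vol s B) ->
  iid_haar_Zp absK p P V ->
  (forall A : set (MatInfm absK p), measurable A ->
     M A = (\int[nu]_k mu absK p P V (sval k) A)%E) ->
  [/\ nu Delta0 = 1%E,
      (forall (n : nat) (x : nat -> nat), (1 <= n)%N ->
         nu [set k : Deltam | exists lam : seq nat,
                [/\ is_partition lam, sval k = padf lam
                  & forall i : nat, (1 <= i <= n)%N -> Xv lam i = x i]] =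
         (pi_s p s (x 1%N) * \prod_(1 <= i < n) P_s p s (x i) (x i.+1))%:E)
    & (forall lam : seq nat, is_partition lam ->
         nu [set k : Deltam | sval k = padf lam] = (nu_formula p s lam)%:E)].
Proof.
move=> Hp s_gt HQ vol_haar M_corner iid nu_mix.
have {}Hp : prime_nat p by exact: Hp.
have {}HQ : Qp_field p absK by exact: HQ.
have nul lam : is_partition lam -> nu (lam_set lam) = (level_lim p s (conj_part lam))%:E.
  exact: (nu_lam s_gt vol_haar M_corner iid nu_mix).
split.
- exact: (nu_Delta0 s_gt vol_haar M_corner iid nu_mix).
- move=> n x n0; exact: (nu_prefix s_gt nul).
- by move=> lam hl; rewrite nu_formulaE; exact: nul.
Qed.
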